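(* Let $x$ be a point of an irreducible oriented pseudomanifold $X$. For any Zariski open neighborhood $V$ of $x$ in $X$, there exists a Zariski open neighborhood $U$ of $x$ with $U\subset V$ such that $U$ is a $K(\pi,1)$ space with $\pi$ a free group.
   Context: An irreducible pseudomanifold of dimension $n$ is a polyhedron $X$ with a triangulation in which every simplex is a face of an $n$-simplex, every $(n-1)$-simplex is a face of exactly two $n$-simplices, and any two $n$-simplices are joined by a sequence of $n$-simplices in which consecutive ones share an $(n-1)$-face. An orientation is a choice of orientation of each $n$-simplex such that the two orientations induced on each $(n-1)$-simplex from the two adjacent $n$-simplices are opposite. An open subset $U$ of $X$ is called Zariski open if $X-U$ is a subcomplex of codimension at least $2$ for some triangulation of $X$ (triangulations are compatible with the PL structure). *)

(* Defs.v *)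
From Stdlib Require Import Relation_Operators.
From HB Require Import structures.
From mathcomp Require Import all_boot all_order all_algebra all_fingroup finmap.
From mathcomp Require Import all_classical all_reals topology normedtype.

Set Implicit Arguments.
Unset Strict Implicit.
Unset Printing Implicit Defensive.

Import Order.TTheory GRing.Theory Num.Theory.
Import numFieldNormedType.Exports.

Local Open Scope classical_set_scope.
Local Open Scope ring_scope.

(** * Polyhedra and triangulations

    Polyhedra are subsets of Euclidean space carried by a locally finite
    geometric simplicial complex.  A simplex is represented by its finite
    nonempty set of vertices; a complex is a set of simplices. *)

Definition hull (R : realType) (N : nat) (s : {fset 'rV[R]_N}) :
    set 'rV[R]_N :=
  [set p | exists w : 'rV[R]_N -> R,
    [/\ forall v, v \in s -> 0 <= w v,
        \sum_(v <- s) w v = 1 &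
        p = \sum_(v <- s) w v *: v]].

Definition affinely_independent (R : realType) (N : nat)
    (s : {fset 'rV[R]_N}) : Prop :=
  forall w : 'rV[R]_N -> R,
    \sum_(v <- s) w v = 0 -> \sum_(v <- s) w v *: v = 0 ->
    forall v, v \in s -> w v = 0.

(* Since [hull fset0] is empty, [sc_inter] says that two simplices are
   disjoint or meet along a common face. *)
Record simplicial_complex (R : realType) (N : nat)
    (K : set {fset 'rV[R]_N}) : Prop := SimplicialComplex {
  sc_nonempty : forall s, K s -> s != fset0;
  sc_independent : forall s, K s -> affinely_independent s;
  sc_face : forall s t, K s -> (t `<=` s)%fset -> t != fset0 -> K t;
  sc_inter : forall s t, K s -> K t ->
    hull s `&` hull t = hull (s `&` t)%fset
}.

Definition carrier (R : realType) (N : nat) (K : set {fset 'rV[R]_N}) :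
    set 'rV[R]_N :=
  \bigcup_(s in K) hull s.

Definition locally_finite_complex (R : realType) (N : nat)
    (K : set {fset 'rV[R]_N}) : Prop :=
  forall p, carrier K p -> exists2 B : set 'rV[R]_N, nbhs p B &
    finite_set [set s | K s /\ hull s `&` B !=set0].

(* The linear triangulations of the subset X of 'rV[R]_N.  The image of a
   subcomplex under a piecewise linear homeomorphism from another complex onto
   X is, after subdivision, a subcomplex of the same dimension of a linear
   triangulation, so these account for all triangulations compatible with the
   PL structure of X. *)
Definition triangulates (R : realType) (N : nat)
    (K : set {fset 'rV[R]_N}) (X : set 'rV[R]_N) : Prop :=
  [/\ simplicial_complex K, locally_finite_complex K & carrier K = X].

Definition subcomplex (R : realType) (N : nat)
    (L K : set {fset 'rV[R]_N}) : Prop :=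
  L `<=` K /\
  forall s t, L s -> (t `<=` s)%fset -> t != fset0 -> L t.

Definition is_simplex (R : realType) (N : nat) (K : set {fset 'rV[R]_N})
    (d : nat) (s : {fset 'rV[R]_N}) : Prop :=
  K s /\ #|` s| = d.+1.

(** * Pseudomanifolds *)

(* A facet is an (n-1)-simplex: n vertices.  There is none when n = 0. *)
Definition is_facet (R : realType) (N : nat) (K : set {fset 'rV[R]_N})
    (n : nat) (f : {fset 'rV[R]_N}) : Prop :=
  K f /\ #|` f| = n.

Definition share_facet (R : realType) (N : nat) (K : set {fset 'rV[R]_N})
    (n : nat) (s t : {fset 'rV[R]_N}) : Prop :=
  [/\ is_simplex K n s, is_simplex K n t &
      exists f, [/\ is_facet K n f, (f `<=` s)%fset & (f `<=` t)%fset]].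

Record irreducible_pseudomanifold (R : realType) (N n : nat)
    (X : set 'rV[R]_N) (K : set {fset 'rV[R]_N}) : Prop :=
  IrreduciblePseudomanifold {
  pm_triangulates : triangulates K X;
  pm_pure : forall s, K s -> exists2 t, is_simplex K n t & (s `<=` t)%fset;
  pm_two : forall f, is_facet K n f -> exists t1 t2, t1 != t2 /\
    forall t, is_simplex K n t /\ (f `<=` t)%fset <-> t = t1 \/ t = t2;
  pm_connected : forall s t, is_simplex K n s -> is_simplex K n t ->
    clos_refl_trans _ (share_facet K n) s t
}.

Definition vertex_ordering (R : realType) (N m : nat)
    (s : {fset 'rV[R]_N}) (v : m.-tuple 'rV[R]_N) : Prop :=
  uniq v /\ v =i s.

(* [o v] tells whether the ordering v of the vertices of an n-simplex is
   positive; [orient_alternating] makes it an orientation of each n-simplex.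
   If w orders the vertices of a facet f, the orientation induced on f by the
   n-simplex v |` f gives w the sign of v :: w. *)
Record orientation (R : realType) (N n : nat) (K : set {fset 'rV[R]_N})
    (o : n.+1.-tuple 'rV[R]_N -> bool) : Prop := Orientation {
  orient_alternating : forall s v, is_simplex K n s -> vertex_ordering s v ->
    forall g : 'S_n.+1,
      o [tuple tnth v (g i) | i < n.+1] = odd_perm g (+) o v;
  orient_opposite : forall f (w : n.-tuple 'rV[R]_N) v1 v2,
    is_facet K n f -> vertex_ordering f w ->
    v1 \notin f -> v2 \notin f -> v1 != v2 ->
    K (v1 |` f)%fset -> K (v2 |` f)%fset ->
    o [tuple of v1 :: w] = ~~ o [tuple of v2 :: w]
}.

(* n is the dimension of X. *)
Definition zariski_open (R : realType) (N n : nat) (X U : set 'rV[R]_N) :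
    Prop :=
  [/\ U `<=` X,
      exists2 O : set 'rV[R]_N, open O & U = X `&` O &
      exists T L : set {fset 'rV[R]_N},
        [/\ triangulates T X, subcomplex L T, carrier L = X `\` U &
            forall s d, is_simplex L d s -> (d + 2 <= n)%N]].

(** * Homotopy groups and K(pi, 1) spaces

    Spaces are subsets U of a topological space E with the induced topology;
    maps to U are functions to E, restricted to a subset C of their domain. *)

Definition map_into (T E : topologicalType) (C : set T) (U : set E)
    (f : T -> E) : Prop :=
  {within C, continuous f} /\ (forall t, C t -> U (f t)).

Definition unit_segment (R : realType) : set R := `[0, 1]%classic.
Arguments unit_segment R : clear implicits.

Definition homotopic_rel (R : realType) (T E : topologicalType)
    (C B : set T) (U : set E) (f g : T -> E) : Prop :=
  exists H : R * T -> E,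
    [/\ map_into (T := (R * T)%type) (unit_segment R `*` C) U H,
        forall t, C t -> H (0, t) = f t,
        forall t, C t -> H (1, t) = g t &
        forall r t, unit_segment R r -> B t -> H (r, t) = f t].

Definition is_path (R : realType) (E : topologicalType) (U : set E)
    (x y : E) (p : R -> E) : Prop :=
  [/\ map_into (unit_segment R) U p, p 0 = x & p 1 = y].

Definition path_connected (R : realType) (E : topologicalType) (U : set E) :
    Prop :=
  forall x y, U x -> U y -> exists p : R -> E, is_path U x y p.

Definition path_homotopic (R : realType) (E : topologicalType) (U : set E)
    (p q : R -> E) : Prop :=
  homotopic_rel R (unit_segment R) [set 0; 1] U p q.

Definition path_concat (R : realType) (E : Type) (p q : R -> E) : R -> E :=
  fun t => if t <= 2^-1 then p (2 * t) else q (2 * t - 1).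

(* A map phi as below is the same thing as a group isomorphism from the
   quotient of the loops by homotopy, with the product induced by
   concatenation, onto G. *)
Definition pi1_isomorphic (R : realType) (E : topologicalType) (U : set E)
    (x : E) (G : groupType) : Prop :=
  exists phi : (R -> E) -> G,
    [/\ forall p q, is_path U x x p -> is_path U x x q ->
          phi (path_concat p q) = (phi p * phi q)%g,
        forall p q, is_path U x x p -> is_path U x x q ->
          (phi p = phi q <-> path_homotopic U p q) &
        forall a : G, exists2 p, is_path U x x p & phi p = a].

Definition cube (R : realType) (k : nat) : set 'rV[R]_k :=
  [set t | forall i, 0 <= t ord0 i <= 1].
Arguments cube R k : clear implicits.

Definition cube_boundary (R : realType) (k : nat) : set 'rV[R]_k :=
  [set t | cube R k t /\ exists i, t ord0 i = 0 \/ t ord0 i = 1].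
Arguments cube_boundary R k : clear implicits.

(* The elements of pi_k(U, x) are the classes, under homotopy relative to the
   boundary, of the maps from the k-cube to U sending its boundary to x. *)
Definition homotopy_group_trivial (R : realType) (E : topologicalType)
    (U : set E) (x : E) (k : nat) : Prop :=
  forall f : 'rV[R]_k -> E,
    map_into (cube R k) U f ->
    (forall t, cube_boundary R k t -> f t = x) ->
    homotopic_rel R (cube R k) (cube_boundary R k) U f (fun=> x).

Definition K_pi_1 (R : realType) (E : topologicalType) (G : groupType)
    (U : set E) : Prop :=
  [/\ U !=set0,
      path_connected R U &
      forall x, U x ->
        pi1_isomorphic R U x G /\
        forall k, (2 <= k)%N -> homotopy_group_trivial R U x k].

Definition free_group (G : groupType) : Prop :=
  exists S : set G, forall (H : groupType) (h : G -> H),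
    exists2 phi : {multiplicative G -> H},
      (forall a, S a -> phi a = h a) &
      forall psi : {multiplicative G -> H},
        (forall a, S a -> psi a = h a) -> psi =1 phi.

(* Main.v *)
Require Import Defs.
From Stdlib Require Import Relation_Operators.
From HB Require Import structures.
From mathcomp Require Import all_boot all_order all_algebra all_fingroup finmap.
From mathcomp Require Import all_classical all_reals topology normedtype.
From mathcomp Require Import ring lra.

Set Implicit Arguments.
Unset Strict Implicit.
Unset Printing Implicit Defensive.

Import Order.TTheory GRing.Theory Num.Theory.
Import numFieldNormedType.Exports.

Local Open Scope classical_set_scope.
Local Open Scope ring_scope.

(** Let [T] be a triangulation of [X] in which the complement of [V] is a
    subcomplex.  Take for [U] the complement of all simplices of [T] of dimension
    at most [n - 2] that do not contain [x].  Since [x] is in [V], these include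
    the simplices outside of [V], so that [U] is contained in [V].  What is left
    is the open star of [x], and the interiors of the n-simplices and of the
    facets.

    The graph has a vertex at [x], one at the barycenter of every n-simplex and
    of every facet that does not contain [x], and an edge from the center of every
    n-simplex (which is [x] if the simplex contains [x]) to the barycenter of each
    of its facets that does not contain [x].  In every n-simplex, explicit
    piecewise rational formulas in the barycentric coordinates push [U] along
    segments onto this graph ([dual_graph_retraction]).  They fit together because
    the lower dimensional faces on which they would be undefined have been
    removed, unless they contain [x], in which case they are sent to [x].

    Connectedness of [U] is seen in the triangulation [K] that makes [X] a
    pseudomanifold: a path that crosses facets can be put in general position with
    respect to simplices of codimension 2, whatever triangulation they come from
    ([complement_connected]).  General position also shows that the simplices of
    [T] have dimension at most [n] ([triangulation_dimension]).

    It remains to see that a path connected set [U] that retracts in this way onto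
    a graph is a K(pi, 1) space with pi free ([graph_K_pi_1]).  All that is used of
    the topology of the graph is the position (a vertex or an open edge) of the
    image of each point of [U], together with the fact that near a point only the
    positions specializing its own occur.  Transporting labels between nearby
    positions gives a theory of lifts ([local_system], [lift_family],
    [lift_star_shaped]) that is applied twice.

    Labels in the universal covering tree of the graph, that is, paths without
    backtracking, give the triviality of the higher homotopy groups
    ([graph_aspherical]): a map from a cube lifts, its labels have bounded length,
    and the longest labels can be shortened, one step at a time, by pulling back
    the last edge ([tree_labelled_push]).  This keeps the image of the boundary of
    the cube a point, though a moving one; a reparametrization of the cube then
    makes the homotopy relative to the boundary ([nullhomotopic_rel_boundary]).

    Labels in a group [H], multiplied by a given factor when an edge is entered
    from its second end, give morphisms from the fundamental group to [H]; with
    the factor 1 on a spanning tree, the factors on the other edges are the values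
    on the corresponding loops.  These loops generate, because the classes of the
    initial parts of a loop, suitably closed up, form a lift of it
    ([holonomy_morphism]).  Hence the universal property of free groups
    ([fundamental_group_free]). *)

(** * Maps into a subset *)

Lemma within_continuousP (T E : topologicalType) (C : set T) (f : T -> E) :
  {within C, continuous f} <->
  forall x, C x -> forall B, nbhs (f x) B -> \forall y \near x, C y -> B (f y).
Proof.
rewrite subspace_continuousP; split=> h x Cx.
  by move=> B /(h x Cx).
move=> B /(h x Cx) nB; exact: nB.
Qed.

Section Within.
Context {T E : topologicalType}.
Implicit Types (C D : set T) (U : set E) (f g : T -> E).

Lemma eq_map_into C U f g :
  (forall t, C t -> f t = g t) -> map_into C U f -> map_into C U g.
Proof.
move=> fg [cf Uf]; split; last by move=> t Ct; rewrite -fg//; exact: Uf.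
apply: subspace_eq_continuous cf => t /set_mem Ct; exact: fg.
Qed.

Lemma continuous_map_into C U f :
  continuous f -> (forall t, C t -> U (f t)) -> map_into C U f.
Proof. by move=> cf Uf; split=> //; exact: continuous_subspaceT. Qed.

Lemma map_into_cst C U (e : E) : U e -> map_into C U (fun=> e).
Proof. by move=> Ue; apply: continuous_map_into => // t; exact: cvg_cst. Qed.

(** Away from the level set [phi t = c] only one of the two maps matters; on it
    they agree, so that a neighborhood of the common value serves both. *)
Lemma map_into_paste (R : realType) C U f g (phi : T -> R) (c : R) :
  {within C, continuous phi} ->
  map_into (C `&` [set t | phi t <= c]) U f ->
  map_into (C `&` [set t | c <= phi t]) U g ->
  (forall t, C t -> phi t = c -> f t = g t) ->
  map_into C U (fun t => if phi t <= c then f t else g t).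
Proof.
move=> cphi [cf Uf] [cg Ug] fg; move/within_continuousP in cphi;
  move/within_continuousP in cf; move/within_continuousP in cg; split; last first.
  move=> t Ct; case: ifPn => [tc|]; first exact: Uf.
  by rewrite -ltNge => /ltW tc; exact: Ug.
apply/within_continuousP => x Cx B.
case: (ltgtP (phi x) c) => [xc|xc|xc] nB.
- have /(cphi x Cx) : nbhs (phi x) [set r | r < c].
    by apply: open_nbhs_nbhs; split => //; exact: open_lt.
  have := cf x (conj Cx (ltW xc)) B nB; apply: filterS2 => y h1 h2 Cy.
  have h := h2 Cy; rewrite (ltW h); apply: h1; split=> //; exact: ltW.
- have /(cphi x Cx) : nbhs (phi x) [set r | c < r].
    by apply: open_nbhs_nbhs; split => //; exact: open_gt.
  have := cg x (conj Cx (ltW xc)) B nB; apply: filterS2 => y h1 h2 Cy.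
  have h := h2 Cy; rewrite leNgt h /=; apply: h1; split=> //; exact: ltW.
- have fgx : f x = g x by apply: fg.
  have xc1 : phi x <= c by rewrite xc.
  have xc2 : c <= phi x by rewrite xc.
  have := cg x (conj Cx xc2) B; rewrite -fgx => /(_ nB).
  have := cf x (conj Cx xc1) B nB; apply: filterS2 => y h1 h2 Cy.
  case: ifPn => [yc|]; first exact: h1.
  by rewrite -ltNge => /ltW yc; exact: h2.
Qed.

End Within.

Lemma map_into_comp (T S E : topologicalType) (C : set T) (D : set S)
    (U : set E) (f : T -> S) (g : S -> E) :
  map_into C D f -> map_into D U g -> map_into C U (g \o f).
Proof.
move=> [/within_continuousP cf Df] [/within_continuousP cg Ug]; split.
  apply/within_continuousP => x Cx B nB.
  have := cf x Cx _ (cg _ (Df _ Cx) _ nB).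
  by apply: filterS => y h Cy; apply: h => //; exact: Df.
by move=> t Ct /=; apply/Ug/Df.
Qed.

Lemma within_continuous_pair (T S E : topologicalType) (C : set T)
    (f : T -> S) (g : T -> E) :
  {within C, continuous f} -> {within C, continuous g} ->
  {within C, continuous (fun t => (f t, g t))}.
Proof.
move=> /within_continuousP cf /within_continuousP cg.
apply/within_continuousP => x Cx B [[B1 B2] [/= n1 n2] B12].
have := cf x Cx _ n1; have := cg x Cx _ n2.
by apply: filterS2 => y h2 h1 Cy; apply: B12; split; [exact: h1|exact: h2].
Qed.

Lemma map_into_pair (T S E : topologicalType) (C : set T)
    (D : set S) (U : set E) (f : T -> S) (g : T -> E) :
  map_into C D f -> map_into C U g ->
  map_into C (D `*` U) (fun t => (f t, g t)).
Proof.
move=> [cf Df] [cg Ug]; split; first exact: within_continuous_pair.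
by move=> t Ct; split; [exact: Df|exact: Ug].
Qed.

Lemma within_continuous_interp (R : realType) (T : topologicalType)
    (E : normedModType R) (C : set T) (f g : T -> E) (r : T -> R) :
  {within C, continuous r} -> {within C, continuous f} ->
  {within C, continuous g} ->
  {within C, continuous (fun t => (1 - r t) *: f t + r t *: g t)}.
Proof.
move=> cr cf cg; move/subspace_continuousP in cr.
move/subspace_continuousP in cf; move/subspace_continuousP in cg.
apply/subspace_continuousP => x Cx.
have c1 : (1 - r t) @[t --> within C (nbhs x)] --> 1 - r x.
  by apply: cvgB (cr x Cx); apply: cvg_cst.
exact: cvgD (cvgZ c1 (cf x Cx)) (cvgZ (cr x Cx) (cg x Cx)).
Qed.

Lemma continuous_pair (T S E : topologicalType) (f : T -> S) (g : T -> E) :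
  continuous f -> continuous g -> continuous (fun t => (f t, g t)).
Proof. by move=> cf cg x; apply: cvg_pair; [exact: cf|exact: cg]. Qed.

Lemma continuous_fst (T S : topologicalType) : continuous (@fst T S).
Proof. by move=> x; exact: cvg_fst. Qed.

Lemma continuous_snd (T S : topologicalType) : continuous (@snd T S).
Proof. by move=> x; exact: cvg_snd. Qed.

Lemma continuous_affine (R : realType) (T : topologicalType) (f : T -> R)
    (a b : R) : continuous f -> continuous (fun t => a * f t + b).
Proof.
move=> cf x; apply: cvgD; last exact: cvg_cst.
by apply: cvgM; [exact: cvg_cst|exact: cf].
Qed.

Lemma continuous_maxr (R : realType) (T : topologicalType) (f g : T -> R) :
  continuous f -> continuous g -> continuous (fun t => Num.max (f t) (g t)).
Proof. by move=> cf cg x; exact: (@continuous_max R T f g x (cf x) (cg x)). Qed.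

Lemma continuous_minr (R : realType) (T : topologicalType) (f g : T -> R) :
  continuous f -> continuous g -> continuous (fun t => Num.min (f t) (g t)).
Proof. by move=> cf cg x; exact: (@continuous_min R T f g x (cf x) (cg x)). Qed.

Lemma continuous_prod (R : realType) (T : topologicalType) (J : Type)
    (s : seq J) (f : J -> T -> R) :
  (forall j, continuous (f j)) -> continuous (fun t => \prod_(j <- s) f j t).
Proof.
move=> cf; elim: s => [|j s IHs].
  by under eq_fun do rewrite big_nil; exact: cst_continuous.
by under eq_fun do rewrite big_cons; move=> x; apply: cvgM; [exact: cf|exact: IHs].
Qed.

Lemma continuous_sumr (R : realType) (T : topologicalType) (J : Type) (r : seq J)
    (f : J -> T -> R) :
  (forall j, continuous (f j)) -> continuous (fun t => \sum_(j <- r) f j t).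
Proof.
move=> cf; elim: r => [|j r IHr].
  by under eq_fun do rewrite big_nil; exact: cst_continuous.
by under eq_fun do rewrite big_cons; move=> x; apply: cvgD; [exact: cf|exact: IHr].
Qed.

Lemma continuous_mulr (R : realType) (T : topologicalType) (f g : T -> R) :
  continuous f -> continuous g -> continuous (fun t => f t * g t).
Proof. by move=> cf cg x; apply: cvgM; [exact: cf|exact: cg]. Qed.

Lemma continuous_affine_id (R : realType) (a b : R) :
  continuous (fun t : R => a * t + b).
Proof. by apply: (continuous_affine (f := @id R)) => x; exact: cvg_id. Qed.

(** * Homotopies *)

Section Homotopies.
Variable R : realType.
Notation I := (unit_segment R).

Lemma in_segment (r : R) : I r <-> (0 <= r <= 1).
Proof. by rewrite /unit_segment /= in_itv. Qed.

(** Besides the homotopies relative to a subset, this covers those whose stages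
    are constant on a subset without being fixed there, as is the case of the
    homotopies that are induced by a deformation of the target. *)
Definition homotopic_through (T E : topologicalType) (C : set T) (U : set E)
    (Q : (T -> E) -> Prop) (f g : T -> E) : Prop :=
  exists H : R * T -> E,
    [/\ map_into (T := (R * T)%type) (I `*` C) U H,
        forall t, C t -> H (0, t) = f t,
        forall t, C t -> H (1, t) = g t &
        forall r, I r -> Q (fun t => H (r, t))].

Section General.
Context {T E : topologicalType}.
Implicit Types (C B : set T) (U : set E) (f g h : T -> E).

Lemma homotopic_relE C B U f g : homotopic_rel R C B U f g <->
  homotopic_through C U (fun h => forall t, B t -> h t = f t) f g.
Proof.
split=> -[H [h1 h2 h3 h4]]; exists H; split=> //.
  by move=> r Ir t Bt; exact: h4.
by move=> r t Ir Bt; exact: (h4 r Ir t Bt).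
Qed.

Lemma homotopic_through_trans C U Q f g h :
  homotopic_through C U Q f g -> homotopic_through C U Q g h ->
  homotopic_through C U Q f h.
Proof.
move=> [H [cH H0 H1 HQ]] [K [cK K0 K1 KQ]].
exists (fun rt => if rt.1 <= 2^-1 then H (2 * rt.1 + 0, rt.2)
                  else K (2 * rt.1 + -1, rt.2)); split.
- apply: map_into_paste.
  + by apply: continuous_subspaceT; exact: continuous_fst.
  + apply: (map_into_comp (f := fun rt : R * T => (2 * rt.1 + 0, rt.2))) cH.
    apply: continuous_map_into.
      apply: continuous_pair; last exact: continuous_snd.
      exact: continuous_affine (@continuous_fst _ _).
    move=> [r t] [[/= /in_segment Ir Ct] r2]; split=> //=.
    by apply/in_segment; lra.
  + apply: (map_into_comp (f := fun rt : R * T => (2 * rt.1 + -1, rt.2))) cK.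
    apply: continuous_map_into.
      apply: continuous_pair; last exact: continuous_snd.
      exact: continuous_affine (@continuous_fst _ _).
    move=> [r t] [[/= /in_segment Ir Ct] r2]; split=> //=.
    by apply/in_segment; lra.
  + move=> [r t] [/= Ir Ct] ->.
    by rewrite addr0 mulfV ?pnatr_eq0// subrr H1// K0.
- by move=> t Ct /=; rewrite ifT ?mulr0 ?addr0 ?H0//; lra.
- move=> t Ct /=; rewrite ifF; last by lra.
  by rewrite (_ : 2 * 1 + -1 = 1 :> R) ?K1//; lra.
- move=> r /in_segment Ir /=; case: (leP r 2^-1) => r2.
    by apply: HQ; apply/in_segment; lra.
  by apply: KQ; apply/in_segment; lra.
Qed.

Lemma homotopic_rel_refl C B U f :
  map_into C U f -> homotopic_rel R C B U f f.
Proof.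
move=> cf; exists (f \o snd); split=> //.
apply: (map_into_comp _ cf); apply: continuous_map_into.
  exact: continuous_snd.
by move=> [r t] [].
Qed.

Lemma homotopic_rel_sym C B U f g : B `<=` C ->
  homotopic_rel R C B U f g -> homotopic_rel R C B U g f.
Proof.
move=> BC [H [cH H0 H1 HB]].
exists (fun rt => H (-1 * rt.1 + 1, rt.2)); split.
- apply: (map_into_comp (f := fun rt : R * T => (-1 * rt.1 + 1, rt.2))) cH.
  apply: continuous_map_into.
    apply: continuous_pair; last exact: continuous_snd.
    exact: continuous_affine (@continuous_fst _ _).
  move=> [r t] [/= /in_segment Ir Ct]; split=> //=.
  by apply/in_segment; lra.
- by move=> t Ct /=; rewrite mulr0 add0r H1.
- by move=> t Ct /=; rewrite mulr1 addNr H0.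
- move=> r t /in_segment Ir Bt /=; rewrite HB ?HB//; last by apply/in_segment; lra.
  rewrite -H1; last exact: BC.
  by rewrite HB//; apply/in_segment; lra.
Qed.

Lemma homotopic_rel_trans C B U f g h : B `<=` C ->
  homotopic_rel R C B U f g -> homotopic_rel R C B U g h ->
  homotopic_rel R C B U f h.
Proof.
move=> BC fg gh; have fgB t : B t -> g t = f t.
  case: fg => H [_ _ H1 HB] Bt; rewrite -H1 ?HB//; last exact: BC.
  by apply/in_segment; lra.
apply/homotopic_relE.
move: fg gh => /homotopic_relE fg /homotopic_relE [H [h1 h2 h3 h4]].
apply: homotopic_through_trans fg _; exists H; split=> // r Ir t Bt.
by rewrite h4// fgB.
Qed.

Lemma eq_homotopic_rel C B U f g f' g' : B `<=` C ->
  (forall t, C t -> f t = f' t) -> (forall t, C t -> g t = g' t) ->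
  homotopic_rel R C B U f g -> homotopic_rel R C B U f' g'.
Proof.
move=> BC ff' gg' [H [h1 h2 h3 h4]]; exists H; split=> //.
- by move=> t Ct; rewrite h2// ff'.
- by move=> t Ct; rewrite h3// gg'.
- by move=> r t Ir Bt; rewrite h4// ff'//; exact: BC.
Qed.

(** The straight-line homotopy, before a map [Q]: with [Q] a path it gives the
    invariance under reparametrization, and with [Q] the identity the homotopy
    of two maps between which all segments lie in [U]. *)
Lemma homotopic_segments (F : normedModType R) (D : set F) C B U
    (Q : F -> E) (a b : T -> F) :
  map_into D U Q ->
  {within C, continuous a} -> {within C, continuous b} ->
  (forall r t, I r -> C t -> D ((1 - r) *: a t + r *: b t)) ->
  (forall r t, I r -> B t -> Q ((1 - r) *: a t + r *: b t) = Q (a t)) ->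
  homotopic_rel R C B U (Q \o a) (Q \o b).
Proof.
move=> cQ ca cb Dab abB.
exists (fun rt => Q ((1 - rt.1) *: a rt.2 + rt.1 *: b rt.2)); split.
- apply: map_into_comp cQ; split; last by move=> [r t] [/= Ir Ct]; exact: Dab.
  have c2 (c : T -> F) : {within C, continuous c} ->
      {within I `*` C, continuous (fun rt : R * T => c rt.2)}.
    move=> cc; have cm : map_into C setT c by split.
    suff : map_into (I `*` C) setT (c \o snd : R * T -> F) by case.
    apply: map_into_comp cm; apply: continuous_map_into.
      exact: continuous_snd.
    by move=> [r t] [].
  apply: within_continuous_interp; [|exact: c2|exact: c2].
  by apply: continuous_subspaceT; exact: continuous_fst.
- by move=> t Ct /=; rewrite subr0 scale1r scale0r addr0.
- by move=> t Ct /=; rewrite subrr scale0r scale1r add0r.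
- by move=> r t Ir Bt /=; exact: abB.
Qed.

End General.

End Homotopies.

(** * Paths and the fundamental group *)

Section Paths.
Variable R : realType.
Notation I := (unit_segment R).
Context {E : topologicalType}.
Implicit Types (U : set E) (p q : R -> E) (x y z : E).

Lemma in_segment0 : I 0. Proof. by apply/in_segment; lra. Qed.
Lemma in_segment1 : I 1. Proof. by apply/in_segment; lra. Qed.

Lemma two_sub_one : 2 * 1 - 1 = 1 :> R. Proof. by ring. Qed.

Lemma ends_in_segment : [set 0; 1] `<=` I.
Proof. by move=> t [->|->]; [exact: in_segment0|exact: in_segment1]. Qed.

Lemma is_path_ends U x y p : is_path U x y p -> U x /\ U y.
Proof.
by move=> [[_ Up] <- <-]; split; apply: Up;
  [exact: in_segment0|exact: in_segment1].
Qed.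

Lemma is_path_cst U x : U x -> is_path U x x (fun _ : R => x).
Proof. by move=> Ux; split=> //; exact: map_into_cst. Qed.

Lemma map_into_affine (a b : R) : 0 <= b <= 1 -> 0 <= a + b <= 1 ->
  map_into I I (fun t => a * t + b).
Proof.
move=> b01 ab01; apply: continuous_map_into.
  exact: continuous_affine_id.
by move=> t /in_segment t01; apply/in_segment; nra.
Qed.

Definition path_inv p : R -> E := fun t => p (-1 * t + 1).

Lemma is_path_inv U x y p : is_path U x y p -> is_path U y x (path_inv p).
Proof.
move=> [cp p0 p1]; split; last 2 first.
- by rewrite /path_inv mulr0 add0r.
- by rewrite /path_inv mulr1 addNr.
by apply: (map_into_comp _ cp); apply: map_into_affine; lra.
Qed.

Lemma path_concat_map_into U (T : topologicalType) (C : set T)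
    (a : T -> R -> E) (b : T -> R -> E) :
  map_into (C `*` I) U (fun st => a st.1 st.2) ->
  map_into (C `*` I) U (fun st => b st.1 st.2) ->
  (forall s, C s -> a s 1 = b s 0) ->
  map_into (C `*` I) U (fun st => path_concat (a st.1) (b st.1) st.2).
Proof.
move=> ca cb ab.
have half (c : R) : continuous (fun st : T * R => (st.1, 2 * st.2 + c)).
  apply: continuous_pair; first exact: continuous_fst.
  exact: continuous_affine (@continuous_snd _ _).
have := @map_into_paste _ _ _ (C `*` I) U
  (fun st => a st.1 (2 * st.2 + 0)) (fun st => b st.1 (2 * st.2 + -1))
  snd 2^-1.
move=> paste; apply: eq_map_into (paste _ _ _ _).
- by move=> [s t] _ /=; rewrite /path_concat addr0.
- by apply: continuous_subspaceT; exact: continuous_snd.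
- apply: (map_into_comp (f := fun st : T * R => (st.1, 2 * st.2 + 0)) _ ca); apply: continuous_map_into (half _) _.
  by move=> [s t] [[/= Cs /in_segment t01] t2]; split=> //; apply/in_segment => /=; lra.
- apply: (map_into_comp (f := fun st : T * R => (st.1, 2 * st.2 + -1)) _ cb); apply: continuous_map_into (half _) _.
  by move=> [s t] [[/= Cs /in_segment t01] t2]; split=> //; apply/in_segment => /=; lra.
- move=> [s t] [/= Cs _] ->.
  by rewrite addr0 mulfV ?pnatr_eq0// subrr ab.
Qed.

Lemma is_path_concat U x y z p q : is_path U x y p -> is_path U y z q ->
  is_path U x z (path_concat p q).
Proof.
move=> [cp p0 p1] [cq q0 q1]; split; last 2 first.
- by rewrite /path_concat ifT ?mulr0//; lra.
- by rewrite /path_concat ifF ?two_sub_one//; lra.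
have snd_into : map_into ([set: R] `*` I) I snd.
  apply: continuous_map_into; first exact: continuous_snd.
  by move=> [s t] [].
have := path_concat_map_into (C := [set: R]) (a := fun=> p) (b := fun=> q)
  (map_into_comp snd_into cp) (map_into_comp snd_into cq).
rewrite p1 q0 => /(_ (fun _ _ => erefl)) cpq.
apply: (map_into_comp (f := fun t : R => (0 : R, t))) cpq.
apply: continuous_map_into => //.
by apply: continuous_pair => t; [exact: cvg_cst|exact: cvg_id].
Qed.

Lemma path_homotopic_refl U p : map_into I U p -> path_homotopic U p p.
Proof. exact: homotopic_rel_refl. Qed.

Lemma path_homotopic_sym U p q : path_homotopic U p q -> path_homotopic U q p.
Proof. exact/homotopic_rel_sym/ends_in_segment. Qed.

Lemma path_homotopic_trans U p q r :
  path_homotopic U p q -> path_homotopic U q r -> path_homotopic U p r.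
Proof. exact/homotopic_rel_trans/ends_in_segment. Qed.

Lemma eq_path_homotopic U p q p' q' :
  (forall t, I t -> p t = p' t) -> (forall t, I t -> q t = q' t) ->
  path_homotopic U p q -> path_homotopic U p' q'.
Proof. exact/eq_homotopic_rel/ends_in_segment. Qed.

Lemma path_homotopic_concat U x y z p q p' q' :
  is_path U x y p -> is_path U y z q ->
  path_homotopic U p p' -> path_homotopic U q q' ->
  path_homotopic U (path_concat p q) (path_concat p' q').
Proof.
move=> [cp p0 p1] [cq q0 q1] [H [cH H0 H1 HB]] [K [cK K0 K1 KB]].
exists (fun rt =>
  path_concat (fun t => H (rt.1, t)) (fun t => K (rt.1, t)) rt.2); split.
- apply: (path_concat_map_into (a := fun r t => H (r, t))
    (b := fun r t => K (r, t))).
  + by apply: eq_map_into cH => -[].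
  + by apply: eq_map_into cK => -[].
  + move=> r Ir; rewrite HB//; last by right.
    by rewrite KB ?p1 ?q0//; left.
- move=> t It; rewrite /path_concat/=; move/in_segment in It.
  by case: ifPn => t2; rewrite ?H0 ?K0//; apply/in_segment; lra.
- move=> t It; rewrite /path_concat/=; move/in_segment in It.
  by case: ifPn => t2; rewrite ?H1 ?K1//; apply/in_segment; lra.
- move=> r t Ir [->|->]; rewrite /path_concat/=.
    rewrite (_ : 0 <= 2^-1) ?mulr0; last by lra.
    by apply: HB => //; left.
  rewrite (_ : (1 <= 2^-1) = false) ?two_sub_one; last by lra.
  by apply: KB => //; right.
Qed.

(** The maps from an interval to an interval with given ends are homotopic by
    convexity.  All identities between concatenated paths are instances. *)
Lemma path_homotopic_reparam U p (a b : R -> R) :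
  map_into I U p -> map_into I I a -> map_into I I b ->
  a 0 = b 0 -> a 1 = b 1 -> path_homotopic U (p \o a) (p \o b).
Proof.
move=> cp [ca Ia] [cb Ib] ab0 ab1.
apply: (homotopic_segments (F := R^o) cp ca cb); last first.
  by move=> r t _ [->|->]; rewrite ?ab0 ?ab1 -scalerDl subrK scale1r.
move=> r t /in_segment Ir It; apply/in_segment.
have /in_segment := Ia t It; have /in_segment := Ib t It.
by rewrite /GRing.scale/=; nra.
Qed.

Lemma path_concat_assoc U x y z w p q r :
  is_path U x y p -> is_path U y z q -> is_path U z w r ->
  path_homotopic U (path_concat (path_concat p q) r)
                   (path_concat p (path_concat q r)).
Proof.
move=> hp hq hr.
have hpqr := is_path_concat (is_path_concat hp hq) hr.
set s := path_concat (path_concat p q) r.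
(* The change of time has slopes 1/2, 1 and 2, in this order: it is the maximum
   of three affine functions. *)
pose a (t : R) : R := Num.max (Num.max (2^-1 * t + 0) (1 * t - 4^-1)) (2 * t - 1).
have cs : map_into I U s by case: hpqr.
apply: path_homotopic_sym.
have ca : map_into I I a.
  apply: continuous_map_into; last first.
    move=> t /in_segment t01; apply/in_segment; rewrite /a.
    by rewrite !le_max !ge_max; apply/andP; split; lra.
  by apply: continuous_maxr; first apply: continuous_maxr;
    exact: continuous_affine_id.
have E1 t : t <= 2^-1 -> a t = 2^-1 * t.
  by move=> t2; rewrite /a max_l ?max_l ?addr0//; lra.
have E2 t : 2^-1 <= t -> t <= 3 / 4 -> a t = t - 4^-1.
  by move=> t2 t4; rewrite /a max_l ?max_r ?mul1r//; lra.
have E3 t : 3 / 4 <= t -> a t = 2 * t - 1.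
  by move=> t4; rewrite /a max_r// max_r//; lra.
have cid : map_into I I id by apply: continuous_map_into => // t; exact: cvg_id.
apply: eq_path_homotopic (path_homotopic_reparam (b := id) cs ca cid _ _).
- move=> t /in_segment It; rewrite /s /path_concat /=.
  have [t2|t2] := leP t 2^-1; last have [t4|t4] := leP (2 * t - 1) 2^-1.
  + rewrite E1//; rewrite ifT; last by lra.
    by rewrite ifT; [congr (p _); lra|lra].
  + rewrite E2; [|lra|lra]; rewrite ifT; last by lra.
    by rewrite ifF; [congr (q _); lra|lra].
  + rewrite E3; last by lra.
    by rewrite ifF; [congr (r _); lra|lra].
- by [].
- by rewrite E1 ?mulr0//; lra.
- by rewrite E3 /=; lra.
Qed.

Lemma path_concat_cst_left U x y p : is_path U x y p ->
  path_homotopic U (path_concat (fun=> x) p) p.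
Proof.
move=> [cp p0 p1]; pose a (t : R) : R := Num.max (0 * t + 0) (2 * t - 1).
have ca : map_into I I a.
  apply: continuous_map_into; last first.
    by move=> t /in_segment t01; apply/in_segment; rewrite le_max ge_max; lra.
  by apply: continuous_maxr; exact: continuous_affine_id.
have cid : map_into I I id by apply: continuous_map_into => // t; exact: cvg_id.
apply: eq_path_homotopic (path_homotopic_reparam (b := id) cp ca cid _ _).
- move=> t _; rewrite /path_concat /a /=; have [t2|t2] := leP t 2^-1.
    by rewrite mul0r addr0 max_l ?p0//; lra.
  by rewrite max_r//; lra.
- by [].
- by rewrite /a max_l//; lra.
- by rewrite /a max_r; lra.
Qed.

Lemma path_concat_cst_right U x y p : is_path U x y p ->
  path_homotopic U (path_concat p (fun=> y)) p.
Proof.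
move=> [cp p0 p1]; pose a (t : R) : R := Num.min (2 * t + 0) (0 * t + 1).
have ca : map_into I I a.
  apply: continuous_map_into; last first.
    by move=> t /in_segment t01; apply/in_segment; rewrite ge_min le_min; lra.
  by apply: continuous_minr; exact: continuous_affine_id.
have cid : map_into I I id by apply: continuous_map_into => // t; exact: cvg_id.
apply: eq_path_homotopic (path_homotopic_reparam (b := id) cp ca cid _ _).
- move=> t _; rewrite /path_concat /a /=; have [t2|t2] := leP t 2^-1.
    by rewrite min_l ?addr0//; lra.
  by rewrite min_r ?mul0r ?add0r ?p1//; lra.
- by [].
- by rewrite /a min_l; lra.
- by rewrite /a min_r//; lra.
Qed.

Lemma path_concat_inv U x y p : is_path U x y p ->
  path_homotopic U (path_concat p (path_inv p)) (fun=> x).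
Proof.
move=> [cp p0 p1]; pose a (t : R) : R := Num.min (2 * t + 0) (-2 * t + 2).
have ca : map_into I I a.
  apply: continuous_map_into; last first.
    by move=> t /in_segment t01; apply/in_segment; rewrite ge_min le_min; lra.
  by apply: continuous_minr; exact: continuous_affine_id.
have c0 : map_into I I (fun=> 0) by apply: map_into_cst; exact: in_segment0.
apply: eq_path_homotopic (path_homotopic_reparam cp ca c0 _ _).
- move=> t _; rewrite /path_concat /path_inv /a /=.
  have [t2|t2] := leP t 2^-1.
    by rewrite min_l ?addr0//; lra.
  by rewrite min_r; [congr (p _); lra|lra].
- by move=> t _ /=.
- by rewrite /a min_l; lra.
- by rewrite /a min_r; lra.
Qed.

Lemma path_invK p : path_inv (path_inv p) =1 p.
Proof. by move=> t; rewrite /path_inv; congr (p _); ring. Qed.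

Lemma path_concat_inv_left U x y p : is_path U x y p ->
  path_homotopic U (path_concat (path_inv p) p) (fun=> y).
Proof.
move=> /is_path_inv hp; have := path_concat_inv hp.
apply: eq_path_homotopic => // t _; rewrite /path_concat.
by case: ifP => // _; exact: path_invK.
Qed.

End Paths.

(** * Classes of loops *)

Section LoopClasses.
Variable R : realType.
Context {E : topologicalType}.
Variables (U : set E) (x : E).
Implicit Types (p q : R -> E).

Definition loop_class p : set (R -> E) :=
  [set q | is_path U x x q /\ path_homotopic U p q].

Lemma loop_class_eqP p q : is_path U x x p -> is_path U x x q ->
  loop_class p = loop_class q <-> path_homotopic U p q.
Proof.
move=> hp hq; split=> [pq|pq].
  suff [] : loop_class p q by [].
  by rewrite pq; split=> //; apply: path_homotopic_refl; case: hq.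
apply/seteqP; split=> r [hr h]; split=> //.
  exact: path_homotopic_trans (path_homotopic_sym pq) h.
exact: path_homotopic_trans pq h.
Qed.

Record loop_classes_at : Type := LoopClass {
  loops_of : set (R -> E);
  loops_ofP : exists2 p, is_path U x x p & loops_of = loop_class p
}.

Lemma loops_of_inj : injective loops_of.
Proof.
move=> [A hA] [B hB] /= AB; subst B; congr LoopClass; exact: Prop_irrelevance.
Qed.

Definition class_of p (hp : is_path U x x p) : loop_classes_at :=
  LoopClass (ex_intro2 _ _ p hp erefl).

Definition repr_loop (a : loop_classes_at) : R -> E := sval (cid2 (loops_ofP a)).

Lemma repr_loop_path a : is_path U x x (repr_loop a).
Proof. by rewrite /repr_loop; case: cid2. Qed.

Lemma class_of_eqP p q (hp : is_path U x x p) (hq : is_path U x x q) :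
  class_of hp = class_of hq <-> path_homotopic U p q.
Proof.
rewrite -loop_class_eqP//; split; first by move=> /(congr1 loops_of).
by move=> pq; exact: loops_of_inj.
Qed.

Lemma class_of_repr a : class_of (repr_loop_path a) = a.
Proof.
apply: loops_of_inj => /=; rewrite /repr_loop.
by case: cid2 => p hp /= ->.
Qed.

Lemma repr_class_of p (hp : is_path U x x p) :
  path_homotopic U (repr_loop (class_of hp)) p.
Proof. by apply/(class_of_eqP (repr_loop_path _) hp); rewrite class_of_repr. Qed.

End LoopClasses.

(** The carrier remembers that the base point lies in [U], which makes the
    constant loop the unit. *)
Definition pi1 (R : realType) (E : topologicalType) (U : set E) (x : E)
  of U x : Type := @loop_classes_at R E U x.

Section FundamentalGroup.
Variable R : realType.
Context {E : topologicalType}.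
Variables (U : set E) (x : E) (Ux : U x).
Local Notation G := (@pi1 R E U x Ux).
Implicit Types a b c : G.

HB.instance Definition _ := gen_eqMixin G.
HB.instance Definition _ := gen_choiceMixin G.

Definition pi1_one : G := class_of (@is_path_cst R E U x Ux).
Definition pi1_mul a b : G :=
  class_of (is_path_concat (repr_loop_path a) (repr_loop_path b)).
Definition pi1_inv a : G := class_of (is_path_inv (repr_loop_path a)).

Lemma pi1_mul_class p q (hp : is_path U x x p) (hq : is_path U x x q) :
  pi1_mul (class_of hp) (class_of hq) = class_of (is_path_concat hp hq).
Proof.
apply/class_of_eqP.
by apply: path_homotopic_concat; try exact: repr_loop_path;
  exact: repr_class_of.
Qed.

Lemma pi1_mulA : associative pi1_mul.
Proof.
move=> a b c; rewrite -[a]class_of_repr -[b]class_of_repr -[c]class_of_repr.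
rewrite !pi1_mul_class; apply/esym/class_of_eqP.
exact: path_concat_assoc (repr_loop_path a) (repr_loop_path b)
  (repr_loop_path c).
Qed.

Lemma pi1_mul1 : left_id pi1_one pi1_mul.
Proof.
move=> a; rewrite -[a]class_of_repr pi1_mul_class; apply/class_of_eqP.
exact: path_concat_cst_left (repr_loop_path a).
Qed.

Lemma pi1_mulr1 : right_id pi1_one pi1_mul.
Proof.
move=> a; rewrite -[a]class_of_repr pi1_mul_class; apply/class_of_eqP.
exact: path_concat_cst_right (repr_loop_path a).
Qed.

Lemma pi1_mulV : left_inverse pi1_one pi1_inv pi1_mul.
Proof.
move=> a; rewrite -{2}[a]class_of_repr pi1_mul_class; apply/class_of_eqP.
exact: path_concat_inv_left (repr_loop_path a).
Qed.

Lemma pi1_mulVr : right_inverse pi1_one pi1_inv pi1_mul.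
Proof.
move=> a; rewrite -{1}[a]class_of_repr pi1_mul_class; apply/class_of_eqP.
exact: path_concat_inv (repr_loop_path a).
Qed.

HB.instance Definition _ := isGroup.Build G
  pi1_mulA pi1_mul1 pi1_mulr1 pi1_mulV pi1_mulVr.

End FundamentalGroup.

Section PathCancellation.
Variable R : realType.
Context {E : topologicalType}.
Variable U : set E.
Implicit Types (p q r : R -> E).

Lemma path_concat_invr x y z p r : is_path U x y p -> is_path U y z r ->
  path_homotopic U (path_concat (path_concat p r) (path_inv r)) p.
Proof.
move=> hp hr; have hr' := is_path_inv hr.
apply: (path_homotopic_trans (path_concat_assoc hp hr hr') _).
apply: (path_homotopic_trans _ (path_concat_cst_right hp)).
apply: (path_homotopic_concat hp (is_path_concat hr hr') _ _).
  by apply: path_homotopic_refl; case: hp.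
exact: path_concat_inv hr.
Qed.

Lemma path_concat_invlr x y z p r : is_path U x y p -> is_path U z y r ->
  path_homotopic U (path_concat (path_concat p (path_inv r)) r) p.
Proof.
move=> hp hr; have hr' := is_path_inv hr.
apply: (path_homotopic_trans (path_concat_assoc hp hr' hr) _).
apply: (path_homotopic_trans _ (path_concat_cst_right hp)).
apply: (path_homotopic_concat hp (is_path_concat hr' hr) _ _).
  by apply: path_homotopic_refl; case: hp.
exact: path_concat_inv_left hr.
Qed.

Lemma path_concat_invl x y z p r : is_path U x y p -> is_path U z x r ->
  path_homotopic U (path_concat (path_inv r) (path_concat r p)) p.
Proof.
move=> hp hr; have hr' := is_path_inv hr.
apply: (path_homotopic_trans
  (path_homotopic_sym (path_concat_assoc hr' hr hp)) _).
apply: (path_homotopic_trans _ (path_concat_cst_left hp)).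
apply: (path_homotopic_concat (is_path_concat hr' hr) hp _ _).
  exact: path_concat_inv_left hr.
by apply: path_homotopic_refl; case: hp.
Qed.

Lemma path_concat_canr x y z p q r :
  is_path U x y p -> is_path U x y q -> is_path U y z r ->
  path_homotopic U (path_concat p r) (path_concat q r) -> path_homotopic U p q.
Proof.
move=> hp hq hr pq.
apply: (path_homotopic_trans (path_homotopic_sym (path_concat_invr hp hr)) _).
apply: (path_homotopic_trans _ (path_concat_invr hq hr)).
have hr' := is_path_inv hr.
apply: (path_homotopic_concat (is_path_concat hp hr) hr' pq _).
by apply: path_homotopic_refl; case: hr'.
Qed.

Lemma path_concat_canl x y z p q r :
  is_path U x y p -> is_path U x y q -> is_path U z x r ->
  path_homotopic U (path_concat r p) (path_concat r q) -> path_homotopic U p q.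
Proof.
move=> hp hq hr pq.
apply: (path_homotopic_trans (path_homotopic_sym (path_concat_invl hp hr)) _).
apply: (path_homotopic_trans _ (path_concat_invl hq hr)).
have hr' := is_path_inv hr.
apply: (path_homotopic_concat hr' (is_path_concat hr hp) _ pq).
by apply: path_homotopic_refl; case: hr'.
Qed.

End PathCancellation.

(** The fundamental groupoid of a path connected set: once a path from the base
    point to every point is chosen, every path becomes a loop, and so a group
    element.  This makes one group serve for all base points. *)
Lemma fundamental_groupoid (R : realType) (E : topologicalType) (U : set E)
    (x0 : E) : U x0 -> path_connected R U ->
  exists (G : groupType) (cl : (R -> E) -> G),
  [/\ forall x y z p q, is_path U x y p -> is_path U y z q ->
        cl (path_concat p q) = (cl p * cl q)%g,
      forall x y p q, is_path U x y p -> is_path U x y q ->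
        (cl p = cl q <-> path_homotopic U p q) &
      forall x y a, U x -> U y -> exists2 p, is_path U x y p & cl p = a].
Proof.
move=> Ux0 Upc; pose G : groupType := @pi1 R E U x0 Ux0.
pose T x : R -> E :=
  if pselect (U x) is left Ux then sval (cid (Upc _ _ Ux0 Ux)) else fun=> x0.
have TP x : U x -> is_path U x0 x (T x).
  by rewrite /T; case: pselect => // Ux _; case: cid.
pose conj p := path_concat (path_concat (T (p 0)) p) (path_inv (T (p 1))).
have conjP x y p : is_path U x y p -> is_path U x0 x0 (conj p).
  move=> hp; have [Ux Uy] := is_path_ends hp; rewrite /conj.
  have [_ -> ->] := hp.
  exact: is_path_concat (is_path_concat (TP _ Ux) hp) (is_path_inv (TP _ Uy)).
pose cl p : G := if pselect (is_path U x0 x0 (conj p)) is left hp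
                 then class_of hp else pi1_one R Ux0.
have clE x y p (hp : is_path U x y p) : cl p = class_of (conjP _ _ _ hp).
  rewrite /cl; case: pselect => [h|]; last by move/(_ (conjP _ _ _ hp)).
  by apply/class_of_eqP/path_homotopic_refl; case: h.
have refl x y (p : R -> E) : is_path U x y p -> path_homotopic U p p.
  by move=> [cp _ _]; exact: path_homotopic_refl.
exists G, cl; split.
- move=> x y z p q hp hq; have hpq := is_path_concat hp hq.
  rewrite (clE _ _ _ hp) (clE _ _ _ hq) (clE _ _ _ hpq) [RHS]pi1_mul_class.
  apply/class_of_eqP; rewrite /conj.
  have [_ -> ->] := hpq; have [_ -> ->] := hp; have [_ -> ->] := hq.
  have [[Ux Uy] [_ Uz]] := (is_path_ends hp, is_path_ends hq).
  have hx := TP _ Ux; have hy := TP _ Uy; have hz := is_path_inv (TP _ Uz).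
  have hy' := is_path_inv hy.
  have hxp := is_path_concat hx hp; have hyq := is_path_concat hy hq.
  have hxpy := is_path_concat hxp hy'.
  apply: path_homotopic_sym; apply: (path_homotopic_trans
    (path_homotopic_sym (path_concat_assoc hxpy hyq hz)) _).
  apply: (path_homotopic_concat (is_path_concat hxpy hyq) hz _ (refl _ _ _ hz)).
  apply: (path_homotopic_trans
    (path_homotopic_sym (path_concat_assoc hxpy hy hq)) _).
  apply: (path_homotopic_trans _ (path_concat_assoc hx hp hq)).
  apply: (path_homotopic_concat (is_path_concat hxpy hy) hq _ (refl _ _ _ hq)).
  exact: path_concat_invlr hxp hy.
- move=> x y p q hp hq; rewrite (clE _ _ _ hp) (clE _ _ _ hq) class_of_eqP.
  have [Ux Uy] := is_path_ends hp; have [hx hy] := (TP _ Ux, TP _ Uy).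
  have hy' := is_path_inv hy.
  rewrite /conj; have [_ -> ->] := hp; have [_ -> ->] := hq; split=> [h|h].
    apply: (path_concat_canl hp hq hx _).
    exact: path_concat_canr (is_path_concat hx hp) (is_path_concat hx hq) hy' h.
  apply: (path_homotopic_concat (is_path_concat hx hp) hy' _ (refl _ _ _ hy')).
  exact: path_homotopic_concat hx hp (refl _ _ _ hx) h.
- move=> x y a Ux Uy; have [hx hy] := (TP _ Ux, TP _ Uy).
  have ha := repr_loop_path a; have hx' := is_path_inv hx.
  have hy' := is_path_inv hy.
  have hp := is_path_concat (is_path_concat hx' ha) hy.
  exists (path_concat (path_concat (path_inv (T x)) (repr_loop a)) (T y)) => //.
  rewrite (clE _ _ _ hp) -[RHS]class_of_repr; apply/class_of_eqP.
  rewrite /conj; have [_ -> ->] := hp.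
  apply: (path_homotopic_trans _ (path_concat_invr ha hy)).
  apply: (path_homotopic_concat (is_path_concat hx hp) hy' _ (refl _ _ _ hy')).
  apply: (path_homotopic_trans (path_homotopic_sym
    (path_concat_assoc hx (is_path_concat hx' ha) hy)) _).
  apply: (path_homotopic_concat
    (is_path_concat hx (is_path_concat hx' ha)) hy _ (refl _ _ _ hy)).
  apply: (path_homotopic_trans
    (path_homotopic_sym (path_concat_assoc hx hx' ha)) _).
  apply: (path_homotopic_trans _ (path_concat_cst_left ha)).
  apply: (path_homotopic_concat (is_path_concat hx hx') ha _ (refl _ _ _ ha)).
  exact: path_concat_inv hx.
Qed.

(** * Lifting through local systems *)

Lemma itv_convex (R : realType) (a b c d r : R) :
  c < a < d -> c < b < d -> 0 <= r <= 1 -> c < (b - a) * r + a < d.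
Proof.
move=> ha hb hr; have [ab|/ltW ab] := leP a b.
  have h1 : 0 <= (b - a) * r by rewrite mulr_ge0//; lra.
  have h2 : (b - a) * r <= (b - a) * 1 by rewrite ler_wpM2l//; lra.
  lra.
have h1 : 0 <= (a - b) * r by rewrite mulr_ge0//; lra.
have h2 : (a - b) * r <= (a - b) * 1 by rewrite ler_wpM2l//; lra.
lra.
Qed.

(** Connectedness of the interval, in the form that serves to compare lifts, to
    extend them, and to follow them along the boundary of a cube. *)
Lemma locally_constant_path (R : realType) (T : topologicalType) (C : set T)
    (P : T -> Prop) (x y : T) (p : R -> T) :
  is_path C x y p ->
  (forall t, C t -> \forall u \near t, C u -> (P t <-> P u)) -> P x -> P y.
Proof.
move=> [[cp Cp] <- <-] locP P0.
have loc (s : R) : unit_segment R s ->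
    \forall r \near s, unit_segment R r -> (P (p s) <-> P (p r)).
  move=> Is; move/within_continuousP in cp.
  have := cp s Is _ (locP _ (Cp _ Is)); apply: filterS => r h Ir.
  by apply: h => //; exact: Cp.
pose A := unit_segment R `&` [set s | P (p s)].
suff : A = unit_segment R.
  by move/seteqP => [_ /(_ 1 (in_segment1 R)) []].
apply: (@segment_connected R 0 1).
- by exists 0; split=> //; exact: (in_segment0 R).
- exists (interior [set s | unit_segment R s -> P (p s)]).
    exact: open_interior.
  apply/seteqP; split=> s [Is] => [Ps|/interior_subset Ps]; last first.
    by split=> //; exact: Ps.
  split=> //; have := loc s Is; apply: filterS => r h Ir.
  by apply/(h Ir).
- exists (~` interior [set s | unit_segment R s -> ~ P (p s)]).
    by apply: open_closedC; exact: open_interior.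
  apply/seteqP; split=> s [Is] => [Ps|nPs].
    by split=> // /interior_subset /(_ Is).
  split=> //; apply: contrapT => nP; apply: nPs.
  have := loc s Is; apply: filterS => r h Ir Pr.
  by apply/nP/(h Ir).
Qed.

(** Values in a set [Y] attached to the positions and carried from a position
    to the positions that may occur near it.  This is the combinatorial content
    of a covering space: [Y] restricted to [ok a] is the fibre over [a]. *)
Record local_system (Pos Y : Type) (le : Pos -> Pos -> Prop)
    (ok : Pos -> Y -> Prop) (tr : Pos -> Pos -> Y -> Y) : Prop := LocalSystem {
  tr_ok : forall a b y, le a b -> ok a y -> ok b (tr a b y);
  tr_id : forall a y, ok a y -> tr a a y = y;
  tr_comp : forall a b c y, le a b -> le b c -> ok a y ->
    tr b c (tr a b y) = tr a c y;
  tr_surj : forall a b z, le a b -> ok b z -> exists2 y, ok a y & tr a b y = z;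
  tr_inj : forall a b y z, le a b -> ok a y -> ok a z ->
    tr a b y = tr a b z -> y = z
}.

(** Continuity of a map to the positions, for the topology in which the
    positions above a given one form its smallest neighborhood. *)
Definition stratified (T : topologicalType) (Pos : Type)
    (le : Pos -> Pos -> Prop) (C : set T) (f : T -> Pos) : Prop :=
  forall t, C t -> \forall u \near t, C u -> le (f t) (f u).

Definition lift (T : topologicalType) (Pos Y : Type) (ok : Pos -> Y -> Prop)
    (tr : Pos -> Pos -> Y -> Y) (C : set T) (f : T -> Pos) (l : T -> Y) : Prop :=
  (forall t, C t -> ok (f t) (l t)) /\
  forall t, C t -> \forall u \near t, C u -> l u = tr (f t) (f u) (l t).

Section Lifts.
Variables (R : realType) (Pos Y : Type) (le : Pos -> Pos -> Prop).
Variables (ok : Pos -> Y -> Prop) (tr : Pos -> Pos -> Y -> Y).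
Hypothesis tr_system : local_system le ok tr.
Notation I := (unit_segment R).
Notation lift := (lift ok tr).
Notation stratified := (stratified le).

Section General.
Context {T : topologicalType}.
Implicit Types (C D : set T) (f : T -> Pos) (l : T -> Y).

Lemma liftS C D f l : C `<=` D -> lift D f l -> lift C f l.
Proof.
move=> CD [h1 h2]; split=> [t /CD /h1//|t /CD /h2].
by apply: filterS => u hu Cu; apply: hu; exact: CD.
Qed.

(** Both labels at a point determine, and are determined by, those nearby. *)
Lemma lift_unique C f l l' x y (p : R -> T) : stratified C f ->
  lift C f l -> lift C f l' -> is_path C x y p -> l x = l' x -> l y = l' y.
Proof.
move=> sf [o1 h1] [o2 h2] hp.
apply: (locally_constant_path (P := fun t => l t = l' t) hp) => t Ct.
have := h1 t Ct; have := h2 t Ct; have := sf t Ct.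
apply: filterS3 => u le_tu e2 e1 Cu; rewrite e1// e2//; split=> [->//|].
by apply: (tr_inj tr_system) (le_tu Cu) _ _; [exact: o1|exact: o2].
Qed.

Lemma lift_paste C f l l' (phi : T -> R) (c : R) : {within C, continuous phi} ->
  lift (C `&` [set t | phi t <= c]) f l ->
  lift (C `&` [set t | c <= phi t]) f l' ->
  (forall t, C t -> phi t = c -> l t = l' t) ->
  lift C f (fun t => if phi t <= c then l t else l' t).
Proof.
move=> /within_continuousP cphi [o1 h1] [o2 h2] ll'; split=> t Ct.
  case: ifPn => [tc|]; first by apply: o1; split.
  by rewrite -ltNge => /ltW tc; apply: o2; split.
case: (ltgtP (phi t) c) => [tc|tc|tc].
- have /(cphi t Ct) : nbhs (phi t) [set r | r < c].
    by apply: open_nbhs_nbhs; split => //; exact: open_lt.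
  have := h1 t (conj Ct (ltW tc)); apply: filterS2 => u e lt_u Cu.
  by have /ltW uc := lt_u Cu; rewrite uc; apply: e; split.
- have /(cphi t Ct) : nbhs (phi t) [set r | c < r].
    by apply: open_nbhs_nbhs; split => //; exact: open_gt.
  have := h2 t (conj Ct (ltW tc)); apply: filterS2 => u e lt_u Cu.
  have uc := lt_u Cu; rewrite leNgt uc /=; apply: e; split=> //; exact: ltW.
- have tc1 : phi t <= c by rewrite tc.
  have tc2 : c <= phi t by rewrite tc.
  have := h2 t (conj Ct tc2); have := h1 t (conj Ct tc1).
  apply: filterS2 => u e1 e2 Cu.
  case: ifPn => [uc|]; first by apply: e1; split.
  by rewrite -ltNge => /ltW uc; rewrite ll'//; apply: e2; split.
Qed.

End General.

Lemma lift_comp (S T : topologicalType) (C : set S) (D : set T) (g : S -> T)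
    (f : T -> Pos) (l : T -> Y) :
  map_into C D g -> lift D f l -> lift C (f \o g) (l \o g).
Proof.
move=> [/within_continuousP cg Dg] [o1 h1]; split=> t Ct; first exact/o1/Dg.
have := cg _ Ct _ (h1 _ (Dg _ Ct)); apply: filterS => u hu Cu /=.
by apply: hu => //; exact: Dg.
Qed.

Lemma stratified_comp (S T : topologicalType) (C : set S) (D : set T)
    (g : S -> T) (f : T -> Pos) :
  map_into C D g -> stratified D f -> stratified C (f \o g).
Proof.
move=> [/within_continuousP cg Dg] sf t Ct.
have := cg _ Ct _ (sf _ (Dg _ Ct)); apply: filterS => u hu Cu /=.
by apply: hu => //; exact: Dg.
Qed.

Lemma segment_path (s : R) : I s -> is_path I 0 s (fun t => s * t + 0).
Proof.
move=> Is; have /in_segment s01 := Is; split.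
- by apply: map_into_affine; lra.
- by rewrite mulr0 addr0.
- by rewrite mulr1 addr0.
Qed.

Lemma segment_lift_unique (f : R -> Pos) (l l' : R -> Y) : stratified I f ->
  lift I f l -> lift I f l' -> l 0 = l' 0 -> forall s, I s -> l s = l' s.
Proof.
by move=> sf hl hl' l0 s /segment_path hp; exact: (lift_unique sf hl hl' hp l0).
Qed.

Lemma segment_lift (f : R -> Pos) y : stratified I f -> ok (f 0) y ->
  exists2 l, lift I f l & l 0 = y.
Proof.
move=> sf oky.
pose S (s : R) : set R := [set t | 0 <= t <= s].
have SE s t : S s t = (0 <= t <= s) :> Prop by [].
pose P s := exists2 l, lift (S s) f l & l 0 = y.
suff : P 1.
  case=> l hl l0; exists l => //; apply: liftS hl => t /in_segment //.
apply: (locally_constant_path (P := P) (segment_path (in_segment1 R))); last first.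
  exists (fun=> y) => //; split=> t; rewrite SE => t0.
    by rewrite (_ : t = 0)//; lra.
  near=> u; rewrite SE => u0; have -> : u = 0 by lra.
  by rewrite (_ : t = 0) ?(tr_id tr_system)//; lra.
move=> s Is; have := sf s Is; rewrite -nbhs_nearE => /nbhs_ballP [e /= e0 he].
suff ext s1 s2 : ball s e s1 -> ball s e s2 -> I s1 -> I s2 -> P s1 -> P s2.
  have se : ball s e s by exact: ballxx.
  have : nbhs s (ball s e) by exact: nbhsx_ballx.
  by apply: filterS => u su Iu; split; exact: ext.
move=> b1 b2 /in_segment I1 /in_segment I2 [l hl l0].
have [s21|s12] := leP s2 s1.
  exists l => //; apply: liftS hl => t; rewrite !SE => /andP[-> /=].
  by move=> /le_trans; apply.
have Is1 : I s1 by apply/in_segment.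
have oks1 : ok (f s1) (l s1).
  by apply: hl.1; rewrite SE lexx andbT; lra.
have [z okz zE] := tr_surj tr_system (he _ b1 Is1) oks1.
exists (fun t => if t <= s1 then l t else tr (f s) (f t) z); last first.
  by rewrite ifT//; lra.
apply: lift_paste.
- by apply: continuous_subspaceT => x; exact: cvg_id.
- by apply: liftS hl => t [] /andP[t0 _] /= ts1; rewrite SE t0.
- have near12 t : s1 <= t -> t <= s2 -> ball s e t.
    move=> h1 h2; move: b1 b2; rewrite /ball /= !ltr_distlC.
    by move=> ? ?; lra.
  split=> t [] /andP[t0 t2] /= t1.
    apply: (tr_ok tr_system) => //; apply: he; first exact: near12.
    by apply/in_segment; lra.
  have It : I t by apply/in_segment; lra.
  have := sf t It; apply: filterS => u hu [] /andP[u0 u2] /= u1.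
  rewrite (tr_comp tr_system)//; first by apply: he => //; exact: near12.
  by apply: hu; apply/in_segment; lra.
- by move=> t _ ->; rewrite zE.
Unshelve. all: by end_near.
Qed.

(** In a neighborhood of a point of one of the paths, all labels are carried from
    the label of this point; so, if the label of the path at [u] is carried from
    that of the path at [t] at one time, it is so at nearby times.  This is where
    homotopy invariance comes from. *)
Lemma lift_family (T : topologicalType) (C : set T) (F : T * R -> Pos)
    (l : T -> R -> Y) :
  stratified (C `*` I) F ->
  (forall t, C t -> lift I (fun s => F (t, s)) (l t)) ->
  forall t, C t ->
  (\forall u \near t, C u -> l u 0 = tr (F (t, 0)) (F (u, 0)) (l t 0)) ->
  \forall u \near t, C u -> l u 1 = tr (F (t, 1)) (F (u, 1)) (l t 1).
Proof.
move=> sF hl t Ct.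
pose P s := \forall u \near t, C u -> l u s = tr (F (t, s)) (F (u, s)) (l t s).
apply: (locally_constant_path (P := P) (segment_path (in_segment1 R))) => s Is.
have [[A B] /= [nA nB] AB] := sF (t, s) (conj Ct Is).
have nB' := (hl t Ct).2 s Is.
have [e /= e0 he] : exists2 e : R, 0 < e & ball s e `<=`
    B `&` [set r | I r -> l t r = tr (F (t, s)) (F (t, r)) (l t s)].
  by apply/nbhs_ballP; exact: filterI.
suff ext s1 s2 : ball s e s1 -> ball s e s2 -> I s1 -> I s2 -> P s1 -> P s2.
  have se : ball s e s by exact: ballxx.
  have : nbhs s (ball s e) by exact: nbhsx_ballx.
  by apply: filterS => u su Iu; split; exact: ext.
move=> b1 b2 I1 I2 P1.
have oks : ok (F (t, s)) (l t s) by exact: (hl t Ct).1.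
have leF u r : A u -> C u -> ball s e r -> I r -> le (F (t, s)) (F (u, r)).
  by move=> Au Cu /he [Br _] Ir; apply: (AB (u, r)).
have key s' : ball s e s' -> I s' -> \forall u \near t,
    C u -> tr (F (t, s')) (F (u, s')) (l t s') = tr (F (t, s)) (F (u, s')) (l t s).
  move=> bs' Is'; have [[A' B'] /= [nA' nB''] AB'] := sF (t, s') (conj Ct Is').
  apply: filterS nA' => u A'u Cu; have [_ /= ->//] := he _ bs'.
  rewrite (tr_comp tr_system)//; first by apply: leF => //; exact: nbhs_singleton.
  by apply: (AB' (u, s')); split=> //=; exact: nbhs_singleton.
have := key s2 b2 I2; have := key s1 b1 I1.
have : nbhs t ([set u | C u ->
    l u s1 = tr (F (t, s1)) (F (u, s1)) (l t s1)] `&` A) by exact: filterI.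
rewrite /P; apply: filterS3 => u [e1 Au] k1 k2 Cu; rewrite k2//.
pose J := I `&` ball s e.
pose Q r := l u r = tr (F (t, s)) (F (u, r)) (l t s).
have pJ : is_path J s1 s2 (fun r => (s2 - s1) * r + s1).
  split; last 2 first.
  - by rewrite mulr0 add0r.
  - by rewrite mulr1 subrK.
  apply: continuous_map_into; first exact: continuous_affine_id.
  move/in_segment in I1; move/in_segment in I2.
  move=> r /in_segment r01; split; first by apply/in_segment; nra.
  by move: b1 b2; rewrite /ball /= !ltr_distlC => b1 b2; exact: itv_convex.
apply: (locally_constant_path (P := Q) pJ); last by rewrite /Q e1// k1.
move=> r [Ir br]; have [[A' B'] /= [nA' nB''] AB'] := sF (u, r) (conj Cu Ir).
have := (hl u Cu).2 r Ir; move: nB''; apply: filterS2 => r' B'r' e' [Ir' br'].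
have ler' : le (F (u, r)) (F (u, r')).
  by apply: (AB' (u, r')); split=> //=; exact: nbhs_singleton.
rewrite /Q e'// -(tr_comp tr_system (leF u r Au Cu br Ir) ler' oks).
split=> [->//|]; apply: (tr_inj tr_system ler'); first exact: (hl u Cu).1.
by apply: (tr_ok tr_system) => //; exact: leF.
Qed.

(** The label of [t] is obtained by lifting along the ray from 0 to [t]. *)
Lemma lift_star_shaped (F : normedModType R) (C : set F) (f : F -> Pos) y :
  (forall t r, C t -> I r -> C (r *: t)) -> C 0 ->
  stratified C f -> ok (f 0) y -> exists2 l, lift C f l & l 0 = y.
Proof.
move=> starC C0 sf oky.
have mC : map_into (C `*` I) C (fun x => x.2 *: x.1).
  apply: continuous_map_into; last by move=> [t r] [] /= Ct Ir; exact: starC.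
  by move=> x; apply: cvgZ; [exact: cvg_snd|exact: cvg_fst].
pose G (x : F * R) := f (x.2 *: x.1).
have sG : stratified (C `*` I) G by exact: (stratified_comp mC sf).
have sGt t : C t -> stratified I (fun s => G (t, s)).
  move=> Ct.
  apply: (stratified_comp (g := fun s : R => (t, s)) (D := C `*` I)) sG.
  apply: continuous_map_into => //.
  by apply: continuous_pair => s; [exact: cvg_cst|exact: cvg_id].
have ex t : exists l, C t -> lift I (fun s => G (t, s)) l /\ l 0 = y.
  case: (pselect (C t)) => [Ct|nCt]; last by exists (fun=> y).
  have [|l hl l0] := segment_lift (y := y) (sGt _ Ct); last by exists l.
  by rewrite /G /= scale0r.
have [l hl] := choice ex.
have lift_cst : lift I (fun s => G (0, s)) (fun=> y).
  split=> s Is; rewrite /G /= scaler0// .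
  by near=> u; rewrite scaler0 (tr_id tr_system).
exists (fun t => l t 1).
  split=> t Ct.
    by have [[+ _] _] := hl t Ct; move=> /(_ 1 (in_segment1 R)); rewrite /G /= scale1r.
  have := lift_family sG (fun t Ct => (hl t Ct).1) Ct.
  rewrite /G /= scale1r scale0r => fam.
  have {fam} : \forall u \near t, C u ->
      l u 1 = tr (f t) (f (1 *: u)) (l t 1).
    apply: fam; near=> u => Cu.
    by rewrite (hl t Ct).2 (hl u Cu).2 scale0r (tr_id tr_system).
  by apply: filterS => u + Cu; rewrite scale1r; apply.
have [h0 h00] := hl 0 C0.
by rewrite (segment_lift_unique (sGt _ C0) h0 lift_cst h00)//; exact: in_segment1.
Unshelve. all: by end_near.
Qed.

Definition holonomy (f : R -> Pos) (y z : Y) : Prop :=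
  exists l, [/\ lift I f l, l 0 = y & l 1 = z].

Lemma holonomy_exists f y : stratified I f -> ok (f 0) y ->
  exists z, holonomy f y z.
Proof.
by move=> sf oky; have [l hl l0] := segment_lift sf oky; exists (l 1), l.
Qed.

Lemma holonomy_fun f y z z' : stratified I f ->
  holonomy f y z -> holonomy f y z' -> z = z'.
Proof.
move=> sf [l [hl l0 <-]] [l' [hl' l'0 <-]].
by apply: (segment_lift_unique sf hl hl'); [rewrite l0|exact: in_segment1].
Qed.

Lemma holonomy_cst (a : Pos) y : ok a y -> holonomy (fun=> a) y y.
Proof.
move=> oky; exists (fun=> y); split=> //; split=> // t It.
by near=> u; rewrite (tr_id tr_system).
Unshelve. all: by end_near.
Qed.

Lemma holonomy_homotopic (E : topologicalType) (U : set E) (pos : E -> Pos)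
    (p q : R -> E) y z : stratified U pos ->
  path_homotopic U p q -> holonomy (pos \o p) y z -> holonomy (pos \o q) y z.
Proof.
move=> spos [H [cH H0 H1 HB]] [l0 [hl0 l00 l01]].
pose F (x : R * R) := pos (H x).
have sF : stratified (I `*` I) F by exact: (stratified_comp cH spos).
have sFr r : I r -> stratified I (fun s => F (r, s)).
  move=> Ir; apply: (stratified_comp (g := fun s : R => (r, s)) (D := I `*` I)) sF.
  apply: continuous_map_into => //.
  by apply: continuous_pair => s; [exact: cvg_cst|exact: cvg_id].
have [I0 I1] := (in_segment0 R, in_segment1 R).
have F0 r : I r -> F (r, 0) = pos (p 0) by move=> Ir; rewrite /F HB//; left.
have F1 r : I r -> F (r, 1) = pos (p 1) by move=> Ir; rewrite /F HB//; right.
have oky : ok (pos (p 0)) y by rewrite -l00; exact: hl0.1.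
have okz : ok (pos (p 1)) z by rewrite -l01; exact: hl0.1.
have ex r : exists l, I r -> lift I (fun s => F (r, s)) l /\ l 0 = y.
  case: (pselect (I r)) => [Ir|nIr]; last by exists (fun=> y).
  have [|l hl l'0] := segment_lift (y := y) (sFr _ Ir); last by exists l.
  by rewrite F0.
have [l hl] := choice ex.
have eq_lift_pos r g : I r -> (forall s, I s -> H (r, s) = g s) ->
    lift I (pos \o g) (l r).
  move=> Ir Hg; have [[h1 h2] _] := hl r Ir.
  split=> s Is; first by rewrite /= -Hg//; exact: h1.
  have := h2 s Is; apply: filterS => u hu Iu /=.
  by rewrite -!Hg//; exact: hu.
exists (l 1); split; [exact: eq_lift_pos|exact: (hl 1 I1).2|].
have z0 : l 0 1 = z.
  rewrite -l01; have sp : stratified I (pos \o p).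
    move=> s Is; have := sFr 0 I0 s Is; rewrite /F H0//.
    by apply: filterS => u hu Iu /=; rewrite -(H0 u)//; exact: hu.
  apply: (segment_lift_unique sp (eq_lift_pos _ _ I0 H0) hl0) => //.
  by rewrite (hl 0 I0).2.
apply: (locally_constant_path (P := fun r => l r 1 = z)
  (segment_path (in_segment1 R))) => // r Ir.
have := lift_family sF (fun t It => (hl t It).1) Ir.
move=> fam; have {}fam := fam _.
have : \forall u \near r, I u -> l u 1 = tr (F (r, 1)) (F (u, 1)) (l r 1).
  apply: fam; near=> u => Iu.
  by rewrite (hl r Ir).2 (hl u Iu).2 !F0// (tr_id tr_system).
apply: filterS => u hu Iu; rewrite hu// !F1// (tr_id tr_system)//.
by rewrite -(F1 r Ir); exact: (hl r Ir).1.1.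
Unshelve. all: by end_near.
Qed.

Lemma holonomy_concat (E : Type) (pos : E -> Pos) (p q : R -> E) x y z :
  p 1 = q 0 -> holonomy (pos \o p) x y -> holonomy (pos \o q) y z ->
  holonomy (pos \o path_concat p q) x z.
Proof.
move=> pq [l [hl l0 l1]] [l' [hl' l'0 l'1]].
exists (fun t => if t <= 2^-1 then l (2 * t + 0) else l' (2 * t + -1)); split.
- have eqp (c : R) (g : R -> E) (k : R -> Y) (D : set R) :
      map_into D I (fun t => 2 * t + c) -> lift I (pos \o g) k ->
      (forall t, D t -> path_concat p q t = g (2 * t + c)) ->
      lift D (pos \o path_concat p q) (k \o (fun t => 2 * t + c)).
    move=> mD hk e; have [h1 h2] := lift_comp mD hk.
    split=> t Dt; first by rewrite /= e//; exact: h1.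
    have := h2 t Dt; apply: filterS => u hu Du /=; rewrite !e//; exact: hu.
  apply: lift_paste.
  + by apply: continuous_subspaceT => t; exact: cvg_id.
  + apply: (eqp 0 p l) => //.
      apply: continuous_map_into; first exact: continuous_affine_id.
      by move=> t [/= /in_segment t01 t2]; apply/in_segment; lra.
    by move=> t [/= _ t2]; rewrite /path_concat t2 addr0.
  + apply: (eqp (-1) q l') => //.
      apply: continuous_map_into; first exact: continuous_affine_id.
      by move=> t [/= /in_segment t01 t2]; apply/in_segment; lra.
    move=> t [/= _ t2]; rewrite /path_concat; case: ifPn => // t2'.
    have -> : t = 2^-1 by lra.
    by rewrite mulfV ?pnatr_eq0// subrr.
  + by move=> t _ ->; rewrite addr0 mulfV ?pnatr_eq0// subrr l1.
- by rewrite ifT ?mulr0 ?addr0//; lra.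
- by rewrite ifF ?two_sub_one//; lra.
Qed.

Lemma holonomy_inv (E : topologicalType) (pos : E -> Pos) (p : R -> E) y z :
  holonomy (pos \o p) y z -> holonomy (pos \o path_inv p) z y.
Proof.
move=> [l [hl l0 l1]]; exists (l \o (fun t => -1 * t + 1)); split => /=.
- have mI : map_into I I (fun t => -1 * t + 1) by apply: map_into_affine; lra.
  exact: (lift_comp mI hl).
- by rewrite mulr0 add0r.
- by rewrite mulr1 addNr.
Qed.

End Lifts.

(** * Cubes *)

Section Cubes.
Variable R : realType.
Notation I := (unit_segment R).

Lemma continuous_rV (T : topologicalType) (k : nat) (f : T -> 'rV[R]_k) :
  (forall i, continuous (fun t => f t ord0 i)) -> continuous f.
Proof.
move=> cf x B [P nP PB].
have : \forall t \near x, forall i j, P i j (f t i j).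
  apply: filter_forall => i; apply: filter_forall => j.
  have := nP i j; rewrite (ord1 i); exact: cf.
by apply: filterS => t Pt; apply: PB => i j; exact: Pt.
Qed.

Lemma continuous_coord (k : nat) (i : 'I_k) :
  continuous (fun t : 'rV[R]_k => t ord0 i).
Proof. exact: coord_continuous. Qed.

Lemma compact_cube (k : nat) : compact (cube R k).
Proof.
have := @rV_compact R k (fun=> I) (fun=> @segment_compact R 0 1).
by congr compact; apply/seteqP; split=> t h i; have := h i;
  rewrite ?in_segment//; move/in_segment.
Qed.

Lemma cube_boundary_sub (k : nat) : cube_boundary R k `<=` cube R k.
Proof. by move=> t []. Qed.

Lemma cube_convex (k : nat) (r : R) (t u : 'rV[R]_k) : I r ->
  cube R k t -> cube R k u -> cube R k ((1 - r) *: t + r *: u).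
Proof.
by move=> /in_segment Ir Ct Cu i; have := Ct i; have := Cu i; rewrite !mxE; nra.
Qed.

Lemma cube0 (k : nat) : cube R k 0.
Proof. by move=> i; rewrite mxE; lra. Qed.

Lemma cube_star (k : nat) (t : 'rV[R]_k) (r : R) :
  cube R k t -> I r -> cube R k (r *: t).
Proof. by move=> Ct /in_segment Ir i; have := Ct i; rewrite mxE; nra. Qed.

Lemma cube_boundary0 (k : nat) : (0 < k)%N -> cube_boundary R k 0.
Proof.
case: k => // k _; split; first exact: cube0.
by exists ord0; left; rewrite mxE.
Qed.

(** A boundary point lies in a face [t_i = 0] or [t_i = 1].  There is another
    coordinate [j]: first reach the face [t_j = 0] inside the given one; it
    contains a segment to the origin. *)
Lemma cube_boundary_path (k : nat) (t : 'rV[R]_k) : (2 <= k)%N ->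
  cube_boundary R k t -> exists p : R -> _, is_path (cube_boundary R k) 0 t p.
Proof.
move=> k2 [Ct [i ti]].
have [j ij] : exists j : 'I_k, j != i.
  have : (1 < #|'I_k|)%N by rewrite card_ord.
  rewrite (cardD1 i) ltnS => /card_gt0P[j]; rewrite inE => /andP[ji _].
  by exists j.
pose u : 'rV[R]_k := \row_l (if l == j then 0 else t ord0 l).
have Cu : cube R k u by move=> l; rewrite mxE; case: ifP => // _; lra.
have seg (v w : 'rV[R]_k) : (forall r, I r ->
    cube_boundary R k ((1 - r) *: v + r *: w)) ->
    is_path (cube_boundary R k) v w (fun r : R => (1 - r) *: v + r *: w).
  move=> h; split; last 2 first.
  - by rewrite subr0 scale1r scale0r addr0.
  - by rewrite subrr scale0r scale1r add0r.
  split; last exact: h.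
  by apply: within_continuous_interp; apply: continuous_subspaceT => x;
    [exact: cvg_id|exact: cvg_cst|exact: cvg_cst].
exists (path_concat (fun r => (1 - r) *: 0 + r *: u)
                    (fun r => (1 - r) *: u + r *: t)).
apply: is_path_concat; apply: seg => r Ir.
- split; first exact: cube_convex Ir (@cube0 k) Cu.
  by exists j; left; rewrite !mxE eqxx !mulr0 addr0.
- split; first exact: cube_convex Ir Cu Ct.
  exists i; rewrite !mxE eq_sym (negPf ij).
  by case: ti => ->; [left|right]; ring.
Qed.

Section BaseChange.
Variable k : nat.
Hypothesis k_gt0 : (0 < k)%N.

Local Definition blow (t : 'rV[R]_k) : 'rV[R]_k :=
  \row_i Num.min 1 (Num.max 0 (2 * t ord0 i + - 2^-1)).

Local Definition collar_factor (s : R) : R :=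
  Num.min 1 (4 * s + 0) * Num.min 1 (- 4 * s + 4).

Local Definition collar (t : 'rV[R]_k) : R := \prod_i collar_factor (t ord0 i).

Lemma blow_continuous : continuous blow.
Proof.
apply: continuous_rV => i.
have -> : (fun t => blow t ord0 i) =
    (fun t => Num.min 1 (Num.max 0 (2 * t ord0 i + - 2^-1))).
  by apply/funext => t; rewrite mxE.
apply: (continuous_minr (f := fun=> 1)); first exact: cst_continuous.
apply: (continuous_maxr (f := fun=> 0)); first exact: cst_continuous.
apply: (continuous_affine (f := fun t : 'rV[R]_k => t ord0 i)).
exact: continuous_coord.
Qed.

Lemma collar_continuous : continuous collar.
Proof.
apply: continuous_prod => i.
have aff (a b : R) : continuous (fun t : 'rV[R]_k => a * t ord0 i + b).
  apply: (continuous_affine (f := fun t : 'rV[R]_k => t ord0 i)).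
  exact: continuous_coord.
have mn (a b : R) : continuous (fun t : 'rV[R]_k => Num.min 1 (a * t ord0 i + b)).
  by apply: (continuous_minr (f := fun=> 1)); [exact: cst_continuous|exact: aff].
by move=> t; exact: (cvgM (mn 4 0 t) (mn (- 4) 4 t)).
Qed.

Lemma blow_cube t : cube R k (blow t).
Proof. by move=> i; rewrite mxE !le_min !le_max !ge_min !lexx ?orbT //=; lra. Qed.

Lemma blow_boundary (t : 'rV[R]_k) (i : 'I_k) : (t ord0 i = 0 -> blow t ord0 i = 0) /\
  (t ord0 i = 1 -> blow t ord0 i = 1).
Proof.
by rewrite mxE; split=> ->; [rewrite (max_l (x := 0)) ?min_r//|
  rewrite (min_l (x := 1))// le_max]; lra.
Qed.

Lemma collar_in_segment t : cube R k t -> I (collar t).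
Proof.
move=> Ct; apply/in_segment; apply: (big_ind (fun s : R => 0 <= s <= 1)).
- by lra.
- by move=> x y /andP[x0 x1] /andP[y0 y1]; rewrite mulr_ge0// mulr_ile1.
- move=> i _; rewrite /collar_factor; have /andP[t0 t1] := Ct i.
  have h1 : 0 <= Num.min 1 (4 * t ord0 i + 0) <= 1.
    by rewrite le_min ge_min lexx /=; lra.
  have h2 : 0 <= Num.min 1 (-4 * t ord0 i + 4) <= 1.
    by rewrite le_min ge_min lexx /=; lra.
  by move/andP: h1 => [? ?]; move/andP: h2 => [? ?]; rewrite mulr_ge0// mulr_ile1.
Qed.

Lemma collar_boundary t : cube_boundary R k t -> collar t = 0.
Proof.
move=> [_ [i ti]]; rewrite /collar (bigD1 i)//= /collar_factor.
case: ti => ->; first by rewrite (min_r (y := 4 * 0 + 0)) ?mulr0 ?addr0 ?mul0r//; lra.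
by rewrite (min_r (y := -4 * 1 + 4)) ?mulr1 ?addNr ?mulr0 ?mul0r//; lra.
Qed.

Lemma collar_inner t : cube R k t -> ~ cube_boundary R k (blow t) ->
  collar t = 1.
Proof.
move=> Ct nB; rewrite /collar big1// => i _; rewrite /collar_factor.
have [t4|t4] := leP (t ord0 i) 4^-1.
  exfalso; apply: nB; split; first exact: blow_cube.
  exists i; left; rewrite mxE (max_l (x := 0)) ?min_r//; lra.
have [t4'|t4'] := leP (3 / 4) (t ord0 i).
  exfalso; apply: nB; split; first exact: blow_cube.
  exists i; right; rewrite mxE min_l// le_max; lra.
by rewrite !min_l ?mulr1//; lra.
Qed.

(** A homotopy that keeps the boundary at a single, moving, point can be
    corrected to fix it: [blow] expands the inner half of the cube to the whole
    cube, and on the collar left outside, the motion of the boundary point is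
    run with time [collar]. *)
Lemma nullhomotopic_rel_boundary (E : topologicalType) (U : set E) (x e : E)
    (f : 'rV[R]_k -> E) :
  map_into (cube R k) U f -> (forall t, cube_boundary R k t -> f t = x) ->
  homotopic_through R (cube R k) U
    (fun h => forall t u, cube_boundary R k t -> cube_boundary R k u ->
       h t = h u) f (fun=> e) ->
  homotopic_rel R (cube R k) (cube_boundary R k) U f (fun=> x).
Proof.
move=> cf fx [H [cH H0 H1 HB]].
have bdry0 := cube_boundary0 k_gt0.
have bdry_sub := @cube_boundary_sub k.
have into (phi : R * 'rV[R]_k -> R) (psi : R * 'rV[R]_k -> 'rV[R]_k) :
    continuous phi -> continuous psi ->
    (forall r t, I r -> cube R k t -> I (phi (r, t)) /\ cube R k (psi (r, t))) ->
    map_into (I `*` cube R k) U (fun x => H (phi x, psi x)).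
  move=> c1 c2 h; apply: (map_into_comp _ cH).
  apply: continuous_map_into; first exact: continuous_pair.
  by move=> [r t] [/= Ir Ct]; have [] := h r t Ir Ct.
pose delta r := H (r, 0).
have HBd r t : I r -> cube_boundary R k t -> H (r, t) = delta r.
  by move=> Ir Bt; exact: HB.
have [I0 I1] := (in_segment0 R, in_segment1 R).
have d0 : delta 0 = x by rewrite /delta H0 ?fx//; exact: cube0.
have d1 : delta 1 = e by rewrite /delta H1//; exact: cube0.
have Bblow t : cube_boundary R k t -> cube_boundary R k (blow t).
  move=> [_ [i ti]]; split; first exact: blow_cube.
  exists i; have [h0 h1] := blow_boundary t i.
  by case: ti => [/h0|/h1]; [left|right].
apply: (homotopic_rel_trans (g := f \o blow)) => //.
  apply: homotopic_rel_sym => //.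
  apply: (homotopic_segments (a := blow) (b := id) cf).
  - by apply: continuous_subspaceT; exact: blow_continuous.
  - by apply: continuous_subspaceT => t; exact: cvg_id.
  - by move=> r t Ir Ct; apply: cube_convex => //; exact: blow_cube.
  - move=> r t Ir [Ct [i ti]].
    rewrite !fx//; first by apply: Bblow; split=> //; exists i.
    split; first by apply: cube_convex => //; exact: blow_cube.
    exists i; have [h0 h1] := blow_boundary t i; rewrite !mxE/= in h0 h1 *.
    by case: ti => [ti|ti]; [rewrite h0// ti|rewrite h1// ti]; [left|right]; ring.
apply: (homotopic_rel_trans (g := fun t => delta (collar t))) => //.
  exists (fun x => H (x.1 * collar x.2, blow x.2)); split.
  - apply: (into (fun x => x.1 * collar x.2) (fun x => blow x.2)).
    + move=> z; apply: cvgM; first exact: cvg_fst.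
      by apply: continuous_comp; [exact: cvg_snd|exact: collar_continuous].
    + move=> z; apply: continuous_comp; [exact: cvg_snd|exact: blow_continuous].
    + move=> r t /in_segment Ir Ct; split; last exact: blow_cube.
      have /in_segment := collar_in_segment Ct => h.
      by apply/in_segment; rewrite /=; nra.
  - by move=> t Ct /=; rewrite mul0r H0//; exact: blow_cube.
  - move=> t Ct /=; rewrite mul1r.
    case: (pselect (cube_boundary R k (blow t))) => [Bt|nBt].
      by rewrite HBd//; exact: collar_in_segment.
    by rewrite collar_inner// H1 ?d1//; exact: blow_cube.
  - move=> r t Ir Bt /=; rewrite collar_boundary// mulr0 H0//.
    exact: blow_cube.
exists (fun x => H ((-1 * x.1 + 1) * collar x.2, 0)); split.
- apply: (into (fun x => (-1 * x.1 + 1) * collar x.2) (fun=> 0)).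
  + move=> z; apply: cvgM.
      exact: (continuous_affine (@continuous_fst R 'rV[R]_k)).
    by apply: continuous_comp; [exact: cvg_snd|exact: collar_continuous].
  + by move=> z; exact: cvg_cst.
  + move=> r t /in_segment Ir Ct; split; last exact: cube0.
    have /in_segment := collar_in_segment Ct => h.
    by apply/in_segment; rewrite /=; nra.
- by move=> t Ct /=; rewrite mulr0 add0r mul1r.
- by move=> t Ct /=; rewrite mulr1 addNr mul0r; exact: d0.
- by move=> r t Ir Bt /=; rewrite collar_boundary// mulr0.
Qed.

End BaseChange.
End Cubes.

(** * Spaces that retract onto a graph *)

Inductive position (V : Type) : Type := Vertex of V | Edge of V & V.

Definition occurring_edge (V E : Type) (U : set E) (pos : E -> position V)
    (i j : V) : Prop :=
  exists2 u, U u & pos u = Edge i j.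

(** The order on the positions: a position specializes to those that occur
    arbitrarily near it. *)
Definition specializes (V E : Type) (U : set E) (pos : E -> position V)
    (a b : position V) : Prop :=
  a = b \/ exists i j,
    [/\ b = Edge i j, occurring_edge U pos i j & a = Vertex i \/ a = Vertex j].

Definition seg (R : realType) (E : normedModType R) (x y : E) : R -> E :=
  fun r => (1 - r) *: x + r *: y.

(** The graph has straight edges and lies in [U], and [pos u] is the vertex or
    the open edge that contains [rho u].  The topology of the graph enters only
    through the continuity of [rho], and through [gr_stratified]: near a point
    over a vertex, only this vertex and its edges occur, and near a point over an
    open edge only this edge. *)
Record graph_retraction (R : realType) (E : normedModType R) (V : Type)
    (U : set E) (pos : E -> position V) (loc : V -> E) (rho : E -> E) : Prop :=
  GraphRetraction {
  gr_stratified : stratified (specializes U pos) U pos;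
  gr_continuous : {within U, continuous rho};
  gr_segment : forall u r, U u -> unit_segment R r -> U (seg u (rho u) r);
  gr_vertex : forall u v, U u -> pos u = Vertex v -> rho u = loc v;
  gr_edge : forall u i j, U u -> pos u = Edge i j ->
    exists2 r, 0 < r < 1 & rho u = seg (loc i) (loc j) r;
  gr_pos_vertex : forall v, (exists2 u, U u & pos u = Vertex v) ->
    pos (loc v) = Vertex v;
  gr_pos_ends : forall i j, occurring_edge U pos i j ->
    pos (loc i) = Vertex i /\ pos (loc j) = Vertex j;
  gr_edge_sub : forall i j r, occurring_edge U pos i j ->
    unit_segment R r -> U (seg (loc i) (loc j) r);
  gr_pos_edge : forall i j r, occurring_edge U pos i j ->
    0 < r < 1 -> pos (seg (loc i) (loc j) r) = Edge i j
}.

Section GraphLike.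
Variables (R : realType) (E : normedModType R) (V : eqType) (U : set E).
Variables (pos : E -> position V) (loc : V -> E) (rho : E -> E).
Hypothesis gr : graph_retraction U pos loc rho.
Notation I := (unit_segment R).
Notation adj := (occurring_edge U pos).
Notation le := (specializes U pos).

Lemma seg0 (x y : E) : seg x y 0 = x.
Proof. by rewrite /seg subr0 scale1r scale0r addr0. Qed.

Lemma seg1 (x y : E) : seg x y 1 = y.
Proof. by rewrite /seg subrr scale0r scale1r add0r. Qed.

Lemma segC (x y : E) r : seg x y r = seg y x (1 - r).
Proof. by rewrite /seg opprB addrCA subrr addr0 addrC. Qed.

Lemma rho_in u : U u -> U (rho u).
Proof. by move=> Uu; rewrite -(seg1 u (rho u)); apply: gr_segment gr _ _ Uu (in_segment1 R). Qed.

Lemma adj_neq i j : adj i j -> i != j.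
Proof.
move=> ij; apply/eqP => e; subst j.
have [] := gr_pos_ends gr ij; have h2 : 0 < (2^-1 : R) < 1 by lra.
by have := gr_pos_edge gr ij h2; rewrite /seg -scalerDl subrK scale1r => ->.
Qed.

Definition link i j := adj i j \/ adj j i.

Lemma link_seg i j r : link i j -> I r -> U (seg (loc i) (loc j) r).
Proof.
move=> [ij|ij] Ir; first exact: gr_edge_sub gr _ _ _ ij Ir.
rewrite segC; apply: gr_edge_sub gr _ _ _ ij _.
by move/in_segment in Ir; apply/in_segment; lra.
Qed.

(** The vertices of the universal covering tree are the paths without
    backtracking, written from the current vertex back to the root.  A point in
    the interior of an edge of the tree is labelled with the end of this edge
    that is farther from the root: so, a label over the edge between [i] and [j]
    is a path that has just crossed this edge, in one direction or the other. *)
Fixpoint nonbacktracking (w : seq V) : Prop :=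
  if w is a :: w' then
    if w' is b :: w'' then
      [/\ link a b, ohead w'' != Some a & nonbacktracking w']
    else True
  else False.

Definition tree_ok (a : position V) (w : seq V) : Prop :=
  nonbacktracking w /\
  match a with
  | Vertex v => exists r, w = v :: r
  | Edge i j => adj i j /\ exists r, w = [:: i, j & r] \/ w = [:: j, i & r]
  end.

Definition tree_step (v u : V) (w : seq V) : seq V :=
  if ohead (behead w) == Some u then w else u :: w.

Definition tree_tr (a b : position V) (w : seq V) : seq V :=
  match a, b with
  | Vertex v, Edge i j => tree_step v (if v == i then j else i) w
  | _, _ => w
  end.

Lemma tree_system : local_system le tree_ok tree_tr.
Proof.
have other i j v : adj i j -> Vertex v = Vertex i \/ Vertex v = Vertex j ->
    exists u, [/\ (if v == i then j else i) = u, u != v, link u v &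
      forall r, nonbacktracking [:: u, v & r] -> tree_ok (Edge i j) [:: u, v & r]].
  move=> ij [[->]|[->]].
    exists j; rewrite eqxx eq_sym adj_neq//; split=> //; first by right.
    by move=> r nb; split=> //; split=> //; exists r; right.
  exists i; rewrite eq_sym (negPf (adj_neq ij)); split=> //; first by left.
  by move=> r nb; split=> //; split=> //; exists r; left.
have other' i j v : adj i j -> Vertex v = Vertex i \/ Vertex v = Vertex j ->
    forall r, nonbacktracking [:: v, (if v == i then j else i) & r] ->
      tree_ok (Edge i j) [:: v, (if v == i then j else i) & r].
  move=> ij [[->]|[->]] r; rewrite ?eqxx => nb; split=> //; split=> //; exists r.
    by left.
  by rewrite eq_sym (negPf (adj_neq ij)); right.
split.
- move=> a b w [<-|[i [j [-> ij av]]]].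
    by case: a.
  have [v av'] : exists v, a = Vertex v by case: av => ->; eexists.
  subst a => -[nb [r wE]]; subst w; have [u [uE uv luv oku]] := other _ _ _ ij av.
  rewrite /= /tree_step; case: ifPn => /=.
    case: r nb => [//|u' r] nb /eqP[u'E]; subst u'.
    exact: other'.
  by move=> hr; rewrite uE in hr *; apply: oku; split.
- by move=> [v|i j] w.
- move=> a b c w [<-|[i [j [-> ij av]]]].
    by case: a => [v|i j]; case: c.
  by move=> [<-|[i' [j' [-> _]]]] [].
- move=> a b w [->|[i [j [-> ij av]]]] okw.
    by exists w => //; case: b okw.
  have [v av'] : exists v, a = Vertex v by case: av => ->; eexists.
  subst a; have [u [uE uv luv oku]] := other _ _ _ ij av.
  case: okw => nb [_ [r wE]].
  have {wE} [wE|wE] : w = [:: v, u & r] \/ w = [:: u, v & r].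
    move: av uE => [[->]|[->]]; first by rewrite eqxx => <-; exact: wE.
    by rewrite eq_sym (negPf (adj_neq ij)) => <-; case: wE => ->; [right|left].
  + subst w; exists [:: v, u & r]; first by split=> //; exists (u :: r).
    by rewrite /= uE /tree_step /= eqxx.
  + subst w; move: nb => [_ rv nb]; exists (v :: r); first by split=> //; exists r.
    by rewrite /= uE /tree_step /= ifN.
- move=> a b w w' [<-|[i [j [-> ij av]]]]; first by case: a.
  have [v av'] : exists v, a = Vertex v by case: av => ->; eexists.
  subst a; have [u [uE uv _ _]] := other _ _ _ ij av.
  move=> [_ [r ->]] [_ [r' ->]]; rewrite /= uE /tree_step /=.
  case: ifPn => _; case: ifPn => _ // [].
  + by move=> e; move: uv; rewrite e eqxx.
  + by move=> e; move: uv; rewrite e eqxx.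
  + by move=> ->.
Qed.

(** * Contracting maps into the universal covering tree *)

Section Contraction.
Context {T : topologicalType}.
Variables (C B : set T).

Local Notation constant_on_B := (fun h : T -> E => forall t u, B t -> B u -> h t = h u).

(** The part of the data of a lift to the tree that survives the contraction:
    [g t] is in the last edge of [l t], which is closed at both ends here, and a
    label can change near [t] only by a further step, from the end vertex. *)
Record tree_labelled (n : nat) (g : T -> E) (l : T -> seq V) : Prop :=
  TreeLabelled {
  tl_map : map_into C U g;
  tl_path : forall t, C t -> nonbacktracking (l t);
  tl_size : forall t, C t -> (size (l t) <= n)%N;
  tl_point : forall t, C t ->
    match l t with
    | [::] => False
    | [:: v] => g t = loc v
    | [:: v, u & _] => exists2 r, I r & g t = seg (loc u) (loc v) r
    end;
  tl_near : forall t, C t -> \forall u \near t, C u -> l u = l t \/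
    exists v w x, [/\ l t = v :: w, g t = loc v & l u = x :: l t];
  tl_const : forall t u, B t -> B u -> l t = l u /\ g t = g u
}.

Local Definition parent_loc (w : seq V) : E :=
  if w is [:: _, u & _] then loc u else 0.

(** The points labelled by the longest paths are pulled back along their last
    edge, to its start.  A label of maximal length has no further step, so it
    does not change nearby; it occurs near a point with a shorter label only if
    this point is at the start of the edge, which does not move. *)
Lemma tree_labelled_push n g l : tree_labelled n.+2 g l ->
  exists g' l', tree_labelled n.+1 g' l' /\
    homotopic_through R C U constant_on_B g g'.
Proof.
move=> tl.
pose H (x : R * T) : E :=
  if size (l x.2) == n.+2 then seg (g x.2) (parent_loc (l x.2)) x.1 else g x.2.
pose l' t := if size (l t) == n.+2 then behead (l t) else l t.
have longP t : C t -> size (l t) = n.+2 -> exists v u w s,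
    [/\ l t = [:: v, u & w], link v u, I s & g t = seg (loc u) (loc v) s].
  move=> Ct; have := tl_point tl Ct; have := tl_path tl Ct.
  case: (l t) => [//|v [//|u w]] [vu _ _] [s Is gs] _.
  by exists v, u, w, s.
have HU : forall x, (I `*` C) x -> U (H x).
  move=> [r t] [/= /in_segment Ir Ct]; rewrite /H /=; case: eqP => [sz|_]; last first.
    by have [_] := tl_map tl; apply.
  have [v [u [w [s [lE vu Is ->]]]]] := longP t Ct sz; rewrite lE /=.
  have -> : seg (seg (loc u) (loc v) s) (loc u) r = seg (loc u) (loc v) ((1 - r) * s).
    rewrite /seg scalerDr !scalerA addrAC -scalerDl.
    by congr (_ *: _ + _); ring.
  apply: link_seg; first by case: vu; [right|left].
  by move/in_segment in Is; apply/in_segment; nra.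
have [cg _] := tl_map tl; move/within_continuousP in cg.
have cH : map_into (I `*` C) U H.
  split=> //; apply/within_continuousP => -[r0 t0] [/= Ir0 Ct0] A nA.
  have cseg (e : E) : {within I `*` C, continuous (fun x : R * T => seg (g x.2) e x.1)}.
    apply: within_continuous_interp.
    - by apply: continuous_subspaceT; exact: continuous_fst.
    - suff [] : map_into (I `*` C) U (g \o (snd : R * T -> T)) by [].
      apply: map_into_comp (tl_map tl).
      by apply: continuous_map_into; [exact: continuous_snd|move=> [r t] []].
    - by apply: continuous_subspaceT; exact: cst_continuous.
  have near2 (P : T -> Prop) : (\forall t \near t0, P t) ->
      \forall x \near ((r0, t0) : R * T), P x.2.
    by move=> nP; exact: (@continuous_snd R T (r0, t0) _ nP).
  have nl := near2 _ (tl_near tl Ct0).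
  have [sz|sz] := eqVneq (size (l t0)) n.+2.
  - have nA' : nbhs (seg (g t0) (parent_loc (l t0)) r0) A.
      by move: nA; rewrite /H /= sz eqxx.
    have /within_continuousP := cseg (parent_loc (l t0)).
    move=> /(_ (r0, t0) (conj Ir0 Ct0) _ nA') nK.
    near=> x => -[Ir Cx]; have := near nl x; rewrite /H.
    move=> /(_ _ Cx) [//|->|[v [w [y [_ _ lE]]]]].
      by rewrite sz eqxx; apply: (near nK x) => //; split.
    by have := tl_size tl Cx; rewrite lE /= sz ltnn.
  - have nA' : nbhs (g t0) A by move: nA; rewrite /H /= (negPf sz).
    have nA'' : nbhs (seg (g t0) (g t0) r0) A.
      by rewrite /seg -scalerDl subrK scale1r.
    have /within_continuousP := cseg (g t0).
    move=> /(_ (r0, t0) (conj Ir0 Ct0) _ nA'') nK.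
    have nG := near2 _ (cg t0 Ct0 _ nA').
    near=> x => -[Ir Cx]; have := near nl x; rewrite /H.
    move=> /(_ _ Cx) [//|->|[v [w [y [lv gv lE]]]]].
      by rewrite (negPf sz); apply: (near nG x).
    case: ifPn => _; last by apply: (near nG x).
    by rewrite lE lv /= -gv; apply: (near nK x) => //; split.
have [I0 I1] := (in_segment0 R, in_segment1 R).
exists (fun t => H (1, t)), l'; split.
  split.
  - apply: (map_into_comp (f := fun t : T => (1 : R, t))) cH.
    apply: continuous_map_into => //.
    by apply: continuous_pair => t; [exact: cvg_cst|exact: cvg_id].
  - move=> t Ct; rewrite /l'; case: eqP => [sz|_]; last exact: tl_path tl _ Ct.
    have [v [u [w [s [lE _ _ _]]]]] := longP t Ct sz.
    by have := tl_path tl Ct; rewrite lE => -[].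
  - move=> t Ct; rewrite /l'; case: eqP => [sz|/eqP sz].
      by rewrite size_behead sz.
    by have := tl_size tl Ct; rewrite leq_eqVlt (negPf sz).
  - move=> t Ct; rewrite /l' /H /=; case: eqP => [sz|_]; last exact: tl_point tl _ Ct.
    have [v [u [w [s [-> _ _ _]]]]] := longP t Ct sz; rewrite /= seg1.
    by case: w => [//|x w]; exists 1; rewrite ?seg1.
  - move=> t Ct; have := tl_near tl Ct; apply: filterS => u hu Cu.
    have [lE|[v [w [x [lv gv lE]]]]] := hu Cu; first by left; rewrite /l' lE.
    have szu := tl_size tl Cu; rewrite lE /= in szu.
    have ne : (size (l t) == n.+2) = false by apply/negbTE; rewrite ltn_eqF.
    rewrite /l' /H lE /= !ne -[(size (l t)).+1 == _]/(size (l t) == n.+1).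
    case: eqP => [sz|_]; first by left.
    by right; exists v, w, x.
  - by move=> t u Bt Bu; have [lE gE] := tl_const tl Bt Bu; rewrite /l' /H /= lE gE.
exists H; split=> // [t Ct|r Ir t u Bt Bu]; rewrite /H /=.
- by case: eqP => // _; rewrite seg0.
- by have [-> ->] := tl_const tl Bt Bu.
Unshelve. all: by end_near.
Qed.

Lemma tree_labelled_contractible n g l t0 : C t0 ->
  (forall t, C t -> exists p : R -> T, is_path C t0 t p) ->
  tree_labelled n.+1 g l ->
  exists e, homotopic_through R C U constant_on_B g (fun=> e).
Proof.
move=> Ct0 pC; elim: n g l => [|n IHn] g l tl; last first.
  have [g' [l' [tl' gg']]] := tree_labelled_push tl.
  have [e g'e] := IHn _ _ tl'; exists e.
  exact: homotopic_through_trans gg' g'e.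
exists (g t0).
have gE t : C t -> g t = g t0.
  move=> Ct; have [p hp] := pC t Ct.
  have lE : l t = l t0.
    apply: (locally_constant_path (P := fun u => l u = l t0) hp) => // u Cu.
    have := tl_near tl Cu; apply: filterS => v hv Cv.
    have [->//|[a [w [x [lu _ lv]]]]] := hv Cv.
    by have := tl_size tl Cv; rewrite lv lu.
  have := tl_point tl Ct; have := tl_point tl Ct0; have := tl_size tl Ct.
  by rewrite lE; case: (l t0) => [//|v [|//]] _ -> ->.
exists (fun=> g t0); split=> //.
- by apply: map_into_cst; have [_] := tl_map tl; apply.
- by move=> t Ct; rewrite gE.
Qed.

End Contraction.

Lemma rho_map_into : map_into U U rho.
Proof. by split; [exact: gr_continuous gr|exact: rho_in]. Qed.

Lemma rho_homotopy : map_into (I `*` U) U (fun x : R * E => seg x.2 (rho x.2) x.1).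
Proof.
split; last by move=> [r u] [/= Ir Uu]; exact: gr_segment gr _ _ Uu Ir.
have snd_into : map_into (I `*` U) U (@snd R E).
  by apply: continuous_map_into; [exact: continuous_snd|move=> [r t] []].
apply: within_continuous_interp.
- by apply: continuous_subspaceT; exact: continuous_fst.
- by case: snd_into.
- by case: (map_into_comp snd_into rho_map_into).
Qed.

(** The boundary of the cube goes to a single vertex or edge of the tree because
    it is connected, and the labels have bounded length by compactness. *)
Lemma cube_tree_labelled (k : nat) (x : E) (f : 'rV[R]_k -> E) : (2 <= k)%N ->
  map_into (cube R k) U f -> (forall t, cube_boundary R k t -> f t = x) ->
  exists n l, tree_labelled (cube R k) (cube_boundary R k) n.+1 (rho \o f) l.
Proof.
move=> k2 cf fx; have C0 := @cube0 R k.
have sf : stratified le (cube R k) (pos \o f).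
  exact: (stratified_comp cf (gr_stratified gr)).
have [w0 okw0] : exists w, tree_ok (pos (f 0)) w.
  have Uf0 : U (f 0) by have [_] := cf; apply.
  case pf0: (pos (f 0)) => [v|i j]; first by exists [:: v]; split=> //; exists [::].
  have ij : adj i j by exists (f 0).
  exists [:: i; j]; split; first by split=> //; left.
  by split=> //; exists [::]; left.
have [l [okl nearl] l0] := lift_star_shaped tree_system (@cube_star R k) C0 sf okw0.
have tr_near t u : cube R k t -> le (pos (f t)) (pos (f u)) ->
    l u = tree_tr (pos (f t)) (pos (f u)) (l t) -> l u = l t \/
    exists v w x, [/\ l t = v :: w, rho (f t) = loc v & l u = x :: l t].
  move=> Ct; have [_] := okl t Ct.
  have Uft : U (f t) by have [_] := cf; apply.
  rewrite /= ; case pt: (pos (f t)) => [v|i j]; last by case: (pos (f u)); left.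
  move=> [r ltE] _; case: (pos (f u)) => [v'|i j]; first by left.
  rewrite /= /tree_step; case: ifP => _ luE; first by left.
  right; exists v, r; eexists; split; [by []| |exact: luE].
  exact: gr_vertex gr _ _ Uft pt.
have near_l t : cube R k t -> \forall u \near t, cube R k u -> l u = l t \/
    exists v w x, [/\ l t = v :: w, (rho \o f) t = loc v & l u = x :: l t].
  move=> Ct; have := sf t Ct; have := nearl t Ct.
  by apply: filterS2 => u lu le_tu Cu; apply: tr_near => //; [exact: le_tu|exact: lu].
have [n nP] : exists n, forall t, cube R k t -> (size (l t) <= n)%N.
  have /compact_near_coveringP cov := @compact_cube R k.
  have := cov nat \oo (fun n t => cube R k t -> (size (l t) <= n)%N) _.
  move=> /(_ _ _)/filter_ex [t Ct|n hn]; last by exists n => t Ct; exact: hn.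
  exists ([set u | cube R k u -> (size (l u) <= (size (l t)).+1)%N],
          [set n | (size (l t) < n)%N]).
    split; last exact: nbhs_infty_gt.
    have := near_l t Ct; apply: filterS => u hu Cu.
    by have [->//|[v [w [y [-> _ ->]]]]] := hu Cu.
  by move=> [u m] [/= hu tm] Cu; exact: leq_trans (hu Cu) tm.
exists n, l; split.
- exact: map_into_comp cf rho_map_into.
- by move=> t /okl [].
- by move=> t /nP/leqW.
- move=> t Ct; have [_] := okl t Ct; have Uft : U (f t) by have [_] := cf; apply.
  rewrite /=; case pt: (pos (f t)) => [v|i j].
    move=> [r ->]; rewrite (gr_vertex gr Uft pt); case: r => // u r.
    by exists 1; rewrite ?seg1//; exact: in_segment1.
  move=> [_ [r lE]]; have [s s01 ->] := gr_edge gr Uft pt.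
  case: lE => ->; last by exists s => //; apply/in_segment; lra.
  by exists (1 - s); [apply/in_segment; lra|rewrite segC].
- exact: near_l.
- have k0 : (0 < k)%N by exact: leq_trans k2.
  suff lE t : cube_boundary R k t -> l t = l 0.
    by move=> t u Bt Bu; rewrite (lE t Bt) (lE u Bu) /= (fx t Bt) (fx u Bu).
  move=> Bt; have [p hp] := cube_boundary_path k2 Bt.
  apply: (locally_constant_path (P := fun u => l u = l 0) hp) => // u Bu.
  have Cu := cube_boundary_sub Bu.
  have := nearl u Cu; apply: filterS => v lv Bv.
  rewrite (lv (cube_boundary_sub Bv)) /= (fx u Bu) (fx v Bv).
  rewrite (tr_id tree_system)//; have := okl u Cu; by rewrite /= (fx u Bu).
Qed.

(** The contraction of the tree moves the image of the boundary of the cube, but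
    keeps it a point. *)
Lemma graph_aspherical (k : nat) (x : E) : (2 <= k)%N ->
  homotopy_group_trivial R U x k.
Proof.
move=> k2 f cf fx; have k0 : (0 < k)%N by exact: leq_trans k2.
have [n [l tl]] := cube_tree_labelled k2 cf fx.
have [|e ge] := tree_labelled_contractible (@cube0 R k) _ tl.
  move=> t Ct; exists (fun r => r *: t); split; rewrite ?scale0r ?scale1r//.
  apply: continuous_map_into; last by move=> r; exact: cube_star.
  by move=> r; apply: cvgZ; [exact: cvg_id|exact: cvg_cst].
apply: (nullhomotopic_rel_boundary k0 cf fx).
apply: (homotopic_through_trans _ ge).
exists (fun y => seg (f y.2) (rho (f y.2)) y.1); split.
- have mf : map_into (I `*` cube R k) (I `*` U) (fun y => (y.1, f y.2)).
    apply: map_into_pair.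
      by apply: continuous_map_into; [exact: continuous_fst|move=> [r t] []].
    apply: (map_into_comp _ cf).
    by apply: continuous_map_into; [exact: continuous_snd|move=> [r t] []].
  exact: (map_into_comp mf rho_homotopy).
- by move=> t Ct; rewrite seg0.
- by move=> t Ct; rewrite seg1.
- by move=> r Ir t u Bt Bu /=; rewrite !fx.
Qed.

End GraphLike.

(** * The fundamental group of a graph *)

Lemma multiplicative_one (G H : groupType) (psi : {multiplicative G -> H}) :
  psi 1%g = 1%g.
Proof.
have := gmulfM (s := psi) 1%g 1%g; rewrite mulg1.
by move=> /(congr1 (fun a => (psi 1)^-1 * a)%g); rewrite mulVg mulKg.
Qed.

Section Freeness.
Variables (R : realType) (E : normedModType R) (V : eqType) (U : set E).
Variables (pos : E -> position V) (loc : V -> E) (rho : E -> E).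
Hypothesis gr : graph_retraction U pos loc rho.
Notation I := (unit_segment R).
Notation adj := (occurring_edge U pos).
Notation le := (specializes U pos).
Notation link := (link U pos).
Variable root : V.
Hypothesis root_pos : pos (loc root) = Vertex root.
Hypothesis U_root : U (loc root).
Hypothesis U_connected : path_connected R U.
Variables (G : groupType) (cl : (R -> E) -> G).
Hypothesis cl_concat : forall x y z p q, is_path U x y p -> is_path U y z q ->
  cl (path_concat p q) = (cl p * cl q)%g.
Hypothesis cl_homotopic : forall x y p q, is_path U x y p -> is_path U x y q ->
  (cl p = cl q <-> path_homotopic U p q).
Hypothesis cl_onto : forall x y a, U x -> U y ->
  exists2 p, is_path U x y p & cl p = a.

Lemma cl_cst x : U x -> cl (fun=> x) = 1%g.
Proof.
move=> Ux; have hx := is_path_cst R Ux.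
have := cl_concat hx hx; rewrite [path_concat _ _](_ : _ = fun=> x).
  by move/(congr1 (fun a => a * (cl (fun=> x))^-1)%g); rewrite mulgV mulgK.
by apply/funext => t; rewrite /path_concat; case: ifP.
Qed.

Lemma cl_inv x y p : is_path U x y p -> cl (path_inv p) = (cl p)^-1%g.
Proof.
move=> hp; have [Ux Uy] := is_path_ends hp; have hp' := is_path_inv hp.
have h : (cl p * cl (path_inv p) = 1)%g.
  rewrite -(cl_concat hp hp') -(cl_cst Ux).
  have hc := is_path_cst R Ux.
  by apply/(cl_homotopic (is_path_concat hp hp') hc)/path_concat_inv/hp.
by rewrite -[LHS]mul1g -(mulVg (cl p)) -mulgA h mulg1.
Qed.

Lemma seg_continuous (x y : E) : continuous (seg x y : R -> E).
Proof.
move=> r; apply: cvgD; (apply: cvgZ; last exact: cvg_cst).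
  by apply: cvgB; [exact: cvg_cst|exact: cvg_id].
exact: cvg_id.
Qed.

Lemma is_path_seg (D : set E) (x y : E) :
  (forall r, I r -> D (seg x y r)) -> is_path D x y (seg x y).
Proof.
move=> h; split; rewrite ?seg0 ?seg1//.
exact: (continuous_map_into (@seg_continuous x y)).
Qed.

Lemma cl_seg_inv x y : (forall r, I r -> U (seg x y r)) ->
  cl (seg y x) = (cl (seg x y))^-1%g.
Proof.
move=> h; rewrite -(cl_inv (is_path_seg h)); congr cl; apply/funext => r.
by rewrite /path_inv segC; congr seg; ring.
Qed.

Lemma cl_triangle (D : set E) (x y z : E) : D `<=` U ->
  (forall a b r, D a -> D b -> I r -> D (seg a b r)) -> D x -> D y -> D z ->
  (cl (seg x y) * cl (seg y z) = cl (seg x z))%g.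
Proof.
move=> DU convD Dx Dy Dz.
have hD a b : D a -> D b -> is_path D a b (seg a b).
  by move=> Da Db; apply: is_path_seg => r; exact: convD.
have hU a b : D a -> D b -> is_path U a b (seg a b).
  by move=> Da Db; apply: is_path_seg => r Ir; apply: DU; exact: convD.
rewrite -(cl_concat (hU _ _ Dx Dy) (hU _ _ Dy Dz)).
have hc := is_path_concat (hD _ _ Dx Dy) (hD _ _ Dy Dz).
apply/(cl_homotopic (is_path_concat (hU _ _ Dx Dy) (hU _ _ Dy Dz)) (hU _ _ Dx Dz)).
have cid : map_into D U id.
  by apply: continuous_map_into => // t; exact: cvg_id.
have [[cc Dc] c0 c1] := hc; have [[cs Ds] s0 s1] := hD _ _ Dx Dz.
apply: (homotopic_segments (Q := id) cid cc cs).
  by move=> r t Ir It; apply: convD => //; [exact: Dc|exact: Ds].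
by move=> r t Ir [->|->]; rewrite ?c0 ?s0 ?c1 ?s1 -scalerDl subrK scale1r.
Qed.

(** A path in a set that is star-shaped from the start of this path is
    homotopic to a segment: the cone over the path is a map from a square, two
    consecutive sides of which form the path and the other two the segment. *)
Lemma cl_star x y q : is_path U x y q ->
  (forall s r, I s -> I r -> U (seg x (q s) r)) -> cl q = cl (seg x y).
Proof.
move=> hq star; have [cq q0 q1] := hq; have [Ux Uy] := is_path_ends hq.
have hs : is_path U x y (seg x y).
  by apply: is_path_seg => r Ir; rewrite -q1; apply: star => //; exact: in_segment1.
have hx := is_path_cst R Ux.
suff h : path_homotopic U (path_concat (fun=> x) q) (path_concat (fun=> x) (seg x y)).
  have hq' := is_path_concat hx hq; have hs' := is_path_concat hx hs.
  have := (cl_homotopic hq' hs').2 h.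
  by rewrite (cl_concat hx hq) (cl_concat hx hs) cl_cst// !mul1g.
pose up (t : R) := Num.min (0 * t + 1) (2 * t + 0).
pose late (t : R) := Num.max (0 * t + 0) (2 * t - 1).
have cup : continuous up by apply: continuous_minr; exact: continuous_affine_id.
have clate : continuous late by apply: continuous_maxr; exact: continuous_affine_id.
have Iup t : I t -> I (up t).
  move=> /in_segment t01; apply/in_segment; rewrite /up le_min ge_min; lra.
have Ilate t : I t -> I (late t).
  move=> /in_segment t01; apply/in_segment; rewrite /late le_max ge_max; lra.
have E1 t : t <= 2^-1 -> up t = 2 * t /\ late t = 0.
  by move=> t2; rewrite /up /late min_r ?max_l; lra.
have E2 t : 2^-1 < t -> up t = 1 /\ late t = 2 * t - 1.
  by move=> t2; rewrite /up /late min_l ?max_r; lra.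
pose Q (z : R * R) := seg x (q z.2) z.1.
have cQ : map_into (I `*` I) U Q.
  split; last by move=> [r s] [/= Ir Is]; exact: star.
  apply: within_continuous_interp.
  - by apply: continuous_subspaceT; exact: continuous_fst.
  - by apply: continuous_subspaceT; exact: cst_continuous.
  - suff [] : map_into (I `*` I) U (q \o (@snd R R)) by [].
    apply: map_into_comp cq.
    by apply: continuous_map_into; [exact: continuous_snd|move=> [r t] []].
have [I0 I1] := (in_segment0 R, in_segment1 R).
have := @homotopic_segments R R E (R * R)%type (I `*` I) I [set 0; 1] U Q
  (fun t => (up t, late t)) (fun t => (late t, up t)) cQ.
move=> hom; apply: eq_path_homotopic (hom _ _ _ _).
- move=> t It; rewrite /Q /path_concat /=; have [t2|t2] := leP t 2^-1.
    by have [-> ->] := E1 t t2; rewrite q0 /seg -scalerDl subrK scale1r.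
  by have [-> ->] := E2 t t2; rewrite seg1.
- move=> t It; rewrite /Q /path_concat /=; have [t2|t2] := leP t 2^-1.
    by have [-> ->] := E1 t t2; rewrite seg0.
  by have [-> ->] := E2 t t2; rewrite q1.
- by apply: continuous_subspaceT; exact: continuous_pair.
- by apply: continuous_subspaceT; exact: continuous_pair.
- have conv (a b r : R) : 0 <= r <= 1 -> 0 <= a <= 1 -> 0 <= b <= 1 ->
      I ((1 - r) * a + r * b) by move=> ? ? ?; apply/in_segment; nra.
  move=> r t /in_segment Ir It; have /in_segment := Iup t It.
  have /in_segment := Ilate t It => h1 h2.
  by split; [apply: (conv (up t) (late t))|apply: (conv (late t) (up t))].
- move=> r t Ir [->|->].
    have [e1 e2] : up 0 = 0 /\ late 0 = 0 by have := E1 0; rewrite mulr0; apply; lra.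
    by congr Q; rewrite e1 e2 -scalerDl subrK scale1r.
  have [e1 e2] : up 1 = 1 /\ late 1 = 1.
    by have := E2 1; rewrite two_sub_one; apply; lra.
  by congr Q; rewrite e1 e2 -scalerDl subrK scale1r.
Qed.

(** * A spanning tree *)

Definition present v := U (loc v) /\ pos (loc v) = Vertex v.

Lemma present_of u v : U u -> pos u = Vertex v -> present v.
Proof.
move=> Uu pu; split; first by rewrite -(gr_vertex gr Uu pu); exact: rho_in gr _ Uu.
by apply: (gr_pos_vertex gr); exists u.
Qed.

Lemma present_ends i j : adj i j -> present i /\ present j.
Proof.
move=> ij; have [pi pj] := gr_pos_ends gr ij; split; split=> //.
  by rewrite -(seg0 (loc i) (loc j)); apply: (gr_edge_sub gr ij); exact: in_segment0.
by rewrite -(seg1 (loc i) (loc j)); apply: (gr_edge_sub gr ij); exact: in_segment1.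
Qed.

Lemma present_link i j : link i j -> present i /\ present j.
Proof. by move=> [/present_ends|/present_ends []]. Qed.

Lemma linkC i j : link i j -> link j i.
Proof. by move=> [?|?]; [right|left]. Qed.

Lemma is_path_link i j : link i j ->
  is_path U (loc i) (loc j) (seg (loc i) (loc j)).
Proof. by move=> ij; apply: is_path_seg => r; exact: (link_seg gr). Qed.

Fixpoint within_steps (n : nat) (v : V) : Prop :=
  if n is n'.+1 then exists2 u, link v u & within_steps n' u else v = root.

(** The vertices that are joined to the root by edges form an open and closed
    part of the graph. *)
Lemma reachable v : present v -> exists n, within_steps n v.
Proof.
move=> [Uv pv].
pose reach a := match a with
  | Vertex v => exists n, within_steps n v
  | Edge i j => exists n, within_steps n i
  end.
have [p hp] := U_connected U_root Uv.
suff : reach (pos (loc v)) by rewrite pv.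
apply: (locally_constant_path (P := fun u => reach (pos u)) hp); last first.
  by rewrite root_pos; exists 0%N.
move=> u Uu; have := gr_stratified gr Uu; apply: filterS => t + Ut.
move=> /(_ Ut) [->//|[i [j [-> ij [->|->]]]]] //=.
by split=> -[n hn]; exists n.+1; [exists j|exists i] => //; [left|right].
Qed.

(** A spanning tree, given by the paths from its vertices to the root: the
    neighbor chosen for a vertex is one step nearer to the root, so that the
    choices fit together. *)
Lemma tree_walk : exists walk : V -> seq V, walk root = [:: root] /\
  forall v, present v -> v != root -> exists2 u, link v u & walk v = v :: walk u.
Proof.
have exd v : exists d, present v -> within_steps d v /\
    forall m, within_steps m v -> (d <= m)%N.
  case: (pselect (present v)) => [pv|npv]; last by exists 0%N.
  have ex : exists n, `[< within_steps n v >].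
    by have [n hn] := reachable pv; exists n; apply/asboolP.
  exists (ex_minn ex) => _; case: ex_minnP => m /asboolP hm min; split=> // k hk.
  by apply: min; apply/asboolP.
have [d dP] := choice exd.
have expar v : exists u, present v -> v != root ->
    link v u /\ d v = (d u).+1.
  case: (pselect (present v)) => [pv|npv]; last by exists v.
  have [hd mind] := dP v pv.
  case dv : (d v) hd mind => [|m] /= hd mind.
    by exists v; rewrite hd eqxx.
  have [u vu hu] := hd; exists u => _ _; split=> //; congr _.+1.
  have [_ pu] := present_link vu; have [hdu minu] := dP u pu.
  apply/eqP; rewrite eqn_leq minu// andbT -ltnS.
  by apply: mind; exists u.
have [par parP] := choice expar.
pose W := fix W n v := if n is n'.+1 then v :: W n' (par v) else [:: v].
exists (fun v => W (d v) v).
have proot : present root by split.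
have d0 : d root = 0%N.
  by apply/eqP; rewrite -leqn0; apply: (dP root proot).2.
split=> [|v pv vr]; first by rewrite d0.
by have [vu dv] := parP v pv vr; exists (par v) => //; rewrite dv.
Qed.

(** * The local system of a labelling of the edges by a group *)

Section GroupSystem.
Variables (H : groupType) (kappa : V -> V -> H).

(** The edges are oriented, so that the label over an edge can be taken equal to
    the label over its first end; passing to the other end costs a factor. *)
Definition group_ok (_ : position V) (_ : H) : Prop := True.

Definition edge_factor (a b : position V) : H :=
  match a, b with
  | Vertex v, Edge i j => if v == i then 1%g else kappa i j
  | _, _ => 1%g
  end.

Definition group_tr (a b : position V) (y : H) : H := (y * edge_factor a b)%g.

Lemma group_system : local_system le group_ok group_tr.
Proof.
have id_edge a : edge_factor a a = 1%g by case: a.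
have id_edge' i j b : edge_factor (Edge i j) b = 1%g by case: b.
split=> //.
- by move=> a y _; rewrite /group_tr id_edge mulg1.
- move=> a b c y [<-|[i [j [-> _ _]]]] lbc _; rewrite /group_tr -mulgA.
    by rewrite id_edge mul1g.
  by rewrite id_edge' mulg1; case: lbc => [<-//|[i' [j' [_ _ []]]]].
- move=> a b z _ _; exists (z * (edge_factor a b)^-1)%g => //.
  by rewrite /group_tr mulgKV.
- by move=> a b y z _ _ _; exact: mulIg.
Qed.

Notation hol := (@holonomy R _ _ group_ok group_tr).

(** The transport acts on the right, hence commutes with translations on the
    left: this makes the holonomy multiplicative. *)
Lemma holonomy_left p y z h : hol p y z -> hol p (h * y)%g (h * z)%g.
Proof.
move=> [l [[_ hl] l0 l1]]; exists (fun t => (h * l t)%g).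
split; [|by rewrite l0|by rewrite l1]; split=> // t It.
have := hl t It; apply: filterS => u hu Iu.
by rewrite hu// /group_tr mulgA.
Qed.

Lemma holonomy_edge i j y : adj i j ->
  hol (pos \o seg (loc j) (loc i)) y (y * kappa i j)%g.
Proof.
move=> ij; have [[_ pi] [_ pj]] := present_ends ij.
have ji : (j == i) = false by apply/negbTE; rewrite eq_sym; exact: adj_neq gr _ _ ij.
have posE r : 0 < r <= 1 -> edge_factor (Vertex j) (pos (seg (loc j) (loc i) r)) =
    (if r < 1 then kappa i j else 1%g).
  move=> r01; have [r1|r1] := ltP r 1; last first.
    by rewrite (_ : r = 1) ?seg1 ?pi//; lra.
  by rewrite segC (gr_pos_edge gr ij) /= ?ji//; lra.
pose l (r : R) := if r <= 0 then y else (y * kappa i j)%g.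
have l0 : l 0 = y by rewrite /l lexx.
have l1 : l 1 = (y * kappa i j)%g by rewrite /l ifF//; lra.
exists l; split=> //; split=> // r /in_segment r01.
have [r0|r0] := leP r 0.
  have -> : r = 0 by lra.
  rewrite l0 /= seg0 pj.
  near=> u => /in_segment u01; have [u0|u0] := leP u 0.
    have -> : u = 0 by lra.
    by rewrite l0 seg0 pj /group_tr mulg1.
  have u1 : u < 1 by near: u; apply: lt_nbhsl; lra.
  by rewrite /l leNgt u0 /= /group_tr posE ?u1//; lra.
have lE u : 0 < u -> l u = (y * kappa i j)%g by move=> u0; rewrite /l leNgt u0.
rewrite lE//; near=> u => /in_segment u01.
have u0 : 0 < u by near: u; exact: lt_nbhsr.
rewrite lE// /group_tr /=; have [r1|r1] := ltP r 1.
  rewrite [X in edge_factor X](_ : _ = Edge i j) /= ?mulg1//.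
  by rewrite segC (gr_pos_edge gr ij)//; lra.
have -> : r = 1 by lra.
rewrite seg1 pi; have [u1|u1] := ltP u 1.
  by rewrite segC (gr_pos_edge gr ij) /= ?eqxx ?mulg1//; lra.
have -> : u = 1 by lra.
by rewrite seg1 pi mulg1.
Unshelve. all: by end_near.
Qed.

Lemma holonomy_edge_inv i j y : adj i j ->
  hol (pos \o seg (loc i) (loc j)) y (y * (kappa i j)^-1)%g.
Proof.
move=> ij; have := holonomy_inv (holonomy_edge (y * (kappa i j)^-1)%g ij).
rewrite mulgKV [path_inv _](_ : _ = seg (loc i) (loc j))//.
by apply/funext => r; rewrite /path_inv segC; congr seg; ring.
Qed.

End GroupSystem.

Notation hol kappa := (@holonomy R _ _ (@group_ok _) (group_tr kappa)).

Section SpanningTree.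
Variable walk : V -> seq V.
Hypothesis walk_root : walk root = [:: root].
Hypothesis walk_step : forall v, present v -> v != root ->
  exists2 u, link v u & walk v = v :: walk u.

Fixpoint list_path (w : seq V) : R -> E :=
  if w is v :: w' then
    if w' is u :: _ then path_concat (list_path w') (seg (loc u) (loc v))
    else fun=> loc v
  else fun=> 0.

Definition tree_path v := list_path (walk v).

Definition tree_edge i j := walk j = j :: walk i \/ walk i = i :: walk j.

Lemma walk_head v : present v -> exists w, walk v = v :: w.
Proof.
move=> pv; have [->|vr] := eqVneq v root; first by exists [::].
by have [u _ ->] := walk_step pv vr; exists (walk u).
Qed.

Lemma tree_path_cons u v : present u -> walk v = v :: walk u ->
  tree_path v = path_concat (tree_path u) (seg (loc u) (loc v)).
Proof. by move=> pu; rewrite /tree_path => ->; have [w ->] := walk_head pu. Qed.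

Lemma tree_ind (P : V -> Prop) : P root ->
  (forall u v, link v u -> walk v = v :: walk u -> P u -> P v) ->
  forall v, present v -> P v.
Proof.
move=> P0 PS v; have [n] := ubnP (size (walk v)).
elim: n v => // n IHn v sz pv; have [->//|vr] := eqVneq v root.
have [u vu wE] := walk_step pv vr; apply: (PS _ _ vu wE).
by apply: IHn; [rewrite wE in sz|have [] := present_link vu].
Qed.

Lemma tree_pathP v : present v -> is_path U (loc root) (loc v) (tree_path v).
Proof.
move: v; apply: tree_ind.
  by rewrite /tree_path walk_root; exact: is_path_cst.
move=> u v vu wE hu; have [_ pu] := present_link vu.
rewrite (tree_path_cons pu wE); apply: (is_path_concat hu _).
by apply: is_path_link; exact: linkC.
Qed.

Lemma holonomy_tree (H : groupType) (kappa : V -> V -> H) :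
  (forall i j, adj i j -> tree_edge i j -> kappa i j = 1%g) ->
  forall v, present v -> hol kappa (pos \o tree_path v) 1%g 1%g.
Proof.
move=> k1; apply: tree_ind.
  rewrite /tree_path walk_root.
  exact: (holonomy_cst R (group_system kappa) (a := pos (loc root))).
move=> u v vu wE hu; have [_ pu] := present_link vu.
rewrite (tree_path_cons pu wE); apply: (holonomy_concat _ hu _).
  by have [_ _ ->] := tree_pathP pu; rewrite seg0.
case: vu => [vu|uv].
  have := holonomy_edge kappa 1%g vu; rewrite k1 ?mulg1//.
  by right.
have := holonomy_edge_inv kappa 1%g uv; rewrite k1 ?invg1 ?mulg1//.
by left.
Qed.

Definition tree_class v : G := cl (tree_path v).

Definition edge_loop i j : R -> E :=
  path_concat (path_concat (tree_path j) (seg (loc j) (loc i)))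
              (path_inv (tree_path i)).

Definition edge_class i j : G :=
  (tree_class j * cl (seg (loc j) (loc i)) * (tree_class i)^-1)%g.

Lemma edge_loopP i j : adj i j -> is_path U (loc root) (loc root) (edge_loop i j).
Proof.
move=> ij; have [pi pj] := present_ends ij.
apply: (is_path_concat _ (is_path_inv (tree_pathP pi))).
apply: (is_path_concat (tree_pathP pj) _).
by apply: is_path_link; right.
Qed.

Lemma cl_edge_loop i j : adj i j -> cl (edge_loop i j) = edge_class i j.
Proof.
move=> ij; have [pi pj] := present_ends ij.
have hji : is_path U (loc j) (loc i) (seg (loc j) (loc i)).
  by apply: is_path_link; right.
have hi := tree_pathP pi; have hj := tree_pathP pj.
rewrite /edge_loop (cl_concat (is_path_concat hj hji) (is_path_inv hi)).
by rewrite (cl_concat hj hji) (cl_inv hi).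
Qed.

Lemma edge_class_tree i j : adj i j -> tree_edge i j -> edge_class i j = 1%g.
Proof.
move=> ij; have [pi pj] := present_ends ij; rewrite /edge_class /tree_class.
have hij : is_path U (loc i) (loc j) (seg (loc i) (loc j)).
  by apply: is_path_link; left.
have hji : is_path U (loc j) (loc i) (seg (loc j) (loc i)).
  by apply: is_path_link; right.
have hi := tree_pathP pi; have hj := tree_pathP pj.
case=> wE.
  rewrite (tree_path_cons pi wE) (cl_concat hi hij) (@cl_seg_inv (loc i) (loc j)).
    by rewrite mulgK mulgV.
  by move=> r; exact: (gr_edge_sub gr ij).
by rewrite (tree_path_cons pj wE) (cl_concat hj hji) mulgV.
Qed.

Lemma holonomy_edge_loop (H : groupType) (kappa : V -> V -> H) i j :
  (forall i j, adj i j -> tree_edge i j -> kappa i j = 1%g) ->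
  adj i j -> hol kappa (pos \o edge_loop i j) 1%g (kappa i j).
Proof.
move=> k1 ij; have [pi pj] := present_ends ij.
have hi := tree_pathP pi; have [_ j0 j1] := tree_pathP pj.
apply: (holonomy_concat (y := kappa i j)); last first.
- have := holonomy_left (kappa i j) (holonomy_inv (holonomy_tree k1 pi)).
  by rewrite mulg1.
- apply: (holonomy_concat _ (holonomy_tree k1 pj) _); first by rewrite j1 seg0.
  by have := holonomy_edge kappa 1%g ij; rewrite mul1g.
- have [_ -> _] := is_path_inv hi.
  by rewrite /path_concat ifF ?two_sub_one ?seg1//; lra.
Qed.

(** A standard way from the base point to [rho u]: through the tree, and then
    along a part of an edge, entered from its first end. *)
Definition frame (u : E) : G :=
  match pos u with
  | Vertex v => tree_class v
  | Edge i j => (tree_class i * cl (seg (loc i) (rho u)))%g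
  end.

Lemma edge_convex i j a b r :
  (exists2 r, I r & a = seg (loc i) (loc j) r) ->
  (exists2 r, I r & b = seg (loc i) (loc j) r) -> I r ->
  exists2 r', I r' & seg a b r = seg (loc i) (loc j) r'.
Proof.
move=> [r1 I1 ->] [r2 I2 ->] Ir; exists ((1 - r) * r1 + r * r2).
  by move: I1 I2 Ir => /in_segment ? /in_segment ? /in_segment ?; apply/in_segment; nra.
rewrite /seg !scalerDr !scalerA addrACA -!scalerDl.
by congr (_ *: _ + _); ring.
Qed.

Lemma edge_first i j : exists2 r, I r & loc i = seg (loc i) (loc j) r.
Proof. by exists 0; rewrite ?seg0//; exact: in_segment0. Qed.

Lemma edge_last i j : exists2 r, I r & loc j = seg (loc i) (loc j) r.
Proof. by exists 1; rewrite ?seg1//; exact: in_segment1. Qed.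

Lemma cl_edge_triangle i j a b c : adj i j ->
  (exists2 r, I r & a = seg (loc i) (loc j) r) ->
  (exists2 r, I r & b = seg (loc i) (loc j) r) ->
  (exists2 r, I r & c = seg (loc i) (loc j) r) ->
  (cl (seg a b) * cl (seg b c) = cl (seg a c))%g.
Proof.
move=> ij; apply: (cl_triangle (D := [set x | exists2 r, I r & x = seg (loc i) (loc j) r])).
  by move=> x [r Ir ->]; exact: (gr_edge_sub gr ij Ir).
by move=> x y r; exact: edge_convex.
Qed.

Lemma rho_in_edge u i j : U u -> pos u = Edge i j ->
  exists2 r, I r & rho u = seg (loc i) (loc j) r.
Proof.
move=> Uu pu; have [r r01 ->] := gr_edge gr Uu pu.
by exists r => //; apply/in_segment; lra.
Qed.

Lemma rho_segment u t r : U u -> U t -> le (pos u) (pos t) -> I r ->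
  U (seg (rho u) (rho t) r).
Proof.
move=> Uu Ut le_ut Ir.
suff [[i [j [ij hu ht]]]|e] : (exists i j, [/\ adj i j,
    exists2 r, I r & rho u = seg (loc i) (loc j) r &
    exists2 r, I r & rho t = seg (loc i) (loc j) r]) \/ rho u = rho t.
- by have [r' Ir' ->] := edge_convex hu ht Ir; exact: (gr_edge_sub gr ij).
- by rewrite e /seg -scalerDl subrK scale1r; exact: rho_in gr _ Ut.
case: le_ut => [e|[i [j [pt ij pu]]]].
  case pu: (pos u) => [v|i j]; have pt := pu; rewrite e in pt.
    by right; rewrite (gr_vertex gr Uu pu) (gr_vertex gr Ut pt).
  left; exists i, j; split; [by exists u|exact: rho_in_edge|exact: rho_in_edge].
left; exists i, j; split=> //; last exact: rho_in_edge.
by case: pu => pu; rewrite (gr_vertex gr Uu pu); [exact: edge_first|exact: edge_last].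
Qed.

(** A short segment of the graph is a standard way back followed by a standard
    way out, except that it picks up an edge loop when it enters an edge from the
    second end. *)
Lemma frame_step u t : U u -> U t -> le (pos u) (pos t) ->
  cl (seg (rho u) (rho t)) =
    ((frame u)^-1 * edge_factor edge_class (pos u) (pos t) * frame t)%g.
Proof.
move=> Uu Ut.
move=> [e|[i [j [pt ij pu]]]].
  rewrite -e /frame -e; case pu: (pos u) => [v|i j] /=; rewrite mulg1.
    have pt : pos t = Vertex v by rewrite -e.
    rewrite mulVg (gr_vertex gr Uu pu) (gr_vertex gr Ut pt).
    have [Uv _] := present_of Uu pu; rewrite -(cl_cst Uv); congr cl.
    by apply/funext => r; rewrite /seg -scalerDl subrK scale1r.
  have pt : pos t = Edge i j by rewrite -e.
  have ij : adj i j by exists u.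
  rewrite invgM !mulgA mulgKV.
  rewrite -(cl_edge_triangle ij (edge_first i j) (rho_in_edge Uu pu) (rho_in_edge Ut pt)).
  by rewrite mulKg.
case: pu => pu; rewrite /frame pt pu (gr_vertex gr Uu pu) /=.
  by rewrite eqxx mulg1 mulKg.
rewrite [j == i]eq_sym (negPf (adj_neq gr ij)) /edge_class !mulgA.
rewrite mulVg mul1g mulgKV.
by rewrite (cl_edge_triangle ij (edge_last i j) (edge_first i j) (rho_in_edge Ut pt)).
Qed.

(** The initial parts of a loop in the graph, brought back to the base point in
    the standard way, have classes that form a lift of the loop, for the labelling
    of the edges by the classes of the edge loops.  So a morphism is determined by
    its values on these classes: they generate the fundamental group. *)
Lemma holonomy_morphism (H : groupType) (psi : {multiplicative G -> H})
    (kappa : V -> V -> H) (p : R -> E) :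
  (forall i j, adj i j -> kappa i j = psi (edge_class i j)) ->
  is_path U (loc root) (loc root) p -> hol kappa (pos \o p) 1%g (psi (cl p)).
Proof.
move=> kE hp; set x0 := loc root in hp *.
have [I0 I1] := (in_segment0 R, in_segment1 R).
have psi1 := multiplicative_one psi.
pose g : R -> E := rho \o p.
have [cp p0 p1] := hp.
have rho0 : rho x0 = x0 by exact: gr_vertex gr _ _ U_root root_pos.
have hg : is_path U x0 x0 g.
  split; [exact: (map_into_comp cp (rho_map_into gr))| |];
    by rewrite /g /= ?p0 ?p1 rho0.
have [cg g0 g1] := hg.
have Up t : I t -> U (p t) by case: cp => _; exact.
have -> : cl p = cl g.
  apply/(cl_homotopic hp hg).
  apply: (homotopic_segments (D := U) (Q := id) (a := p) (b := g)).
  - by apply: continuous_map_into => // t; exact: cvg_id.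
  - by case: cp.
  - by case: cg.
  - by move=> r t Ir /Up Upt; exact: (gr_segment gr Upt Ir).
  - by move=> r t Ir [->|->]; rewrite ?g0 ?p0 ?g1 ?p1 -scalerDl subrK scale1r.
pose part (t : R) : R -> E := g \o (fun s => t * s + 0).
have hpart t : I t -> is_path U x0 (g t) (part t).
  move=> It; have [ct c0 c1] := segment_path It; split.
  - exact: (map_into_comp ct cg).
  - by rewrite /part /= c0 g0.
  - by rewrite /part /= c1.
pose l t := psi (cl (part t) * (frame (p t))^-1)%g.
have frame0 : frame x0 = 1%g.
  by rewrite /frame root_pos /tree_class /tree_path walk_root /= cl_cst.
exists l; split; last 2 first.
- rewrite /l p0 frame0 invg1 mulg1 -psi1; congr (psi _); rewrite -(cl_cst U_root).
  by congr cl; apply/funext => s; rewrite /part /= mul0r addr0 g0.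
- rewrite /l p1 frame0 invg1 mulg1; congr (psi (cl _)).
  by apply/funext => s; rewrite /part /= mul1r addr0.
split=> // t It.
have sp : stratified le I (pos \o p).
  exact: (stratified_comp cp (gr_stratified gr)).
have := sp t It; rewrite -nbhs_nearE => /nbhs_ballP [e /= e0 he].
have : nbhs t (ball t e) by exact: nbhsx_ballx.
apply: filterS => u bu Iu; have le_tu := he u bu Iu.
have btt : ball t e t by exact: ballxx.
have tu (s : R) : I s -> ball t e ((u - t) * s + t) /\ I ((u - t) * s + t).
  move=> /in_segment s01; split.
    by move: btt bu; rewrite /ball /= !ltr_distlC => ? ?; exact: itv_convex.
  by move: It Iu => /in_segment ? /in_segment ?; apply/in_segment; nra.
pose q (s : R) := g ((u - t) * s + t).
have cq : is_path I t u (fun s => (u - t) * s + t).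
  split; last 2 first.
  - by rewrite mulr0 add0r.
  - by rewrite mulr1 subrK.
  apply: continuous_map_into; first exact: continuous_affine_id.
  by move=> s /tu [].
have hq : is_path U (g t) (g u) q.
  have [cq' q0 q1] := cq; split; rewrite /q ?q0 ?q1//.
  exact: (map_into_comp cq' cg).
have partE : (cl (part u) = cl (part t) * cl (seg (g t) (g u)))%g.
  rewrite -(cl_star hq); last first.
    move=> s r /tu [bs Is] Ir.
    by apply: rho_segment => //; [exact: Up|exact: Up|exact: he].
  rewrite -(cl_concat (hpart t It) hq).
  apply/(cl_homotopic (hpart u Iu) (is_path_concat (hpart t It) hq)).
  have [c1 c10 c11] := segment_path Iu.
  have [c2 c20 c21] := is_path_concat (segment_path It) cq.
  have := path_homotopic_reparam cg c1 c2; rewrite c10 c11 c20 c21.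
  move=> /(_ erefl erefl); apply: eq_path_homotopic => // s _.
  by rewrite /path_concat /part /q /=; case: ifP.
rewrite /l /group_tr partE (frame_step (Up t It) (Up u Iu) le_tu).
rewrite !mulgA mulgK [LHS]gmulfM; congr (_ * _)%g.
case: le_tu => [/= <-|[i [j [/= -> ij pt]]]].
  by case: (pos (p t)) => *; rewrite /= psi1.
by case: pt => ->; rewrite /=; case: ifP => // _; rewrite kE.
Qed.

(** The basis consists of the classes of the edge loops of the edges outside of
    the tree.  Given values for them, label these edges by the values and the
    edges of the tree by 1: the holonomy is the morphism sought. *)
Lemma fundamental_group_free : free_group G.
Proof.
exists [set a | exists i j, [/\ adj i j, ~ tree_edge i j & a = edge_class i j]].
move=> H h.
pose kappa i j := if `[< tree_edge i j >] then 1%g else h (edge_class i j).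
have k1 i j : adj i j -> tree_edge i j -> kappa i j = 1%g.
  by move=> _ /asboolP; rewrite /kappa => ->.
have ex a : exists z, forall p, is_path U (loc root) (loc root) p -> cl p = a ->
    hol kappa (pos \o p) 1%g z.
  have [p hp pa] := cl_onto a U_root U_root.
  have sp q : is_path U (loc root) (loc root) q -> stratified le I (pos \o q).
    by move=> [cq _ _]; exact: (stratified_comp cq (gr_stratified gr)).
  have [z hz] := holonomy_exists (group_system kappa) (y := 1%g) (sp p hp) Logic.I.
  exists z => q hq qa.
  apply: (holonomy_homotopic (group_system kappa) (gr_stratified gr) _ hz).
  by apply/(cl_homotopic hp hq); rewrite pa qa.
have [phi phiP] := choice ex.
have sp q : is_path U (loc root) (loc root) q -> stratified le I (pos \o q).
  by move=> [cq _ _]; exact: (stratified_comp cq (gr_stratified gr)).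
have hol_fun p z z' : is_path U (loc root) (loc root) p ->
    hol kappa (pos \o p) 1%g z -> hol kappa (pos \o p) 1%g z' -> z = z'.
  by move=> /sp; exact: holonomy_fun (group_system kappa) _ _ _ _.
have phiM : {morph phi : a b / (a * b)%g}.
  move=> a b; have [p hp pa] := cl_onto a U_root U_root.
  have [q hq qb] := cl_onto b U_root U_root.
  have hpq := is_path_concat hp hq.
  apply: (hol_fun _ _ _ hpq).
    by apply: phiP => //; rewrite (cl_concat hp hq) pa qb.
  apply: (holonomy_concat (y := phi a)).
  - by have [_ _ ->] := hp; have [_ -> _] := hq.
  - exact: phiP.
  - by have := holonomy_left (phi a) (phiP b q hq qb); rewrite mulg1.
pose phiH : {multiplicative G -> H} :=
  HB.pack_for (Multiplicative.type G H) phi (isMultiplicative.Build G H phi phiM).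
exists phiH.
  move=> a [i [j [ij nt aE]]].
  apply: (hol_fun _ _ _ (edge_loopP ij)).
    by apply: phiP; [exact: edge_loopP|rewrite cl_edge_loop].
  have -> : h a = kappa i j by rewrite aE /kappa; case: asboolP.
  exact: holonomy_edge_loop.
move=> psi psih a; have [p hp pa] := cl_onto a U_root U_root.
apply: (hol_fun _ _ _ hp); last exact: phiP.
rewrite -pa; apply: holonomy_morphism hp => i j ij.
rewrite /kappa; case: asboolP => [tij|ntij].
  by rewrite edge_class_tree// multiplicative_one.
by rewrite psih//; exists i, j.
Qed.

End SpanningTree.

End Freeness.

Theorem graph_K_pi_1 (R : realType) (E : normedModType R) (V : eqType)
    (U : set E) (pos : E -> position V) (loc : V -> E) (rho : E -> E) (root : V) :
  graph_retraction U pos loc rho ->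
  U (loc root) -> pos (loc root) = Vertex root -> path_connected R U ->
  exists2 G : groupType, free_group G & K_pi_1 R G U.
Proof.
move=> gr Uroot proot Upc.
have [G [cl [clM clh clo]]] := fundamental_groupoid Uroot Upc.
have [walk [w0 wS]] := tree_walk gr proot Uroot Upc.
exists G; first exact: (fundamental_group_free gr proot Uroot clM clh clo w0 wS).
split=> //; first by exists (loc root).
move=> x Ux; split; last by move=> k; exact: graph_aspherical gr _ _.
exists cl; split=> [p q|p q|a].
- exact: clM.
- exact: clh.
- exact: clo.
Qed.

(** * Affine functions and general position *)

Section Affine.
Variables (R : realType) (N : nat).
Notation E := 'rV[R]_N.
Implicit Types (s t : seq E) (c : 'cV[R]_(N + 1)) (u v : E) (w : E -> R).

(** In homogeneous coordinates affine functions become linear, and affine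
    independence becomes linear independence. *)
Definition homog u : 'rV[R]_(N + 1) := row_mx u 1%:M.

Definition aff c u : R := (homog u *m c) 0 0.

Lemma homog_sum s w : \sum_(v <- s) w v = 1 ->
  homog (\sum_(v <- s) w v *: v) = \sum_(v <- s) w v *: homog v.
Proof.
move=> w1; rewrite /homog.
suff -> : \sum_(v <- s) w v *: row_mx v 1%:M =
    row_mx (\sum_(v <- s) w v *: v) ((\sum_(v <- s) w v)%:M : 'M_1) by rewrite w1.
elim: s {w1} => [|v s IHs]; first by rewrite !big_nil raddf0 row_mx0.
by rewrite !big_cons IHs scale_row_mx add_row_mx scale_scalar_mx mulr1 raddfD.
Qed.

Lemma aff_sum s w c : \sum_(v <- s) w v = 1 ->
  aff c (\sum_(v <- s) w v *: v) = \sum_(v <- s) w v * aff c v.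
Proof.
move=> w1; rewrite /aff homog_sum// mulmx_suml summxE.
by apply: eq_bigr => v _; rewrite -scalemxAl mxE.
Qed.

Lemma aff_seg c u v (r : R) :
  aff c ((1 - r) *: u + r *: v) = (1 - r) * aff c u + r * aff c v.
Proof.
rewrite /aff [homog _](_ : _ = (1 - r) *: homog u + r *: homog v).
  by rewrite mulmxDl -!scalemxAl !mxE.
rewrite /homog !scale_row_mx add_row_mx !scale_scalar_mx -raddfD /=.
by congr (row_mx _ _%:M); ring.
Qed.

Lemma continuous_aff c : continuous (aff c).
Proof.
rewrite /aff; under eq_fun do rewrite mxE.
apply: continuous_sumr => k.
apply: (continuous_mulr (g := fun=> c k 0)); last exact: cst_continuous.
rewrite -(splitK k); case: (fintype.split k) => i /=.
  have -> : (fun v : E => homog v 0 (lshift 1 i)) = (fun v => v ord0 i).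
    by apply/funext => v; rewrite row_mxEl.
  exact: continuous_coord.
have -> : (fun v : E => homog v 0 (rshift N i)) = (fun=> (1%:M : 'M_1) 0 i).
  by apply/funext => v; rewrite row_mxEr.
exact: cst_continuous.
Qed.

Local Definition homog_mx s : 'M[R]_(size s, N + 1) :=
  \matrix_(i < size s) homog (s`_i).

Lemma homog_mx_free (s : {fset E}) :
  affinely_independent s -> row_free (homog_mx s).
Proof.
move=> ind; apply: inj_row_free => a a0.
pose w (v : E) : R :=
  if insub (index v s) is Some i then a ord0 (i : 'I_(size s)) else 0.
have wE (i : 'I_(size s)) : w s`_i = a ord0 i.
  rewrite /w index_uniq ?fset_uniq//.
  by rewrite (insubT (fun k => k < size s)%N (ltn_ord i)) /=; congr (a _ _); apply: val_inj.
have sumE (F : E -> R -> 'rV[R]_(N + 1)) :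
    \sum_(v <- s) F v (w v) = \sum_(i < size s) F s`_i (a ord0 i).
  by rewrite (big_nth 0) big_mkord; apply: eq_bigr => i _; rewrite wE.
have h0 : \sum_(v <- s) w v *: homog v = 0.
  rewrite (sumE (fun v r => r *: homog v)) -[RHS]a0.
  by apply/rowP => j; rewrite summxE mxE; apply: eq_bigr => i _; rewrite !mxE.
have {h0} : row_mx (\sum_(v <- s) w v *: v) ((\sum_(v <- s) w v)%:M : 'M_1) =
    row_mx 0 0.
  rewrite row_mx0 -h0; elim: (s : seq E) => [|v t IHt].
    by rewrite !big_nil raddf0 row_mx0.
  by rewrite !big_cons -IHt scale_row_mx add_row_mx scale_scalar_mx mulr1 raddfD.
move=> /eq_row_mx [wv0 /matrixP/(_ 0 0)]; rewrite !mxE mulr1n => w0.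
apply/rowP => i; rewrite mxE -wE; apply: ind => //.
exact: mem_nth.
Qed.

(** A right inverse of the matrix of homogeneous coordinates has the barycentric
    coordinates as its columns. *)
Lemma affine_coordinate (s : {fset E}) v : affinely_independent s -> v \in s ->
  exists c, forall x, x \in s -> aff c x = (x == v)%:R.
Proof.
move=> /homog_mx_free/row_freeP[B BE] vs.
have iv : (index v s < size s)%N by rewrite index_mem.
exists (col (Ordinal iv) B) => x xs.
have ix : (index x s < size s)%N by rewrite index_mem.
have /matrixP/(_ (Ordinal ix) (Ordinal iv)) := BE; rewrite !mxE /aff mxE /=.
have -> : (Ordinal ix == Ordinal iv) = (x == v).
  apply/eqP/eqP => [[/(congr1 (nth 0 s))]|xv]; first by rewrite !nth_index.
  by apply: val_inj; rewrite /= xv.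
move=> <-; apply: eq_bigr => k _.
by rewrite !mxE nth_index// /homog.
Qed.

(** For reasons of rank, the linear span of the points does not contain that of
    the vertices of the simplex. *)
Lemma separating_affine (s : {fset E}) t :
  affinely_independent s -> (size t < #|` s|)%N ->
  exists c, (forall x, x \in t -> aff c x = 0) /\
    exists2 x, x \in s & aff c x != 0.
Proof.
move=> /homog_mx_free free_s ts.
have : ~~ (homog_mx s <= homog_mx t)%MS.
  apply/negP => /mxrankS; rewrite leqNgt => /negP; apply.
  move: free_s => /eqP ->; apply: leq_ltn_trans (rank_leq_row _) ts.
rewrite submxE => /matrix0Pn[i [k nz]].
exists (col k (cokermx (homog_mx t))); split.
  move=> x xt; have ix : (index x t < size t)%N by rewrite index_mem.
  have /matrixP/(_ (Ordinal ix) k) := mulmx_coker (homog_mx t).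
  rewrite !mxE => <-; rewrite /aff mxE; apply: eq_bigr => l _.
  by rewrite !mxE nth_index.
exists s`_i; first exact: mem_nth.
apply: contra nz => /eqP h; rewrite -h; apply/eqP; rewrite /aff !mxE.
by apply: eq_bigr => l _; rewrite !mxE.
Qed.

Lemma sum_fset_incl (W : zmodType) (s t : {fset E}) (F : E -> W) :
  (s `<=` t)%fset -> (forall x, x \in t -> x \notin s -> F x = 0) ->
  \sum_(x <- s) F x = \sum_(x <- t) F x.
Proof. exact: big_fset_incl. Qed.

Lemma hullS (s t : {fset E}) : (s `<=` t)%fset -> hull s `<=` hull t.
Proof.
move=> st p [w [w0 w1 ->]]; exists (fun v => if v \in s then w v else 0); split.
- by move=> v _; case: ifP => // /w0.
- rewrite -w1; apply/esym.
  rewrite -(sum_fset_incl st); last by move=> v _ /negPf ->.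
  by apply: eq_big_seq => v ->.
- rewrite -(sum_fset_incl st); last by move=> v _ /negPf ->; rewrite scale0r.
  by apply: eq_big_seq => v ->.
Qed.

Lemma hull_segment (s : {fset E}) p q (r : R) : hull s p -> hull s q ->
  0 <= r <= 1 -> hull s ((1 - r) *: p + r *: q).
Proof.
move=> [w [w0 w1 ->]] [w' [w'0 w'1 ->]] r01.
exists (fun v => (1 - r) * w v + r * w' v); split.
- by move=> v vs; have := w0 v vs; have := w'0 v vs; nra.
- by rewrite big_split /= -!mulr_sumr w1 w'1; ring.
- rewrite !scaler_sumr -big_split /=; apply: eq_bigr => v _.
  by rewrite !scalerA -scalerDl.
Qed.

(** Give the vertices weights proportional to the powers of a number [a]: the
    value of an affine function becomes, up to a factor, that of a nonzero
    polynomial at [a], and there are infinitely many choices for [a]. *)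
Lemma general_position (s : {fset E}) (cs : seq 'cV[R]_(N + 1)) :
  s != fset0 ->
  (forall c, c \in cs -> exists2 x, x \in s & aff c x != 0) ->
  exists2 q, hull s q & forall c, c \in cs -> aff c q != 0.
Proof.
move=> s0 hcs.
pose P c : {poly R} := \poly_(i < size s) aff c s`_i.
have P0 c : c \in cs -> P c != 0.
  move=> /hcs [x xs]; apply: contra => /eqP/polyP/(_ (index x s)).
  by rewrite coef0 coef_poly index_mem xs nth_index// => ->.
pose Q := \prod_(c <- cs) P c.
have Q0 : Q != 0 by rewrite /Q prodf_seq_neq0; apply/allP => c /P0.
have [m mQ] : exists m : nat, ~~ root Q m.+1%:R.
  apply: contrapT => nex.
  pose rs : seq R := [seq i.+1%:R | i <- iota 0 (size Q)].
  have rsQ : all (root Q) rs.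
    apply/allP => r /mapP[i _ ->]; apply: contrapT => /negP nr.
    by apply: nex; exists i.
  have urs : uniq rs.
    rewrite map_inj_uniq ?iota_uniq// => i j /eqP.
    by rewrite eqr_nat => /eqP[].
  by have := max_poly_roots Q0 rsQ urs; rewrite size_map size_iota ltnn.
pose a : R := m.+1%:R.
pose w (v : E) : R := a ^+ index v s.
have w_gt0 v : 0 < w v by rewrite exprn_gt0// ltr0n.
pose W := \sum_(v <- s) w v.
have W_gt0 : 0 < W.
  have [v vs] := fset0Pn _ s0.
  rewrite /W (big_fsetD1 v)//= ltr_wpDr//.
  by apply: sumr_ge0 => x _; exact: ltW.
have w1 : \sum_(v <- s) w v / W = 1.
  by rewrite -mulr_suml divff//; exact: lt0r_neq0.
exists (\sum_(v <- s) (w v / W) *: v).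
  by exists (fun v => w v / W); split=> // v _; rewrite divr_ge0// ltW.
move=> c cc; rewrite (aff_sum c w1).
have -> : \sum_(v <- s) w v / W * aff c v = (P c).[a] / W.
  rewrite horner_poly mulr_suml (big_nth 0) big_mkord; apply: eq_bigr => i _.
  by rewrite /w index_uniq ?fset_uniq//; ring.
apply: mulf_neq0; last by rewrite invr_eq0 lt0r_neq0.
apply: contra mQ => Pa; rewrite /root /Q horner_prod.
by rewrite prodf_seq_eq0; apply/hasP; exists c.
Qed.

End Affine.

(** * Points of a simplicial complex *)

Section Simplices.
Variables (R : realType) (N : nat).
Notation E := 'rV[R]_N.
Implicit Types (s t : {fset E}) (p q u v : E) (w : E -> R).

(** The coordinates are extended by zero outside of [s], which makes those in a
    face of [s] equal to those in [s]. *)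
Definition barycentric s p w : Prop :=
  [/\ forall v, 0 <= w v, forall v, v \notin s -> w v = 0,
      \sum_(v <- s) w v = 1 & p = \sum_(v <- s) w v *: v].

Lemma hull_barycentric s p : hull s p <-> exists w, barycentric s p w.
Proof.
split=> [[w [w0 w1 pE]]|[w [w0 _ w1 pE]]]; last by exists w; split.
exists (fun v => if v \in s then w v else 0); split.
- by move=> v; case: ifP => // /w0.
- by move=> v /negPf ->.
- by rewrite -w1; apply: eq_big_seq => v ->.
- by rewrite pE; apply: eq_big_seq => v ->.
Qed.

Lemma barycentricS s t p w : (s `<=` t)%fset ->
  barycentric s p w -> barycentric t p w.
Proof.
move=> st [w0 ws w1 pE]; split=> //.
- by move=> v vt; apply: ws; apply: contra vt; exact/fsubsetP.
- by rewrite -(sum_fset_incl st)// => v _ /ws.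
- by rewrite -(sum_fset_incl st)// => v _ /ws ->; rewrite scale0r.
Qed.

Lemma barycentric_unique s p w w' : affinely_independent s ->
  barycentric s p w -> barycentric s p w' -> w = w'.
Proof.
move=> ind [_ ws w1 wp] [_ ws' w'1 wp']; apply/funext => v.
have [vs|vs] := boolP (v \in s); last by rewrite ws// ws'.
apply/eqP; rewrite -subr_eq0; apply/eqP.
apply: (ind (fun v => w v - w' v)) => //; first by rewrite sumrB w1 w'1 subrr.
under eq_bigr do rewrite scalerBl.
by rewrite sumrB -wp -wp' subrr.
Qed.

Lemma barycentric_aff s p w c : barycentric s p w ->
  aff c p = \sum_(v <- s) w v * aff c v.
Proof. by move=> [_ _ w1 ->]; rewrite aff_sum. Qed.

Lemma barycentric_seg s p q w w' (r : R) : 0 <= r <= 1 ->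
  barycentric s p w -> barycentric s q w' ->
  barycentric s ((1 - r) *: p + r *: q) (fun v => (1 - r) * w v + r * w' v).
Proof.
move=> r01 [w0 ws w1 ->] [w'0 w's w'1 ->]; split.
- by move=> v; have := w0 v; have := w'0 v; nra.
- by move=> v vs; rewrite ws// w's//; ring.
- by rewrite big_split /= -!mulr_sumr w1 w'1; ring.
- rewrite !scaler_sumr -big_split /=; apply: eq_bigr => v _.
  by rewrite !scalerA -scalerDl.
Qed.

Lemma compact_hull s : compact (hull s).
Proof.
pose F (a : 'rV[R]_(size s)) : E := \sum_i a ord0 i *: s`_i.
pose D := cube R (size s) `&` [set a | \sum_i a ord0 i = 1].
have cD : compact D.
  apply: compact_closedI; first exact: compact_cube.
  apply: (@preimage_closed _ _ (fun a : 'rV[R]_(size s) => \sum_i a ord0 i) [set 1]).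
    move=> a _; apply: continuous_sumr => i; exact: continuous_coord.
  exact: closed_eq.
have cF : continuous F.
  apply: continuous_rV => j.
  have -> : (fun a => F a ord0 j) = (fun a => \sum_i a ord0 i * (s`_i) ord0 j).
    by apply/funext => a; rewrite summxE; apply: eq_bigr => i _; rewrite mxE.
  apply: continuous_sumr => i.
  apply: (continuous_mulr (g := fun=> _)); first exact: continuous_coord.
  exact: cst_continuous.
have -> : hull s = F @` D; last first.
  by apply: continuous_compact => //; exact: continuous_subspaceT.
apply/seteqP; split=> p.
  move=> /hull_barycentric[w [w0 ws w1 ->]].
  exists (\row_i w s`_i); last first.
    by rewrite /F (big_nth 0) big_mkord; apply: eq_bigr => i _; rewrite mxE.
  have w1' : \sum_(i < size s) w s`_i = 1 by rewrite -w1 (big_nth 0) big_mkord.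
  split=> [i|/=]; last by rewrite -[RHS]w1'; apply: eq_bigr => i _; rewrite mxE.
  rewrite mxE w0 -w1' (bigD1 i)//= lerDl; apply: sumr_ge0 => j _; exact: w0.
move=> [a [Ca /= a1] <-].
pose w v : R := if insub (index v s) is Some i then a ord0 (i : 'I_(size s)) else 0.
have wE (i : 'I_(size s)) : w s`_i = a ord0 i.
  rewrite /w index_uniq ?fset_uniq//.
  by rewrite (insubT (fun k => k < size s)%N (ltn_ord i)) /=; congr (a _ _); apply: val_inj.
exists w; split.
- by move=> v vs; rewrite /w; case: insub => // i; have /andP[] := Ca i.
- by rewrite -a1 (big_nth 0) big_mkord; apply: eq_bigr => i _; rewrite wE.
- by rewrite (big_nth 0) big_mkord; apply: eq_bigr => i _; rewrite wE.
Qed.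

Lemma closed_hull s : closed (hull s).
Proof.
apply: compact_closed; last exact: compact_hull.
exact: norm_hausdorff.
Qed.

Lemma near_finite (J : choiceType) (A : set J) (Q : J -> E -> Prop) u :
  finite_set A -> (forall a, A a -> \forall p \near u, Q a p) ->
  \forall p \near u, forall a, A a -> Q a p.
Proof.
move=> /finite_seqP[r ->]; elim: r => [|a r IHr] h.
  by apply: filterE => p a.
have h1 : \forall p \near u, Q a p by apply: h; rewrite /= mem_head.
have h2 : \forall p \near u, forall b, b \in r -> Q b p.
  by apply: IHr => b br; apply: h; rewrite /= inE br orbT.
apply: filterS2 h1 h2 => p Qa Qr b /=; rewrite inE => /orP[/eqP->//|br].
exact: Qr.
Qed.

End Simplices.

Section Complexes.
Variables (R : realType) (N : nat).
Notation E := 'rV[R]_N.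
Variables (T : set {fset E}) (X : set E).
Hypothesis hT : triangulates T X.
Implicit Types (s t : {fset E}) (p q u v : E).

Let complexT : simplicial_complex T. Proof. by case: hT. Qed.

Lemma complex_independent s : T s -> affinely_independent s.
Proof. exact: (sc_independent complexT). Qed.

Lemma hull_sub s : T s -> hull s `<=` X.
Proof. by move=> Ts p sp; case: hT => _ _ <-; exists s. Qed.

(** Two simplices that contain the point share a face that contains it, so all
    simplices give the same coordinates. *)
Definition coordinates p : E -> R :=
  xget (fun=> 0) [set w | exists2 s, T s & barycentric s p w].

Lemma coordinatesP s p : T s -> hull s p -> barycentric s p (coordinates p).
Proof.
move=> Ts /hull_barycentric[w hw].
have := @xgetPex _ (fun=> 0) [set w | exists2 s, T s & barycentric s p w].
case; first by exists w; exists s.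
rewrite -/(coordinates p) => t Tt ht.
have : (hull s `&` hull t) p.
  by split; apply/hull_barycentric; [exists w|exists (coordinates p)].
rewrite (sc_inter complexT Ts Tt) => /hull_barycentric[w' hw'].
have h1 := barycentricS (fsubsetIl s t) hw'.
have h2 := barycentricS (fsubsetIr s t) hw'.
by rewrite (barycentric_unique (complex_independent Tt) ht h2).
Qed.

Lemma coordinates_eq s p w : T s -> barycentric s p w -> coordinates p = w.
Proof.
move=> Ts hw; apply: (barycentric_unique (complex_independent Ts) _ hw).
by apply: coordinatesP => //; apply/hull_barycentric; exists w.
Qed.

Lemma coordinates_ge0 p v : X p -> 0 <= coordinates p v.
Proof.
case: hT => _ _ <- [s Ts sp]; have [h _ _ _] := coordinatesP Ts sp; exact: h.
Qed.

Lemma coordinates_seg s p q v (r : R) : T s -> hull s p -> hull s q ->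
  0 <= r <= 1 -> coordinates ((1 - r) *: p + r *: q) v =
    (1 - r) * coordinates p v + r * coordinates q v.
Proof.
move=> Ts sp sq r01.
by rewrite (coordinates_eq Ts
  (barycentric_seg r01 (coordinatesP Ts sp) (coordinatesP Ts sq))).
Qed.

(** The simplex whose interior contains the point. *)
Definition supp p : {fset E} :=
  xget fset0 [set s | T s /\ hull s p /\ forall v, v \in s -> 0 < coordinates p v].

Lemma suppP p : X p -> [/\ T (supp p), hull (supp p) p &
  forall v, (v \in supp p) = (0 < coordinates p v)].
Proof.
move=> Xp; have Xp' := Xp; case: hT => _ _ XE; rewrite -XE in Xp'.
case: Xp' => s Ts sp; have hs := coordinatesP Ts sp; have [w0 ws w1 wp] := hs.
set t := [fset v in s | 0 < coordinates p v]%fset.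
have tE v : (v \in t) = (0 < coordinates p v).
  rewrite !inE /=; have [vs|vs] := boolP (v \in s) => //=.
  by rewrite ws// ltxx.
have ts : (t `<=` s)%fset by apply/fsubsetP => v; rewrite !inE => /andP[].
have out v : v \notin t -> coordinates p v = 0.
  by rewrite tE -leNgt => h; apply/eqP; rewrite eq_le h w0.
have ht : barycentric t p (coordinates p).
  split=> //; first by rewrite (sum_fset_incl ts)// => v _ /out.
  by rewrite (sum_fset_incl ts)// => v _ /out ->; rewrite scale0r.
have t0 : t != fset0.
  apply/eqP => t0; have [_ _] := ht; rewrite t0 big_nil => /eqP.
  by rewrite eq_sym oner_eq0.
have [Ts' [sp' pos']] : T (supp p) /\ hull (supp p) p /\
    forall v, v \in supp p -> 0 < coordinates p v.
  apply: (@xgetPex _ fset0 [set s | T s /\ hull s p /\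
    forall v, v \in s -> 0 < coordinates p v]).
  exists t; split; first exact: (sc_face complexT Ts ts t0).
  by split; [apply/hull_barycentric; exists (coordinates p)|move=> v; rewrite tE].
split=> // v; apply/idP/idP => [/pos'//|].
by apply: contraTT => vs; have [_ h _ _] := coordinatesP Ts' sp'; rewrite h ?ltxx.
Qed.

Lemma mem_supp p v : X p -> (v \in supp p) = (0 < coordinates p v).
Proof. by case/suppP. Qed.

Lemma supp_simplex p : X p -> T (supp p).
Proof. by case/suppP. Qed.

Lemma hull_supp p : X p -> hull (supp p) p.
Proof. by case/suppP. Qed.

Lemma coordinates_out p v : X p -> v \notin supp p -> coordinates p v = 0.
Proof.
move=> Xp; rewrite mem_supp// -leNgt => h.
by apply/eqP; rewrite eq_le h coordinates_ge0.
Qed.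

Lemma supp_neq0 p : X p -> supp p != fset0.
Proof. by move=> /supp_simplex; exact: (sc_nonempty complexT). Qed.

Lemma hull_suppP s p : T s -> X p -> hull s p <-> (supp p `<=` s)%fset.
Proof.
move=> Ts Xp; split=> [sp|/hullS]; last by apply; exact: hull_supp.
apply/fsubsetP => v; rewrite mem_supp//; apply: contraTT => vs.
by have [_ h _ _] := coordinatesP Ts sp; rewrite h ?ltxx.
Qed.

(** Near [u] there are finitely many simplices, and those that do not contain [u]
    can be avoided since they are closed. *)
Lemma near_simplices (Q : E -> Prop) u : X u ->
  (forall s, T s -> hull s u -> \forall p \near u, hull s p -> Q p) ->
  \forall p \near u, X p -> Q p.
Proof.
move=> Xu hQ; case: hT => _ lf XE; have := Xu; rewrite -XE => /lf[B nB finB].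
have : \forall p \near u, forall s, (T s /\ hull s `&` B !=set0) -> hull s p -> Q p.
  apply: (@near_finite R N _ [set s | T s /\ hull s `&` B !=set0]
    (fun s p => hull s p -> Q p)) => // s [Ts _].
  have [su|nsu] := pselect (hull s u); first exact: hQ.
  have : \forall p \near u, (~` hull s) p.
    apply: open_nbhs_nbhs; split=> //.
    by apply: closed_openC; exact: closed_hull.
  by apply: filterS => p np /np.
move: nB; apply: filterS2 => p Bp hp Xp.
have [s Ts sp] := Xp; apply: (hp s) => //.
by split=> //; exists p.
Qed.

Lemma coordinate_function s v : T s -> exists2 f : E -> R, continuous f &
  forall p, hull s p -> coordinates p v = f p.
Proof.
move=> Ts; have [vs|vs] := boolP (v \in s); last first.
  exists (fun=> 0); first exact: cst_continuous.
  by move=> p sp; have [_ h _ _] := coordinatesP Ts sp; exact: h.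
have [c cP] := affine_coordinate (complex_independent Ts) vs.
exists (aff c); first exact: continuous_aff.
move=> p sp; rewrite (barycentric_aff c (coordinatesP Ts sp)).
rewrite (big_fsetD1 v)//= cP// eqxx mulr1 big_seq big1 ?addr0// => x.
by rewrite !inE => /andP[/negPf xv xs]; rewrite cP// xv mulr0.
Qed.

(** A positive coordinate stays positive: the supports can only grow. *)
Lemma near_supp s u : T s -> hull s u ->
  \forall p \near u, hull s p -> (supp u `<=` supp p)%fset.
Proof.
move=> Ts su; have Xu := hull_sub Ts su.
have : \forall p \near u, forall v, v \in supp u -> hull s p -> 0 < coordinates p v.
  apply: (@near_finite R N _ [set v | v \in supp u]
    (fun v p => hull s p -> 0 < coordinates p v)); first exact: finite_fset.
  move=> v vu; have [f cf fE] := coordinate_function v Ts.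
  have fu : 0 < f u by rewrite -fE// -mem_supp.
  have : \forall p \near u, 0 < f p by exact: cvgr_gt (cf u) _ fu.
  by apply: filterS => p fp sp; rewrite fE.
apply: filterS => p hp sp; apply/fsubsetP => v vu.
by rewrite mem_supp; [exact: hp|exact: hull_sub sp].
Qed.

Lemma finite_meeting (C : set E) : compact C -> C `<=` X ->
  finite_set [set s | T s /\ hull s `&` C !=set0].
Proof.
move=> cC CX; case: hT => _ lf XE.
have ex p : exists B : set E, C p -> nbhs p B /\
    finite_set [set s | T s /\ hull s `&` B !=set0].
  case: (pselect (C p)) => [Cp|nCp]; last by exists setT.
  have /lf[B nB fB] : carrier T p by rewrite XE; exact: CX.
  by exists B.
have [B BP] := choice ex.
move: cC; rewrite compact_cover => /(_ _ C (fun p => interior (B p))) [||D DC CD].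
- by move=> p _; exact: open_interior.
- by move=> p Cp; exists p => //; exact: (BP p Cp).1.
apply: (@sub_finite_set _ _ (\bigcup_(p in [set` D])
    [set s | T s /\ hull s `&` B p !=set0])).
  move=> s [Ts [q [sq /CD [p Dp /interior_subset Bq]]]].
  by exists p => //; split=> //; exists q.
apply: bigcup_finite => [|p Dp]; first exact: finite_fset.
by have /set_mem/BP[] := DC p Dp.
Qed.

End Complexes.

(** * Connectedness and dimension by general position *)

Section GeneralPosition.
Variables (R : realType) (N : nat).
Notation E := 'rV[R]_N.
Implicit Types (s t : {fset E}) (p q u v : E).

Lemma avoiding_point s (ts : seq (seq E)) : affinely_independent s ->
  s != fset0 -> (forall t : seq E, t \in ts -> (size t < #|` s|)%N) ->
  exists2 q, hull s q & forall t : seq E, t \in ts ->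
    exists2 c, (forall x, x \in t -> aff c x = 0) & aff c q != 0.
Proof.
move=> ind s0 hts.
have ex (t : seq E) : exists c : 'cV[R]_(N + 1), (size t < #|` s|)%N ->
    (forall x, x \in t -> aff c x = 0) /\ exists2 x, x \in s & aff c x != 0.
  have [lt_ts|] := boolP (size t < #|` s|)%N; last by exists 0.
  by have [c hc] := separating_affine ind lt_ts; exists c.
have [f fP] := choice ex.
have [c /mapP[t /hts/fP[_ ne] ->]//|q sq hq] := general_position (cs := map f ts) s0.
exists q => // t tts; exists (f t); first exact: (fP t (hts t tts)).1.
by apply: hq; exact: map_f.
Qed.

Lemma aff_hull0 s p (c : 'cV[R]_(N + 1)) : hull s p ->
  (forall x, x \in s -> aff c x = 0) -> aff c p = 0.
Proof.
move=> /hull_barycentric[w hw] c0; rewrite (barycentric_aff c hw) big_seq big1//.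
by move=> v /c0 ->; rewrite mulr0.
Qed.

Section Complement.
Variables (n : nat) (T L : set {fset E}) (X : set E).
Hypothesis hT : triangulates T X.
Hypothesis LT : L `<=` T.
Hypothesis L_small : forall s, L s -> (#|` s| < n)%N.
Let U := X `\` carrier L.

Lemma L_locally_finite s : hull s `<=` X -> exists r : seq {fset E},
  (forall t, t \in r -> L t) /\
  forall p, hull s p -> (forall t, t \in r -> ~ hull t p) -> U p.
Proof.
move=> sX; have /finite_seqP[r rE] := finite_meeting hT (@compact_hull R N s) sX.
exists [seq t <- r | `[< L t >]]; split.
  by move=> t; rewrite mem_filter => /andP[/asboolP].
move=> p sp np; split; first exact: sX.
move=> [t Lt tp]; apply: (np t) => //; rewrite mem_filter; apply/andP; split.
  exact/asboolP.
have : [set` r] t by rewrite -rE; split; [exact: LT|exists p].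
by [].
Qed.

Lemma complement_meets s : affinely_independent s -> s != fset0 ->
  hull s `<=` X -> (n <= #|` s|)%N -> exists2 q, hull s q & U q.
Proof.
move=> ind s0 sX ns; have [r [rL rU]] := L_locally_finite sX.
have [|q sq hq] := avoiding_point (ts := [seq enum_fset t | t <- r]) ind s0.
  by move=> t /mapP[t' /rL/L_small lt_n ->]; exact: leq_trans lt_n ns.
exists q => //; apply: rU => // t tr tq.
have [|c c0] := hq (enum_fset t); first exact: map_f.
by rewrite (aff_hull0 tq c0) eqxx.
Qed.

(** Two points of an n-simplex are joined through a third one, in general
    position with respect to the spans of one of them and a removed simplex. *)
Lemma complement_simplex_path s u u' : affinely_independent s ->
  hull s `<=` X -> #|` s| = n.+1 -> hull s u -> hull s u' -> U u -> U u' ->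
  exists p : R -> E, is_path U u u' p.
Proof.
move=> ind sX sn su su' Uu Uu'; have [r [rL rU]] := L_locally_finite sX.
have s0 : s != fset0 by rewrite -cardfs_gt0 sn.
have [|q sq hq] := avoiding_point (ts := [seq u :: enum_fset t | t <- r] ++
    [seq u' :: enum_fset t | t <- r]) ind s0.
  by move=> t; rewrite mem_cat sn => /orP[] /mapP[t' /rL/L_small lt_n ->].
have to_q w : hull s w -> U w ->
    (forall t, t \in r -> exists2 c, (forall x, x \in w :: enum_fset t -> aff c x = 0)
      & aff c q != 0) -> is_path U w q (seg w q).
  move=> sw Uw hw; apply: is_path_seg => a /in_segment a01; apply: rU.
    exact: hull_segment.
  move=> t tr tp; have [c c0 cq] := hw t tr.
  have cp : aff c (seg w q a) = 0.
    by apply: aff_hull0 tp _ => x xt; apply: c0; rewrite inE; apply/orP; right.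
  rewrite aff_seg c0 ?mem_head// mulr0 add0r in cp.
  have a0 : a = 0 by apply/eqP; move/eqP: cp; rewrite mulf_eq0 (negPf cq) orbF.
  by rewrite a0 seg0 in tp; case: Uw => _; apply; exists t => //; exact: rL.
exists (path_concat (seg u q) (path_inv (seg u' q))).
apply: (is_path_concat (y := q)).
  apply: to_q => // t tr; apply: hq; rewrite mem_cat; apply/orP; left.
  exact: map_f.
apply: is_path_inv; apply: to_q => // t tr; apply: hq.
rewrite mem_cat; apply/orP; right; exact: map_f.
Qed.

End Complement.

(** An n-simplex minus simplices of codimension at least 2 remains connected, and
    so remains the passage through a facet, which is not covered by what has been
    removed.  The pseudomanifold may be triangulated independently of the removed
    set: only dimensions matter. *)
Lemma complement_connected (n : nat) (K T L : set {fset E}) (X : set E) :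
  irreducible_pseudomanifold n X K -> triangulates T X -> L `<=` T ->
  (forall s, L s -> (#|` s| < n)%N) -> path_connected R (X `\` carrier L).
Proof.
move=> pm hT LT L_small; set U := X `\` carrier L.
have hK := pm_triangulates pm.
have indK := complex_independent hK; have subK := hull_sub hK.
pose joined s s' := forall u u', hull s u -> hull s' u' -> U u -> U u' ->
  exists p : R -> E, is_path U u u' p.
have in_simplex s : is_simplex K n s -> joined s s.
  move=> [Ks sn] u u' su su' Uu Uu'.
  exact: (complement_simplex_path hT LT L_small (indK _ Ks) (subK _ Ks) sn su su').
have meets s : K s -> (n <= #|` s|)%N -> exists2 q, hull s q & U q.
  move=> Ks; apply: (complement_meets hT LT L_small) => //.
  - exact: indK.
  - by have [[h _ _ _] _ _] := hK; exact: h.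
  - exact: subK.
have trans s s' s'' q : hull s' q -> U q -> joined s s' -> joined s' s'' -> joined s s''.
  move=> s'q Uq j1 j2 u u'' su su'' Uu Uu''.
  have [p hp] := j1 u q su s'q Uu Uq; have [p' hp'] := j2 q u'' s'q su'' Uq Uu''.
  by exists (path_concat p p'); exact: is_path_concat hp hp'.
have chain s s' : clos_refl_trans _ (share_facet K n) s s' ->
    is_simplex K n s -> is_simplex K n s' /\ joined s s'.
  elim=> {s s'} [s s' [hs hs' [f [[Kf fn] fs fs']]]|s|s s' s'' _ IH1 _ IH2] ks.
  - split=> //; have [q fq Uq] : exists2 q, hull f q & U q by apply: meets; rewrite ?fn.
    move=> u u' su su' Uu Uu'.
    have [p hp] := in_simplex s hs u q su (hullS fs fq) Uu Uq.
    have [p' hp'] := in_simplex s' hs' q u' (hullS fs' fq) su' Uq Uu'.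
    by exists (path_concat p p'); exact: is_path_concat hp hp'.
  - by split=> //; exact: in_simplex.
  - have [ks' j1] := IH1 ks; have [ks'' j2] := IH2 ks'; split=> //.
    have [q s'q Uq] : exists2 q, hull s' q & U q.
      by case: ks' => Ks' s'n; apply: meets => //; rewrite s'n.
    exact: trans s'q Uq j1 j2.
move=> u u' Uu Uu'.
have top p : U p -> exists2 s, is_simplex K n s & hull s p.
  move=> [Xp _]; have [_ _ KX] := hK.
  have [s Ks sp] : carrier K p by rewrite KX.
  by have [t kt st] := pm_pure pm Ks; exists t => //; exact: (hullS st).
have [s ks su] := top u Uu; have [s' ks' su'] := top u' Uu'.
have [_ j] := chain s s' (pm_connected pm ks ks') ks.
exact: j.
Qed.

(** A simplex of higher dimension would not be covered by the finitely many
    simplices of [K] that it meets. *)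
Lemma triangulation_dimension (n : nat) (K T : set {fset E}) (X : set E) :
  irreducible_pseudomanifold n X K -> triangulates T X ->
  forall s, T s -> (#|` s| <= n.+1)%N.
Proof.
move=> pm hT s Ts; rewrite leqNgt; apply/negP => ns.
have hK := pm_triangulates pm; have sX := hull_sub hT Ts.
have /finite_seqP[r rE] := finite_meeting hK (@compact_hull R N s) sX.
have rK t : t \in r -> K t.
  move=> tr; have : [set` r] t by [].
  by rewrite -rE => -[].
have s0 : s != fset0 by rewrite -cardfs_gt0; exact: leq_trans ns.
have [|q sq hq] := avoiding_point (ts := [seq enum_fset t | t <- r])
    (complex_independent hT Ts) s0.
  move=> t /mapP[t' /rK/(pm_pure pm)[t'' [_ t''n] t't''] ->].
  by apply: leq_ltn_trans ns; rewrite -t''n; exact: fsubset_leq_card.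
have [_ _ KX] := hK; have [t Kt tq] : carrier K q by rewrite KX; exact: sX.
have tr : t \in r.
  have : [set` r] t by rewrite -rE; split=> //; exists q.
  by [].
have [|c c0] := hq (enum_fset t); first exact: map_f.
by rewrite (aff_hull0 tq c0) eqxx.
Qed.

End GeneralPosition.

(** * The retraction onto the dual graph *)

Section DualGraph.
Variables (R : realType) (N n : nat).
Notation E := 'rV[R]_N.
Variables (T : set {fset E}) (X : set E) (x : E).
Hypothesis hT : triangulates T X.
Hypothesis dimT : forall s, T s -> (#|` s| <= n.+1)%N.
Hypothesis Xx : X x.
Implicit Types (s t : {fset E}) (p q u v w : E).
Notation coords := (coordinates T).
Notation supp := (supp T).

(** All the simplices of codimension at least 2 are removed, except for those in
    the star of [x]. *)
Definition removed : set {fset E} := [set s | [/\ T s, (#|` s| < n)%N & ~ hull s x]].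

Let U := X `\` carrier removed.
Let s0 := supp x.

Lemma hull_x s : T s -> hull s x <-> (s0 `<=` s)%fset.
Proof. by move=> Ts; exact: (hull_suppP hT Ts Xx). Qed.

Lemma U_supp p : U p <-> X p /\ ((s0 `<=` supp p)%fset \/ (n <= #|` supp p|)%N).
Proof.
split=> [[Xp np]|[Xp h]].
  split=> //; have Tp := supp_simplex hT Xp.
  case: (leqP n #|` supp p|) => [|lt_pn]; first by right.
  left; apply/(hull_x Tp); apply: contrapT => nx; apply: np.
  by exists (supp p) => //; exact: (hull_supp hT).
split=> // -[s [Ts sn nsx] sp].
have sup : (supp p `<=` s)%fset by apply/(hull_suppP hT Ts Xp).
case: h => [h|h].
  by apply: nsx; apply/(hull_x Ts); exact: fsubset_trans sup.
by move: sn; rewrite ltnNge (leq_trans h)// fsubset_leq_card.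
Qed.

Lemma U_X p : U p -> X p. Proof. by case. Qed.

(** The vertices of the dual graph are simplices: [s0], placed at [x], stands for
    the whole open star of [x], and away from it come the n-simplices and their
    facets, placed at their barycenters.  The weights of the vertices of the
    simplex at this place are positive in all cases. *)
Definition room t : {fset E} := if (s0 `<=` t)%fset then s0 else t.

Definition weight t : E -> R :=
  if t == s0 then coords x else fun w => if w \in t then #|` t|%:R^-1 else 0.

Definition center t : E := \sum_(w <- t) weight t w *: w.

Lemma s0_simplex : T s0. Proof. exact: (supp_simplex hT). Qed.

Lemma room_simplex t : T t -> T (room t).
Proof. by rewrite /room; case: ifP => // _ _; exact: s0_simplex. Qed.

Lemma room_sub t : (room t `<=` t)%fset.
Proof. by rewrite /room; case: ifP. Qed.

Lemma roomK t : room (room t) = room t.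
Proof.
rewrite /room; case: (boolP (s0 `<=` t)%fset) => [_|/negPf ->//].
by rewrite fsubset_refl.
Qed.

Lemma simplex_neq0 t : T t -> t != fset0.
Proof. by case: hT => [[h _ _ _] _ _]; exact: h. Qed.

Lemma simplex_face s t : T s -> (t `<=` s)%fset -> t != fset0 -> T t.
Proof. by case: hT => [[_ _ h _] _ _]; exact: h. Qed.

Lemma weight_gt0 t w : (0 < weight t w) = (w \in t).
Proof.
rewrite /weight; case: eqP => [->|_]; first by rewrite (mem_supp hT).
case: ifP => [wt|_]; last by rewrite ltxx.
by rewrite invr_gt0 ltr0n cardfs_gt0; apply/fset0Pn; exists w.
Qed.

Lemma center_s0 : center s0 = x.
Proof.
rewrite /center /weight eqxx.
by have [_ _ _ <-] := coordinatesP hT s0_simplex (hull_supp hT Xx).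
Qed.

Lemma center_barycentric t : T t -> barycentric t (center t) (weight t).
Proof.
move=> Tt; rewrite /center /weight; case: eqP => [->|_].
  have h := coordinatesP hT s0_simplex (hull_supp hT Xx).
  by have [h1 h2 h3 _] := h; split.
have t0 : (0 : R) < #|` t|%:R by rewrite ltr0n cardfs_gt0 simplex_neq0.
split=> //.
- by move=> v; case: ifP => // _; rewrite invr_ge0 ltW.
- by move=> v /negPf ->.
- transitivity (\sum_(v <- t) (#|` t|%:R^-1 : R)).
    by apply: eq_big_seq => v ->.
  rewrite big_const_seq count_predT iter_addr_0.
  rewrite -[_ *+ _](mulr_natr (#|` t|%:R^-1 : R)).
  exact: mulVf (lt0r_neq0 t0).
Qed.

Lemma center_hull t : T t -> hull t (center t).
Proof. by move=> Tt; apply/hull_barycentric; exists (weight t); exact: center_barycentric. Qed.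

Lemma center_coords t : T t -> coords (center t) = weight t.
Proof. by move=> Tt; apply: (coordinates_eq hT Tt); exact: center_barycentric. Qed.

Lemma center_X t : T t -> X (center t).
Proof. by move=> Tt; exact: (hull_sub hT Tt (center_hull Tt)). Qed.

Lemma center_supp t : T t -> supp (center t) = t.
Proof.
move=> Tt; apply/fsetP => v.
by rewrite (mem_supp hT _ (center_X Tt)) center_coords// weight_gt0.
Qed.

(** In an n-simplex whose room is centered at the point with weights [c], the
    facet opposite to [v] is without [x] exactly when [c v] is positive.  The
    points sent into the interior of the edge from the center to this facet are
    those whose coordinate at [v], divided by [c v], is smaller than all the other
    such quotients: this happens for one [v] at most, and near the facet. *)
Definition toward p v : bool :=
  let t := supp p in let c := weight (room t) in
  [&& (0 < n)%N, #|` t| == n.+1, v \in t, 0 < c v &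
      all (fun w => (w == v) || (coords p v * c w < c v * coords p w)) t].

Lemma towardP p v : reflect
  [/\ (0 < n)%N, #|` supp p| = n.+1, v \in supp p, 0 < weight (room (supp p)) v &
      forall w, w \in supp p -> w != v ->
        coords p v * weight (room (supp p)) w < weight (room (supp p)) v * coords p w]
  (toward p v).
Proof.
apply: (iffP and5P) => -[n0 pn vp cv /=].
  move=> /allP h; split=> //; first exact/eqP.
  by move=> w wp /negPf wv; have := h w wp; rewrite wv.
move=> h; split=> //; first exact/eqP.
by apply/allP => w wp; case: eqVneq => //= wv; exact: h.
Qed.

Lemma toward_unique p v w : toward p v -> toward p w -> v = w.
Proof.
move=> /towardP[_ _ vp _ hv] /towardP[_ _ wp _ hw].
apply/eqP; apply: contraT => vw.
have h1 : coords p v * weight (room (supp p)) w <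
    weight (room (supp p)) v * coords p w by apply: hv => //; rewrite eq_sym.
have h2 := hw v vp vw.
by have := lt_trans h1; rewrite mulrC => /(_ _ h2); rewrite mulrC ltxx.
Qed.

Definition dual_pos p : position {fset E} :=
  let t := supp p in
  if [seq v <- t | toward p v] is v :: _ then Edge (room t) (t `\ v)%fset
  else Vertex (room t).

(** The place on the edge, from the center of the room at 0 to the center of the
    facet at 1, is a quotient that tends to 0 as one of the inequalities of
    [toward] becomes an equality, and is 1 on the facet. *)
Definition excess t v p : R :=
  \prod_(w <- (t `\ v)%fset)
    Num.max 0 (weight (room t) v * coords p w - coords p v * weight (room t) w).

Definition progress t v p : R := excess t v p / (coords p v + excess t v p).

Definition dual_rho p : E :=
  let t := supp p in
  if [seq v <- t | toward p v] is v :: _ then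
    seg (center (room t)) (center (t `\ v)%fset) (progress t v p)
  else center (room t).

Lemma dual_cases p : (exists v, [/\ toward p v,
    dual_pos p = Edge (room (supp p)) (supp p `\ v)%fset &
    dual_rho p = seg (center (room (supp p))) (center (supp p `\ v)%fset)
      (progress (supp p) v p)]) \/
  [/\ forall v, ~~ toward p v, dual_pos p = Vertex (room (supp p)) &
    dual_rho p = center (room (supp p))].
Proof.
rewrite /dual_pos /dual_rho; case e: [seq v <- supp p | toward p v] => [|v r].
  right; split=> // v; apply/negP => pv.
  have [_ _ vp _ _] := towardP _ _ pv.
  suff : v \in [seq v <- supp p | toward p v] by rewrite e.
  by rewrite mem_filter pv.
left; exists v; split=> //.
have : v \in [seq v <- supp p | toward p v] by rewrite e mem_head.
by rewrite mem_filter => /andP[].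
Qed.

Lemma dual_edge p v : toward p v ->
  dual_pos p = Edge (room (supp p)) (supp p `\ v)%fset /\
  dual_rho p = seg (center (room (supp p))) (center (supp p `\ v)%fset)
    (progress (supp p) v p).
Proof.
move=> pv; have [[w [pw -> ->]]|[/(_ v)]] := dual_cases p; last by rewrite pv.
by rewrite (toward_unique pv pw).
Qed.

Lemma dual_vertex p : (forall v, ~~ toward p v) ->
  dual_pos p = Vertex (room (supp p)) /\ dual_rho p = center (room (supp p)).
Proof.
by move=> np; have [[w [pw _ _]]|[_ -> ->]//] := dual_cases p; have := np w; rewrite pw.
Qed.

(** * The edges of the dual graph *)

Lemma facetP t v : T t -> #|` t| = n.+1 -> (0 < n)%N -> v \in t ->
  0 < weight (room t) v ->
  [/\ T (t `\ v)%fset, #|` (t `\ v)%fset| = n, ~~ (s0 `<=` t `\ v)%fset &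
      room (t `\ v)%fset = (t `\ v)%fset].
Proof.
move=> Tt tn n0 vt; rewrite weight_gt0 => vr.
have cF : #|` (t `\ v)%fset| = n.
  by apply/eqP; rewrite -eqSS -tn (cardfsD1 v t) vt.
have nF : ~~ (s0 `<=` t `\ v)%fset.
  apply/negP => h; have st := fsubset_trans h (fsubD1set t v).
  move: vr; rewrite /room st => vs0.
  by have := fsubsetP h v vs0; rewrite !inE eqxx.
split=> //; last by rewrite /room (negPf nF).
apply: simplex_face Tt (fsubD1set t v) _.
by rewrite -cardfs_gt0 cF.
Qed.

Lemma top_supp s p : T s -> hull s p -> #|` supp p| = n.+1 -> supp p = s.
Proof.
move=> Ts sp pn; have Xp := hull_sub hT Ts sp.
by apply/eqP; rewrite eqEfcard pn dimT// andbT; apply/(hull_suppP hT Ts Xp).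
Qed.

Lemma excess_ge0 t v p : 0 <= excess t v p.
Proof. by apply: prodr_ge0 => w _; rewrite le_max lexx. Qed.

Lemma toward_excess p v : X p -> (0 < n)%N -> #|` supp p| = n.+1 ->
  v \in supp p -> 0 < weight (room (supp p)) v ->
  toward p v = (0 < excess (supp p) v p).
Proof.
move=> Xp n0 pn vp cv; apply/towardP/idP => [[_ _ _ _ h]|].
  rewrite /excess big_seq; apply: prodr_gt0 => w; rewrite !inE => /andP[wv wp].
  by rewrite lt_max subr_gt0 h ?orbT.
rewrite lt_def excess_ge0 andbT /excess prodf_seq_neq0 => /allP h.
split=> // w wp wv; have := h w; rewrite !inE wv wp => /(_ isT) /= h'.
rewrite ltNge -subr_le0; apply: contra h' => le0.
by rewrite max_l.
Qed.

Lemma progress_itv p v : X p -> toward p v -> 0 < progress (supp p) v p < 1.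
Proof.
move=> Xp pv; have [n0 pn vp cv _] := towardP _ _ pv.
have := pv; rewrite toward_excess// => ex_gt0.
have v_gt0 : 0 < coords p v by rewrite -(mem_supp hT).
rewrite /progress divr_gt0 ?addr_gt0//= ltr_pdivrMr ?addr_gt0// mul1r.
by rewrite ltrDr.
Qed.

Lemma seg_supp p q (r : R) : X p -> hull (supp p) q -> 0 <= r < 1 ->
  X (seg p q r) /\ supp (seg p q r) = supp p.
Proof.
move=> Xp pq r01; have Tp := supp_simplex hT Xp; have pp := hull_supp hT Xp.
have r01' : 0 <= r <= 1 by lra.
have Xs : X (seg p q r).
  by apply: (hull_sub hT Tp); exact: hull_segment.
split=> //; apply/fsetP => v; rewrite !(mem_supp hT)//.
rewrite /seg (coordinates_seg hT v Tp pp pq r01').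
have p0 := coordinates_ge0 hT v Xp; have q0 := coordinates_ge0 hT v (hull_sub hT Tp pq).
apply/idP/idP => [|p_gt0]; last nra.
apply: contraTT; rewrite -!leNgt => p_le0.
have vp : v \notin supp p by rewrite (mem_supp hT)// -leNgt.
have [_ h _ _] := coordinatesP hT Tp pq; rewrite (h v vp).
have -> : coords p v = 0 by lra.
by rewrite !mulr0 addr0.
Qed.

Lemma seg_U p q (r : R) : U p -> hull (supp p) q -> 0 <= r < 1 -> U (seg p q r).
Proof.
move=> /U_supp[Xp hp] pq r01; have [Xs sE] := seg_supp Xp pq r01.
by apply/U_supp; rewrite sE.
Qed.

Lemma center_room_U p : U p -> U (center (room (supp p))).
Proof.
move=> /U_supp[Xp hp]; have Tr := room_simplex (supp_simplex hT Xp).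
apply/U_supp; split; first exact: center_X.
rewrite center_supp// /room; case: ifPn => ps0; first by left; exact: fsubset_refl.
by right; case: hp => //; rewrite (negPf ps0).
Qed.

(** At the center the inequalities of [toward] are equalities; the facet adds a
    positive coordinate at every vertex but [v], and makes them strict. *)
Lemma edge_point t v (r : R) : T t -> #|` t| = n.+1 -> (0 < n)%N -> v \in t ->
  0 < weight (room t) v -> 0 < r < 1 ->
  let p := seg (center (room t)) (center (t `\ v)%fset) r in
  [/\ U p, supp p = t & toward p v].
Proof.
move=> Tt tn n0 vt cv r01 p.
have [TF Fn nF rF] := facetP Tt tn n0 vt cv.
have Tr := room_simplex Tt; have r01' : 0 <= r <= 1 by lra.
have hr := hullS (room_sub t) (center_hull Tr).
have hF := hullS (fsubD1set t v) (center_hull TF).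
have tp : hull t p by exact: hull_segment.
have Xp := hull_sub hT Tt tp.
have pE w : coords p w = (1 - r) * weight (room t) w + r * weight (t `\ v)%fset w.
  by rewrite /p /seg (coordinates_seg hT w Tt hr hF r01') !center_coords.
have wr0 w : 0 <= weight (room t) w by have [h _ _ _] := center_barycentric Tr; exact: h.
have F_gt0 w : w \in t -> w != v -> 0 < weight (t `\ v)%fset w.
  by move=> wt wv; rewrite weight_gt0 !inE wv.
have Fv : weight (t `\ v)%fset v = 0.
  by have [_ h _ _] := center_barycentric TF; apply: h; rewrite !inE eqxx.
have sp : supp p = t.
  apply/eqP; rewrite eqEfsubset; apply/andP; split; first exact/(hull_suppP hT Tt Xp).
  apply/fsubsetP => w wt; rewrite (mem_supp hT)// pE.
  have [->|wv] := eqVneq w v; first by rewrite Fv; nra.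
  by have := F_gt0 w wt wv; have := wr0 w; nra.
split=> //; first by apply/U_supp; rewrite sp tn; split=> //; right.
apply/towardP; rewrite sp; split=> // w wt wv; rewrite !pE Fv.
have := F_gt0 w wt wv; set a := weight (room t) v; set b := weight (room t) w.
set c := weight (t `\ v)%fset w => c0.
have : 0 < a * (r * c) by rewrite !mulr_gt0//; lra.
by rewrite /a in cv *; nra.
Qed.

(** * Continuity *)

Lemma near_order s u (c : E -> R) : T s -> hull s u ->
  \forall p \near u, hull s p -> forall v w, v \in s -> w \in s ->
    coords u v * c w < c v * coords u w -> coords p v * c w < c v * coords p w.
Proof.
move=> Ts su.
have near1 v w : \forall p \near u, hull s p ->
    coords u v * c w < c v * coords u w -> coords p v * c w < c v * coords p w.
  have [f cf fE] := coordinate_function hT v Ts.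
  have [g cg gE] := coordinate_function hT w Ts.
  have [lt|nlt] := boolP (coords u v * c w < c v * coords u w); last first.
    by apply: filterE.
  have ch : continuous (fun p : E => c v * g p - f p * c w).
    have c1 : continuous (fun p : E => c v * g p).
      by apply: (continuous_mulr (f := fun=> c v)) cg; exact: cst_continuous.
    have c2 : continuous (fun p : E => f p * c w).
      by apply: (continuous_mulr cf (g := fun=> c w)); exact: cst_continuous.
    by move=> p; exact: (cvgB (c1 p) (c2 p)).
  have h0 : 0 < c v * g u - f u * c w by rewrite subr_gt0 -fE// -gE.
  have : \forall p \near u, 0 < c v * g p - f p * c w by exact: cvgr_gt (ch u) _ h0.
  by apply: filterS => p + sp _; rewrite fE// gE// subr_gt0.
have : \forall p \near u, forall v, v \in s -> forall w, w \in s -> hull s p ->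
    coords u v * c w < c v * coords u w -> coords p v * c w < c v * coords p w.
  apply: (@near_finite R N _ [set v | v \in s] (fun v p => forall w, w \in s ->
    hull s p -> coords u v * c w < c v * coords u w ->
    coords p v * c w < c v * coords p w)); first exact: finite_fset.
  move=> v _; apply: (@near_finite R N _ [set w | w \in s] (fun w p =>
    hull s p -> coords u v * c w < c v * coords u w ->
    coords p v * c w < c v * coords p w)); first exact: finite_fset.
  by move=> w _; exact: near1.
by apply: filterS => p hp sp v w vs ws; exact: hp.
Qed.

(** The vertex left out is in [s0], or else [s0] is not a face of [s] at all and
    the weights are those of the barycenter. *)
Lemma opposite_vertex s t : T s -> #|` s| = n.+1 -> (t `<=` s)%fset ->
  #|` t| = n -> ~~ (s0 `<=` t)%fset ->
  exists v, [/\ v \in s, t = (s `\ v)%fset & 0 < weight (room s) v].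
Proof.
move=> Ts sn ts tn nt.
have [v] : exists v, v \in (s `\` t)%fset.
  apply/fset0Pn; rewrite fsetD_eq0; apply/negP => /fsubset_leq_card.
  by rewrite tn sn ltnn.
rewrite inE => /andP[vt vs].
have tE : t = (s `\ v)%fset.
  apply/eqP; rewrite eqEfcard; apply/andP; split.
    apply/fsubsetP => w wt; rewrite !inE (fsubsetP ts w wt) andbT.
    by apply: contra vt => /eqP <-.
  by rewrite tn -ltnS -sn [X in (_ < X)%N](cardfsD1 v) vs.
exists v; split=> //; rewrite weight_gt0 /room; case: ifPn => // ss.
apply: contraT => vs0; move: nt; rewrite tE; apply: contraNT => _.
apply/fsubsetP => w ws0; rewrite !inE (fsubsetP ss w ws0) andbT.
by apply: contra vs0 => /eqP <-.
Qed.

Lemma no_toward p : X p -> (#|` supp p| <= n)%N -> forall v, ~~ toward p v.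
Proof.
move=> Xp pn v; apply/negP => /towardP[_ e _ _ _].
by rewrite e ltnn in pn.
Qed.

(** Near [u] the supports contain that of [u].  They are equal, or else [u] is
    over a vertex; if this vertex is a facet, the point is in an n-simplex and so
    near the facet that the inequalities of [toward] hold. *)
Lemma dual_stratified : stratified (specializes U dual_pos) U dual_pos.
Proof.
move=> u Uu; have Xu := U_X Uu.
suff : \forall p \near u, X p -> U p -> specializes U dual_pos (dual_pos u) (dual_pos p).
  by apply: filterS => p hp Up; apply: hp => //; exact: U_X.
apply: (near_simplices hT Xu) => s Ts su.
have nsub := near_supp hT Ts su; have nord := near_order (weight (room s)) Ts su.
apply: filterS2 nsub nord => p sub ord sp Up.
have Xp := U_X Up; have {}sub := sub sp; have {}ord := ord sp.
have ps : (supp p `<=` s)%fset by apply/(hull_suppP hT Ts Xp).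
have from_vertex : dual_pos u = Vertex (room (supp u)) ->
    room (supp u) = room (supp p) ->
    specializes U dual_pos (dual_pos u) (dual_pos p).
  move=> -> ->; have [[v [_ pE _]]|[_ -> _]] := dual_cases p; last by left.
  right; exists (room (supp p)), (supp p `\ v)%fset; split=> //; last by left.
  by exists p.
have [e|ne] := eqVneq (supp u) (supp p).
  have [[v [uv uE _]]|[_ uE _]] := dual_cases u; last by apply: from_vertex => //; rewrite e.
  have [n0 un vu cv h] := towardP _ _ uv.
  have us : supp u = s by exact: top_supp.
  have pv : toward p v.
    apply/towardP; rewrite -e; split=> // w wu wv; rewrite us.
    by apply: ord; rewrite -?us//; exact: h.
  by left; rewrite uE (dual_edge pv).1 e.
have lt_up : (#|` supp u| < #|` supp p|)%N.
  by apply: fproper_ltn_card; rewrite fproperEneq ne.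
have pn1 : (#|` supp p| <= n.+1)%N by apply: dimT; exact: (supp_simplex hT).
have un : (#|` supp u| <= n)%N by rewrite -ltnS; exact: (leq_trans lt_up pn1).
have uE := (dual_vertex (no_toward Xu un)).1.
have [s0u|s0u] := boolP (s0 `<=` supp u)%fset.
  by apply: from_vertex => //; rewrite /room s0u (fsubset_trans s0u sub).
have {un} un : #|` supp u| = n.
  have /U_supp[_ [h|h]] := Uu; first by rewrite h in s0u.
  by apply/eqP; rewrite eqn_leq un h.
have pn : #|` supp p| = n.+1 by apply/eqP; rewrite eqn_leq pn1 -un.
have pE : supp p = s by exact: top_supp.
have sn : #|` s| = n.+1 by rewrite -pE.
have [v [vs usv cv]] := opposite_vertex Ts sn (fsubset_trans sub ps) un s0u.
have n0 : (0 < n)%N by rewrite -un cardfs_gt0; exact: (supp_neq0 hT).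
have pv : toward p v.
  apply/towardP; rewrite pE; split=> // w ws wv; apply: ord => //.
  rewrite (coordinates_out hT Xu) ?mul0r; last by rewrite usv !inE eqxx.
  by rewrite mulr_gt0// -(mem_supp hT)// usv !inE wv.
rewrite uE (dual_edge pv).1 pE; right; exists (room s), (s `\ v)%fset; split=> //.
  by exists p => //; rewrite (dual_edge pv).1 pE.
by right; rewrite usv; have [_ _ _ ->] := facetP Ts sn n0 vs cv.
Qed.

Lemma excess_eq0 t v w p : w \in t -> w != v ->
  weight (room t) v * coords p w <= coords p v * weight (room t) w ->
  excess t v p = 0.
Proof.
move=> wt wv le0; apply/eqP; rewrite /excess prodf_seq_eq0; apply/hasP.
exists w; first by rewrite !inE wv.
by rewrite /= max_l// subr_le0.
Qed.

(** A formula for [dual_rho] that is valid on all the faces of an n-simplex that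
    have not been removed, so that continuity can be read off from it.  At most
    one of the terms of the sum is nonzero. *)
Definition star_formula s p : E := center (room s) +
  \sum_(v <- s) (if 0 < weight (room s) v then progress s v p else 0) *:
    (center (s `\ v)%fset - center (room s)).

Lemma star_formula_at s v p (a : R) : v \in s -> 0 < weight (room s) v ->
  progress s v p = a ->
  (forall w, w \in s -> w != v -> 0 < weight (room s) w -> excess s w p = 0) ->
  star_formula s p = seg (center (room s)) (center (s `\ v)%fset) a.
Proof.
move=> vs cv pa h; rewrite /star_formula (big_fsetD1 v)//= cv pa.
rewrite big_seq big1 ?addr0; last first.
  move=> w; rewrite !inE => /andP[wv ws]; case: ifP => [cw|_]; last by rewrite scale0r.
  by rewrite /progress h// mul0r scale0r.
by rewrite /seg scalerBr scalerBl scale1r addrCA addrC.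
Qed.

Lemma star_formula_center s p :
  (forall w, w \in s -> 0 < weight (room s) w -> excess s w p = 0) ->
  star_formula s p = center (room s).
Proof.
move=> h; rewrite /star_formula big_seq big1 ?addr0// => w ws.
by case: ifP => [cw|_]; rewrite ?scale0r// /progress h// mul0r scale0r.
Qed.

Lemma dual_rho_star s p : T s -> #|` s| = n.+1 -> (0 < n)%N -> hull s p -> U p ->
  dual_rho p = star_formula s p.
Proof.
move=> Ts sn n0 sp Up; have Xp := U_X Up.
have ps : (supp p `<=` s)%fset by apply/(hull_suppP hT Ts Xp).
have [e|ne] := eqVneq (supp p) s.
  have ex0 w : w \in s -> 0 < weight (room s) w -> ~~ toward p w -> excess s w p = 0.
    move=> ws cw; rewrite toward_excess ?e//.
    by rewrite lt_def excess_ge0 andbT negbK => /eqP.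
  have [[v [pv _ ->]]|[np _ ->]] := dual_cases p; rewrite e; last first.
    by rewrite star_formula_center// => w ws cw; exact: ex0.
  have [_ _ vp cv _] := towardP _ _ pv; rewrite e in vp cv.
  rewrite (star_formula_at vp cv (erefl _))// => w ws wv cw; apply: ex0 => //.
  by apply: contra wv => pw; rewrite (toward_unique pv pw).
have lt_pn : (#|` supp p| <= n)%N.
  by rewrite -ltnS -sn; apply: fproper_ltn_card; rewrite fproperEneq ne.
rewrite (dual_vertex (no_toward Xp lt_pn)).2.
have [s0p|s0p] := boolP (s0 `<=` supp p)%fset.
  have rs : room s = s0 by rewrite /room (fsubset_trans s0p ps).
  rewrite star_formula_center; first by rewrite rs /room s0p.
  move=> v vs; rewrite weight_gt0 rs => vs0.
  have [w] : exists w, w \in (s `\` supp p)%fset.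
    apply/fset0Pn; rewrite fsetD_eq0; apply/negP => /fsubset_leq_card.
    by rewrite leqNgt sn ltnS lt_pn.
  rewrite inE => /andP[wp ws]; apply: (excess_eq0 ws).
    by apply: contra wp => /eqP ->; exact: (fsubsetP s0p).
  rewrite rs (coordinates_out hT Xp wp) mulr0.
  have [h _ _ _] := center_barycentric s0_simplex.
  rewrite mulr_ge0 ?h//.
  exact: (coordinates_ge0 hT).
have pn : #|` supp p| = n.
  have /U_supp[_ [h|h]] := Up; first by rewrite h in s0p.
  by apply/eqP; rewrite eqn_leq lt_pn h.
have [v [vs pE cv]] := opposite_vertex Ts sn ps pn s0p.
have pv0 : coords p v = 0.
  by apply: (coordinates_out hT Xp); rewrite pE !inE eqxx.
have ex_gt0 : 0 < excess s v p.
  rewrite /excess big_seq; apply: prodr_gt0 => w; rewrite !inE => /andP[wv ws].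
  rewrite pv0 mul0r subr0 lt_max; apply/orP; right; rewrite mulr_gt0//.
  by rewrite -(mem_supp hT)// pE !inE wv.
rewrite (star_formula_at vs cv (a := 1)).
- by rewrite seg1 pE; have [_ _ _ ->] := facetP Ts sn n0 vs cv.
- by rewrite /progress pv0 add0r divff// gt_eqF.
- move=> w ws wv cw; apply: (excess_eq0 (w := v)) => //; first by rewrite eq_sym.
  by rewrite pv0 mulr0 mulr_ge0 ?(coordinates_ge0 hT)// ltW.
Qed.

(** The denominator vanishes only if two coordinates do, one of which at a vertex
    of positive weight: then the point is in a removed simplex. *)
Lemma star_denominator s v u : T s -> #|` s| = n.+1 -> hull s u -> U u ->
  v \in s -> 0 < weight (room s) v -> coords u v + excess s v u != 0.
Proof.
move=> Ts sn su Uu vs cv; have Xu := U_X Uu.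
have v0 := coordinates_ge0 hT v Xu; have ex0 := excess_ge0 s v u.
apply/eqP => sum0; have uv0 : coords u v = 0 by lra.
have : excess s v u = 0 by lra.
move/eqP; rewrite /excess prodf_seq_eq0 => /hasP[w]; rewrite !inE => /andP[wv ws] /=.
rewrite uv0 mul0r subr0 => /eqP max0.
have : weight (room s) v * coords u w <= 0 by rewrite -max0 le_max lexx orbT.
rewrite pmulr_rle0// => uw_le0.
have uw0 : coords u w = 0 by have := coordinates_ge0 hT w Xu; lra.
have out a : coords u a = 0 -> a \notin supp u by move=> e; rewrite (mem_supp hT)// e ltxx.
have usub : (supp u `<=` (s `\ v) `\ w)%fset.
  apply/fsubsetP => a au; rewrite !inE.
  have -> : a \in s by apply: fsubsetP au; apply/(hull_suppP hT Ts Xu).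
  rewrite andbT; apply/andP; split.
    by apply: contraL au => /eqP ->; exact: out.
  by apply: contraL au => /eqP ->; exact: out.
have un : (#|` supp u| < n)%N.
  have le_u := fsubset_leq_card usub.
  have [nE] : n.+1 = (#|` ((s `\ v) `\ w)%fset|).+2.
    by rewrite -sn (cardfsD1 v) vs (cardfsD1 w (s `\ v)%fset) !inE wv ws.
  by rewrite nE ltnS.
have /U_supp[_ [s0u|h]] := Uu; last by rewrite leqNgt un in h.
have rs : room s = s0.
  by rewrite /room (fsubset_trans s0u) ?(fsubset_trans usub)//
    (fsubset_trans (fsubD1set _ _))// fsubD1set.
move: cv; rewrite weight_gt0 rs => vs0.
by have := out _ uv0; rewrite (fsubsetP s0u).
Qed.

Lemma star_formula_near s u (A : set E) : T s -> #|` s| = n.+1 -> hull s u ->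
  U u -> nbhs (star_formula s u) A ->
  \forall p \near u, hull s p -> A (star_formula s p).
Proof.
move=> Ts sn su Uu nA.
have ex v : exists f : E -> R, continuous f /\ forall p, hull s p -> coords p v = f p.
  by have [f cf fE] := coordinate_function hT v Ts; exists f.
have [f fP] := choice ex.
pose g v p : R := \prod_(w <- (s `\ v)%fset)
  Num.max 0 (weight (room s) v * f w p - f v p * weight (room s) w).
have gE v p : hull s p -> excess s v p = g v p.
  by move=> sp; apply: eq_bigr => w _; rewrite !(fP _).2.
have cg v : continuous (g v).
  apply: continuous_prod => w; apply: (continuous_maxr (f := fun=> 0)).
    exact: cst_continuous.
  have c1 : continuous (fun p : E => weight (room s) v * f w p).
    by apply: (continuous_mulr (f := fun=> _)) (fP w).1; exact: cst_continuous.
  have c2 : continuous (fun p : E => f v p * weight (room s) w).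
    by apply: (continuous_mulr (fP v).1 (g := fun=> _)); exact: cst_continuous.
  by move=> p; exact: (cvgB (c1 p) (c2 p)).
pose h v p : R := if 0 < weight (room s) v then g v p / (f v p + g v p) else 0.
have ch v : {for u, continuous (h v)}.
  have [cv|/negPf ncv] := boolP (0 < weight (room s) v); last first.
    by rewrite /h ncv; exact: cst_continuous.
  rewrite /h cv.
  have vs : v \in s.
    by rewrite weight_gt0 in cv; apply: fsubsetP cv; exact: room_sub.
  have den : f v u + g v u != 0.
    by rewrite -(fP v).2// -gE//; exact: star_denominator.
  apply: (cvgM (cg v u)); apply: (cvgV den).
  exact: (cvgD ((fP v).1 u) (cg v u)).
pose d v := center (s `\ v)%fset - center (room s).
pose F p := center (room s) + \sum_(v <- s) h v p *: d v.
have cF : {for u, continuous F}.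
  suff cS (r : seq E) : (\sum_(v <- r) h v p *: d v) @[p --> u] -->
      \sum_(v <- r) h v u *: d v by exact: (cvgD (cvg_cst _) (cS s)).
  elim: r => [|v r IHr].
    rewrite big_nil (_ : (fun p => _) = fun=> 0); first exact: cst_continuous.
    by apply/funext => p; rewrite big_nil.
  rewrite big_cons (_ : (fun p => _) = (fun p => h v p *: d v + \sum_(w <- r) h w p *: d w)).
    exact: (cvgD (cvgZ (ch v) (cvg_cst _)) IHr).
  by apply/funext => p; rewrite big_cons.
have FE p : hull s p -> star_formula s p = F p.
  move=> sp; rewrite /star_formula /F; congr (_ + _); apply: eq_bigr => v _.
  by rewrite /h /progress gE// (fP v).2.
rewrite FE// in nA; have := cF _ nA; rewrite nbhs_simpl /=.
by apply: filterS => p Ap sp; rewrite FE.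
Qed.

Lemma dual_rho_continuous : {within U, continuous dual_rho}.
Proof.
apply/within_continuousP => u Uu A nA; have Xu := U_X Uu.
suff : \forall p \near u, X p -> U p -> A (dual_rho p).
  by apply: filterS => p hp Up; apply: hp => //; exact: U_X.
apply: (near_simplices hT Xu) => s Ts su.
have [/andP[n0 /eqP sn]|flat] := boolP ((0 < n)%N && (#|` s| == n.+1)).
  rewrite (dual_rho_star Ts) // in nA.
  have := star_formula_near Ts sn su Uu nA.
  by apply: filterS => p hp sp Up; rewrite (dual_rho_star Ts sn n0 sp Up); exact: hp.
have nsub := near_supp hT Ts su; apply: filterS nsub => p sub sp Up.
have Xp := U_X Up; have {}sub := sub sp.
have no q : X q -> hull s q -> forall v, ~~ toward q v.
  move=> Xq sq v; apply/negP => /towardP[n0 qn _ _ _].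
  by move: flat; rewrite n0 -(top_supp Ts sq qn) qn eqxx.
have roomE : room (supp p) = room (supp u).
  rewrite /room; have [s0u|s0u] := boolP (s0 `<=` supp u)%fset.
    by rewrite (fsubset_trans s0u sub).
  suff e : supp u = supp p by rewrite -e (negPf s0u).
  apply/eqP; rewrite eqEfcard sub /=.
  have ps : (supp p `<=` s)%fset by apply/(hull_suppP hT Ts Xp).
  apply: (leq_trans (fsubset_leq_card ps)).
  have u0 : (0 < #|` supp u|)%N by rewrite cardfs_gt0; exact: (supp_neq0 hT).
  have nu : (n <= #|` supp u|)%N.
    by have /U_supp[_ [h|//]] := Uu; rewrite h in s0u.
  have := dimT Ts; rewrite leq_eqVlt ltnS => /orP[/eqP sn|h]; last exact: leq_trans nu.
  move: flat; rewrite sn eqxx andbT -leqNgt leqn0 => /eqP n0.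
  by rewrite n0.
rewrite (dual_vertex (no p Xp sp)).2 roomE -(dual_vertex (no u Xu su)).2.
exact: nbhs_singleton.
Qed.

(** * The retraction *)

Lemma center_pos t : T t -> room t = t -> dual_pos (center t) = Vertex t.
Proof.
move=> Tt rt; suff no v : ~~ toward (center t) v.
  by rewrite (dual_vertex no).1 center_supp// rt.
apply/negP => /towardP[n0]; rewrite center_supp// center_coords// rt => tn vt _ h.
have [w] : exists w, w \in (t `\ v)%fset.
  by apply/fset0Pn; rewrite -cardfs_gt0; move: tn; rewrite (cardfsD1 v) vt add1n => -[->].
by rewrite !inE => /andP[wv wt]; have := h w wt wv; rewrite ltxx.
Qed.

Lemma occurring_edgeP i j : occurring_edge U dual_pos i j ->
  exists t v, [/\ T t, #|` t| = n.+1, (0 < n)%N, v \in t & 0 < weight (room t) v] /\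
    i = room t /\ j = (t `\ v)%fset.
Proof.
move=> [u Uu uE]; have [[v [uv pE _]]|[_ pE _]] := dual_cases u; last by rewrite pE in uE.
have [n0 un vu cv _] := towardP _ _ uv.
rewrite uE in pE; case: pE => -> ->; exists (supp u), v; split=> //; split=> //.
exact: (supp_simplex hT (U_X Uu)).
Qed.

Lemma dual_rho_hull u : U u -> hull (supp u) (dual_rho u).
Proof.
move=> Uu; have Xu := U_X Uu; have Tu := supp_simplex hT Xu.
have hr := hullS (room_sub (supp u)) (center_hull (room_simplex Tu)).
have [[v [uv _ ->]]|[_ _ ->//]] := dual_cases u.
have [n0 un vu cv _] := towardP _ _ uv.
have [TF _ _ _] := facetP Tu un n0 vu cv.
apply: hull_segment => //; first exact: (hullS (fsubD1set _ v) (center_hull TF)).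
by have := progress_itv Xu uv; lra.
Qed.

Lemma dual_rho_U u : U u -> U (dual_rho u).
Proof.
move=> Uu; have Xu := U_X Uu; have Tu := supp_simplex hT Xu.
have [[v [uv _ ->]]|[_ _ ->]] := dual_cases u; last exact: center_room_U.
have [n0 un vu cv _] := towardP _ _ uv.
by have [] := edge_point Tu un n0 vu cv (progress_itv Xu uv).
Qed.

Theorem dual_graph_retraction : graph_retraction U dual_pos center dual_rho.
Proof.
split.
- exact: dual_stratified.
- exact: dual_rho_continuous.
- move=> u r Uu /in_segment r01; have [r1|r1] := ltP r 1.
    by apply: seg_U; [|exact: dual_rho_hull|lra].
  have -> : r = 1 by lra.
  by rewrite seg1; exact: dual_rho_U.
- move=> u v Uu uv; have [[w [_ pE _]]|[_ pE ->]] := dual_cases u; rewrite uv in pE => //.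
  by case: pE => ->.
- move=> u i j Uu uE; have [[v [uv pE ->]]|[_ pE _]] := dual_cases u; rewrite uE in pE => //.
  by case: pE => -> ->; exists (progress (supp u) v u) => //; exact: progress_itv (U_X Uu) uv.
- move=> v [u Uu uv]; have [[w [_ pE _]]|[_ pE _]] := dual_cases u; rewrite uv in pE => //.
  case: pE => ->; apply: center_pos; last exact: roomK.
  exact: room_simplex (supp_simplex hT (U_X Uu)).
- move=> i j /occurring_edgeP[t [v [[Tt tn n0 vt cv] [-> ->]]]].
  have [TF Fn _ rF] := facetP Tt tn n0 vt cv.
  by split; apply: center_pos => //; [exact: room_simplex|exact: roomK].
- move=> i j r /[dup] ij /occurring_edgeP[t [v [[Tt tn n0 vt cv] [iE jE]]]] /in_segment r01.
  have [TF Fn _ rF] := facetP Tt tn n0 vt cv; rewrite iE jE.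
  have [r0|r0] := leP r 0.
    have -> : r = 0 by lra.
    rewrite seg0; have := center_room_U; move: ij => [u Uu uE] /(_ u Uu).
    have [[w [uw pE _]]|[_ pE _]] := dual_cases u; rewrite uE in pE => //.
    by case: pE => <- _; rewrite iE.
  have [r1|r1] := ltP r 1.
    by have [|//] := edge_point (r := r) Tt tn n0 vt cv; lra.
  have -> : r = 1 by lra.
  rewrite seg1; apply/U_supp; split; first exact: center_X.
  by rewrite center_supp// Fn; right.
- move=> i j r /occurring_edgeP[t [v [[Tt tn n0 vt cv] [-> ->]]]] r01.
  have [_ sE pv] := edge_point Tt tn n0 vt cv r01.
  by rewrite (dual_edge pv).1 sE.
Qed.

Lemma x_U : U x.
Proof. by apply/U_supp; split=> //; left; exact: fsubset_refl. Qed.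

Lemma dual_root : U (center s0) /\ dual_pos (center s0) = Vertex s0.
Proof.
split; first by rewrite center_s0; exact: x_U.
by apply: center_pos; [exact: s0_simplex|rewrite /room fsubset_refl].
Qed.

Lemma U_zariski : zariski_open n X U.
Proof.
split; first exact: U_X.
  exists (interior (U `|` ~` X)); first exact: open_interior.
  apply/seteqP; split=> u; last first.
    by move=> [Xu /interior_subset[]].
  move=> Uu; have Xu := U_X Uu; split=> //.
  suff : \forall p \near u, X p -> U p.
    by apply: filterS => p hp; have [/hp|] := pselect (X p); [left|right].
  apply: (near_simplices hT Xu) => s Ts su.
  have := near_supp hT Ts su; apply: filterS => p sub sp.
  have Xp := hull_sub hT Ts sp; have {}sub := sub sp.
  apply/U_supp; split=> //; have /U_supp[_ [h|h]] := Uu.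
    by left; exact: fsubset_trans sub.
  by right; exact: leq_trans (fsubset_leq_card sub).
exists T, removed; split=> //.
- split; first by move=> s [].
  move=> s t [Ts sn nx] ts t0; split; first exact: simplex_face Ts ts t0.
    exact: leq_ltn_trans (fsubset_leq_card ts) sn.
  by move=> /(hullS ts).
- rewrite setDD; apply/esym/setIidr.
  by case: hT => _ _ <- p [s [Ts _ _] sp]; exists s.
- by move=> s d [[Ts sn _] sd]; rewrite addn2 -sd.
Qed.

End DualGraph.

Theorem lemma2p1 (R : realType) (N n : nat) (X : set 'rV[R]_N)
    (K : set {fset 'rV[R]_N}) (o : n.+1.-tuple 'rV[R]_N -> bool)
    (X_pm : irreducible_pseudomanifold n X K) (K_oriented : orientation K o)
    (x : 'rV[R]_N) (Xx : X x) (V : set 'rV[R]_N)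
    (V_zariski : zariski_open n X V) (Vx : V x) :
  exists U : set 'rV[R]_N,
    [/\ zariski_open n X U, U x, U `<=` V &
        exists2 G : groupType, free_group G & K_pi_1 R G U].
Proof.
have [_ _ [T [M [hT [MT _] XV M_small]]]] := V_zariski.
have dimT := triangulation_dimension X_pm hT.
exists (X `\` carrier (removed n T x)); split.
- exact: (U_zariski n hT Xx).
- exact: (x_U n hT Xx).
- move=> u [Xu nu]; apply: contrapT => nVu; apply: nu.
  have [s Ms su] : carrier M u by rewrite XV.
  exists s => //; split; first exact: MT.
    have s0 : (0 < #|` s|)%N by rewrite cardfs_gt0; exact: (simplex_neq0 hT (MT _ Ms)).
    by have := M_small s #|` s|.-1; rewrite /is_simplex prednK// addn2 prednK//; apply.
  move=> sx; have : carrier M x by exists s.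
  by rewrite XV => -[].
- have [Uroot proot] := dual_root n hT Xx.
  apply: (graph_K_pi_1 (dual_graph_retraction hT dimT Xx) Uroot proot).
  apply: (complement_connected X_pm hT) => s; first by case.
  by case.
Qed.
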